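(* Let $\omega$ be a non-quasianalytic subadditive weight function. For every $u\in\mathcal{S}'_\omega(\mathbb{R}^d)$ we have $\mathrm{WF}'_\omega(u)=\emptyset$ if and only if $u\in\mathcal{S}_\omega(\mathbb{R}^d)$.
   Context: A non-quasianalytic subadditive weight function is a continuous increasing $\omega:[0,+\infty)\to[0,+\infty)$ with: $(\alpha)$ $\omega(t_1+t_2)\le\omega(t_1)+\omega(t_2)$ for all $t_1,t_2\ge0$; $(\beta)$ $\int_1^{+\infty}\omega(t)t^{-2}dt<+\infty$; $(\gamma)$ $\log t=o(\omega(t))$ as $t\to+\infty$; $(\delta)$ $t\mapsto\omega(e^t)$ is convex. For vectors $\zeta$, $\omega(\zeta):=\omega(|\zeta|)$. Fourier transform: $\hat f(\xi)=\int_{\mathbb{R}^d}e^{-i\langle x,\xi\rangle}f(x)dx$. $\mathcal{S}_\omega(\mathbb{R}^d)$ is the set of Schwartz functions $u$ such that for all $\lambda>0$ and all multi-indices $\alpha$, $\sup_x e^{\lambda\omega(x)}|D^\alpha u(x)|<\infty$ and $\sup_\xi e^{\lambda\omega(\xi)}|D^\alpha\hat u(\xi)|<\infty$, with $D^\alpha=(-i)^{|\alpha|}\partial^\alpha$; it is a Fréchet space with these seminorms, and $\mathcal{S}'_\omega(\mathbb{R}^d)$ is its dual. The bracket $\langle u,\psi\rangle$ for $u\in\mathcal{S}'_\omega$, $\psi\in\mathcal{S}_\omega$ is conjugate linear in $\psi$ and consistent with $\langle f,g\rangle=\int f\bar g$. For $z=(x,\xi)\in\mathbb{R}^{2d}$,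 $\Pi(z)f(y)=e^{i\langle y,\xi\rangle}f(y-x)$. For a window $\varphi\in\mathcal{S}_\omega(\mathbb{R}^d)\setminus\{0\}$ and $f\in\mathcal{S}'_\omega(\mathbb{R}^d)$, the short-time Fourier transform is $V_\varphi f(z)=\langle f,\Pi(z)\varphi\rangle$. $\mathrm{WF}'_\omega(u)$: given a window $\varphi\in\mathcal{S}_\omega(\mathbb{R}^d)\setminus\{0\}$, a point $z_0\in\mathbb{R}^{2d}\setminus\{0\}$ is not in $\mathrm{WF}'_\omega(u)$ if there is an open conic set $\Gamma\subseteq\mathbb{R}^{2d}\setminus\{0\}$ containing $z_0$ with $\sup_{z\in\Gamma}e^{\lambda\omega(z)}|V_\varphi u(z)|<+\infty$ for all $\lambda>0$. (This set does not depend on the choice of $\varphi$.) *)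

(* Defs.v *)
From HB Require Import structures.
From mathcomp Require Import all_boot all_order all_algebra.
From mathcomp Require Import all_classical all_reals all_analysis.
From mathcomp Require Import complex.

Set Implicit Arguments.
Unset Strict Implicit.
Unset Printing Implicit Defensive.

Import Order.TTheory GRing.Theory Num.Theory.
Import numFieldNormedType.Exports.

Local Open Scope classical_set_scope.
Local Open Scope ring_scope.

(* Lebesgue measure on R^n, built by induction on n as the image of
   lebesgue_measure \x (Lebesgue measure on R^n) under (x, t) |-> x :: t. *)
Section lebesgue_step.
Context {R : realType} (n : nat).
Local Notation mR := (measurableTypeR R).
Variable mu : {sigma_finite_measure set (n.-tuple mR) -> \bar R}.

Definition tcons (p : mR * n.-tuple mR) : n.+1.-tuple mR :=
  [tuple of p.1 :: p.2].

Definition tuncons (t : n.+1.-tuple mR) : mR * n.-tuple mR :=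
  (tnth t ord0, [tuple of behead t]).

Lemma tconsK : cancel tcons tuncons.
Proof.
by move=> [x t]; congr (_, _); apply: val_inj.
Qed.

Lemma measurable_tcons : measurable_fun [set: mR * n.-tuple mR] tcons.
Proof. exact: measurable_cons. Qed.

Lemma measurable_tuncons : measurable_fun [set: n.+1.-tuple mR] tuncons.
Proof.
apply/measurable_fun_pairP; split.
- exact: measurable_tnth.
- exact: measurable_behead.
Qed.

Definition lebesgue_step : set (n.+1.-tuple mR) -> \bar R :=
  pushforward (lebesgue_measure \x mu)%E tcons.

Let step0 : lebesgue_step set0 = 0%E.
Proof. by rewrite /lebesgue_step /pushforward preimage_set0 measure0. Qed.

Let step_ge0 A : (0 <= lebesgue_step A)%E.
Proof. by rewrite /lebesgue_step /pushforward measure_ge0. Qed.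

Let step_sigma_additive : semi_sigma_additive lebesgue_step.
Proof.
move=> F mF tF mUF; rewrite /lebesgue_step /pushforward preimage_bigcup.
have mpre B : measurable B -> measurable (tcons @^-1` B).
  by move=> mB; rewrite -[X in measurable X]setTI; exact: measurable_tcons.
apply: measure_semi_sigma_additive.
- by move=> k; exact: mpre.
- apply/trivIsetP => /= i j _ _ ij; rewrite -preimage_setI.
  by move/trivIsetP : tF => /(_ _ _ _ _ ij) ->//; rewrite preimage_set0.
- by rewrite -preimage_bigcup; exact: mpre.
Qed.

HB.instance Definition _ := isMeasure.Build _ _ _ lebesgue_step
  step0 step_ge0 step_sigma_additive.

Let step_sigma_finite : sigma_finite setT lebesgue_step.
Proof.
have /sigma_finiteP[F [TF ndF Foo]] := sigma_finiteT (@lebesgue_measure R).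
have /sigma_finiteP[G [TG ndG Goo]] := sigma_finiteT mu.
exists (fun k => tuncons @^-1` (F k `*` G k)).
  rewrite -preimage_bigcup (_ : \bigcup_k _ = setT) ?preimage_setT//.
  rewrite -setXTT TF TG predeqE => -[x y]; split.
    by move=> [n1 _ []/= ? ?]; split; exists n1.
  move=> [/= [n1 _ Fnx] [k _ Gky]]; exists (maxn n1 k) => //; split.
  - by move: x Fnx; exact/subsetPset/ndF/leq_maxl.
  - by move: y Gky; exact/subsetPset/ndG/leq_maxr.
move=> k; have [mF Fkoo] := Foo k; have [mG Gkoo] := Goo k; split.
  rewrite -[X in measurable X]setTI; apply: measurable_tuncons => //.
  exact: measurableX.
rewrite /lebesgue_step /pushforward -comp_preimage.
rewrite (_ : tuncons \o tcons = id); last by apply/funext => p; exact: tconsK.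
rewrite preimage_id product_measure1E//.
by rewrite lte_mul_pinfty// ge0_fin_numE.
Qed.

HB.instance Definition _ := Measure_isSigmaFinite.Build _ _ _ lebesgue_step
  step_sigma_finite.

End lebesgue_step.

Fixpoint lebesgue_tuple (R : realType) (n : nat) :
    {sigma_finite_measure set (n.-tuple (measurableTypeR R)) -> \bar R} :=
  match n with
  | 0 => \d_([tuple] : 0.-tuple (measurableTypeR R))
  | n'.+1 => lebesgue_step (lebesgue_tuple R n')
  end.

(* Normalisation: the measure of a box is the product of the side measures. *)
Lemma lebesgue_tuple_box (R : realType) (n : nat)
    (A : 'I_n -> set (measurableTypeR R)) :
  (forall i, measurable (A i)) ->
  lebesgue_tuple R n [set t | forall i, A i (tnth t i)] =
  (\prod_(i < n) lebesgue_measure (A i))%E.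
Proof.
elim: n A => [|n IHn] A mA.
  rewrite big_ord0 /= diracE mem_set //=.
  by case.
have mbox : measurable [set t : n.-tuple (measurableTypeR R) |
    forall i, A (lift ord0 i) (tnth t i)].
  rewrite (_ : [set _ | _] = \bigcap_(i in [set: 'I_n])
      ((fun t => tnth t i) @^-1` A (lift ord0 i))).
    apply: fin_bigcap_measurable => // i _.
    by rewrite -[X in measurable X]setTI; exact: measurable_tnth.
  by apply/seteqP; split=> t /= h i; [move=> _; exact: h | exact: h].
rewrite big_ord_recl /= -IHn //= /lebesgue_step /pushforward.
rewrite -product_measure1E //; congr (product_measure1 _ _ _).
apply/seteqP; split => -[x t] /=.
  move=> h; split; first exact: (h ord0).
  by move=> i; have := h (lift ord0 i); rewrite tnthS.
by move=> [h0 h] i; case: (unliftP ord0 i) => [j ->|->//]; rewrite tnthS.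
Qed.

Section Weight.
Context {R : realType}.

(* w : [0,+oo[ -> [0,+oo[ is represented by a function on R whose values on
   negative arguments are irrelevant. *)
Record nonquasianalytic_subadditive_weight (w : R -> R) : Prop := {
  weight_ge0 : forall t, 0 <= t -> 0 <= w t;
  weight_continuous : {within `[0, +oo[, continuous w};
  weight_increasing : {in `[0, +oo[ &, {homo w : s t / s <= t}};
  weight_subadditive : forall t1 t2, 0 <= t1 -> 0 <= t2 ->
    w (t1 + t2) <= w t1 + w t2;
  weight_nonquasianalytic :
    (\int[lebesgue_measure]_(t in `[1%R, +oo[) (w t / t ^+ 2)%:E < +oo)%E;
  weight_log : @ln R =o_ (FilterType (pinfty_nbhs R) _) w;
  weight_convex : convex_function [set: R^o] (w \o @expR R)
}.

End Weight.

Section Spaces.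
Context {R : realType}.
Local Open Scope complex_scope.
Local Notation C := R[i].
Local Notation normc := (@Normc.normc R).

Definition dotv n (x y : 'rV[R]_n) : R := \sum_(i < n) x 0 i * y 0 i.

(* the library's `|x| on row vectors is the sup norm *)
Definition enorm n (x : 'rV[R]_n) : R := Num.sqrt (dotv x x).

Definition expi (t : R) : C := cos t +i* sin t.

Definition cintegral n (f : 'rV[R]_n -> C) : C :=
  (\int[lebesgue_tuple R n]_t complex.Re (f (\row_i tnth t i))) +i*
  (\int[lebesgue_tuple R n]_t complex.Im (f (\row_i tnth t i))).

Definition fourier n (f : 'rV[R]_n -> C) (xi : 'rV[R]_n) : C :=
  cintegral (fun x => expi (- dotv x xi) * f x).

Definition partial n (i : 'I_n) (f : 'rV[R]_n -> C) (x : 'rV[R]_n) : C :=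
  ('D_(delta_mx 0 i) (fun y => complex.Re (f y)) x) +i*
  ('D_(delta_mx 0 i) (fun y => complex.Im (f y)) x).

Definition multi_index (n : nat) : Type := {ffun 'I_n -> nat}.

Definition mabs n (a : multi_index n) : nat := \sum_(i < n) a i.

Definition mpartial n (a : multi_index n) (f : 'rV[R]_n -> C) :
    'rV[R]_n -> C :=
  foldr (fun i g => iter (a i) (partial i) g) f (enum 'I_n).

(* 0 -i* 1 is -i *)
Definition mD n (a : multi_index n) (f : 'rV[R]_n -> C) (x : 'rV[R]_n) : C :=
  (0 -i* 1) ^+ mabs a * mpartial a f x.

Definition mmonomial n (b : multi_index n) (x : 'rV[R]_n) : R :=
  \prod_(i < n) x 0 i ^+ b i.

(* All iterated partial derivatives, in any order, exist and are continuous. *)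
Definition smooth n (f : 'rV[R]_n -> C) : Prop :=
  forall s : seq 'I_n, let g := foldr (@partial n) f s in
    [/\ continuous (fun x => complex.Re (g x)), continuous (fun x => complex.Im (g x)) &
      forall (i : 'I_n) (x : 'rV[R]_n),
        derivable (fun y => complex.Re (g y)) x (delta_mx 0 i) /\
        derivable (fun y => complex.Im (g y)) x (delta_mx 0 i)].

Definition schwartz n (f : 'rV[R]_n -> C) : Prop :=
  smooth f /\ forall a b : multi_index n,
    has_ubound (range (fun x => `|mmonomial b x| * normc (mD a f x))).

Definition weighted (w : R -> R) n (l : R) (a : multi_index n)
    (f : 'rV[R]_n -> C) (x : 'rV[R]_n) : R :=
  expR (l * w (enorm x)) * normc (mD a f x).

Definition S_omega (w : R -> R) n (f : 'rV[R]_n -> C) : Prop :=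
  schwartz f /\ forall (l : R) (a : multi_index n), 0 < l ->
    has_ubound (range (weighted w l a f)) /\
    has_ubound (range (weighted w l a (fourier f))).

Definition seminorm (w : R -> R) n (l : R) (a : multi_index n)
    (f : 'rV[R]_n -> C) : R := sup (range (weighted w l a f)).

(* Elements of the dual of S_omega: continuous linear functionals. They are
   represented by functions on all of 'rV[R]_n -> C whose values outside
   S_omega are irrelevant. Continuity is spelled out for the locally convex
   topology generated by the seminorms. *)
Record S_omega_dual (w : R -> R) n (u : ('rV[R]_n -> C) -> C) : Prop := {
  dual_linear : forall (c : C) (f g : 'rV[R]_n -> C),
    S_omega w f -> S_omega w g ->
    u (fun x => c * f x + g x) = c * u f + u g;
  dual_continuous : forall f : 'rV[R]_n -> C, S_omega w f ->
    forall e : R, 0 < e ->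
    exists (s : seq (R * multi_index n)) (del : R),
      [/\ 0 < del, forall k, k \in s -> 0 < k.1 &
        forall g : 'rV[R]_n -> C, S_omega w g ->
          (forall k, k \in s ->
             seminorm w k.1 k.2 (fun x => g x - f x) < del /\
             seminorm w k.1 k.2 (fourier (fun x => g x - f x)) < del) ->
          normc (u g - u f) < e]
}.

Definition bracket n (u : ('rV[R]_n -> C) -> C) (psi : 'rV[R]_n -> C) : C :=
  u (fun x => conjc (psi x)).

(* u in S'_omega is (identified with) an element f of S_omega. *)
Definition in_S_omega (w : R -> R) n (u : ('rV[R]_n -> C) -> C) : Prop :=
  exists2 f : 'rV[R]_n -> C, S_omega w f &
    forall psi : 'rV[R]_n -> C, S_omega w psi ->
      bracket u psi = cintegral (fun x => f x * conjc (psi x)).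

(* R^{2d} is 'rV_(d + d), with z = (x, xi) = row_mx x xi. *)
Definition tf_shift n (z : 'rV[R]_(n + n)) (f : 'rV[R]_n -> C)
    (y : 'rV[R]_n) : C :=
  expi (dotv y (rsubmx z)) * f (y - lsubmx z).

Definition window (w : R -> R) n (phi : 'rV[R]_n -> C) : Prop :=
  S_omega w phi /\ phi <> cst 0.

Definition stft n (phi : 'rV[R]_n -> C) (u : ('rV[R]_n -> C) -> C)
    (z : 'rV[R]_(n + n)) : C := bracket u (tf_shift z phi).

Definition conic m (G : set 'rV[R]_m) : Prop :=
  forall (t : R) (z : 'rV[R]_m), 0 < t -> G z -> G (t *: z).

Definition WF' (w : R -> R) n (phi : 'rV[R]_n -> C)
    (u : ('rV[R]_n -> C) -> C) : set 'rV[R]_(n + n) :=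
  [set z0 | z0 != 0 /\
    ~ exists G : set 'rV[R]_(n + n),
      [/\ open G, conic G, G `<=` [set z | z != 0], G z0 &
        forall l : R, 0 < l ->
          has_ubound [set expR (l * w (enorm z)) * normc (stft phi u z)
                     | z in G]]].

End Spaces.

(* Main.v *)
Require Import Defs.
From HB Require Import structures.
From mathcomp Require Import all_boot all_order all_algebra.
From mathcomp Require Import all_classical all_reals all_analysis.
From mathcomp Require Import complex measurable_realfun lebesgue_integral_under.
From mathcomp Require Import ring lra.

(* If the wave front set is empty, finitely many cones on which V_phi u decays faster than
   every exp(-l w) cover the unit sphere, so V_phi u decays in this way on all of R^{2d}.
   Then f = c \int V_phi u(z) Pi(z) phi dz, with 1/c = (2 pi)^d |phi|^2, belongs to S_omega,
   because a time-frequency shift costs only a factor exp(l w(z)) in each seminorm of phi.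
   It represents u: the inversion formula writes psi as c \int V_phi psi(z) Pi(z) phi dz and
   u commutes with this integral. The commutation needs no duality theory: the difference
   between u of the integral over a set A of phase space and the integral over A of u is
   finitely additive in A and, by continuity of u, of arbitrarily small density near every
   point, hence zero. Conversely, if u is in S_omega then V_phi u decays: in x directly, in xi
   by Parseval, and jointly by taking the geometric mean of the two bounds. *)

Set Implicit Arguments.
Unset Strict Implicit.
Unset Printing Implicit Defensive.

Import Order.TTheory GRing.Theory Num.Theory.
Import numFieldNormedType.Exports.

Local Open Scope classical_set_scope.
Local Open Scope ring_scope.

Local Notation Re := (@complex.Re _).
Local Notation Im := (@complex.Im _).
Local Notation normc := Normc.normc.

(** * Complex-valued integrals *)

(** [S_omega] bounds each D^alpha with the derivatives taken in one fixed order of the coordinates,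
    whereas inductions on derivatives remove one index at a time. So the work is done with words of
    indices ([rapid]), and mixed partials are made symmetric by Fourier inversion: derivatives of an
    inverse transform multiply its integrand by commuting factors ([S_omega_rapid]). Inversion uses
    the convergence factor exp(-|x_1| - ... - |x_n|), whose transform is an elementary product of
    Cauchy kernels; the same product is the integrable majorant of the later estimates, since
    (gamma) bounds exp(-w) by a multiple of it. Superpositions of shifts are indexed by an abstract
    measurable space with maps a and b to R^d. The Fourier transform turns a shift by (a, b) into
    one by (b, -a) up to a phase, so superpositions are stable under it and one estimate serves both
    halves of the definition of [S_omega]. V_phi u must be measurable before it can be integrated;
    this follows from continuity, because the shifts of a window depend continuously on (a, b) in
    every weighted seminorm. *)

Section complex_numbers.
Context {R : realType}.
Local Open Scope complex_scope.
Implicit Types z w : R[i].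

Lemma cReD z w : Re (z + w) = Re z + Re w. Proof. by case: z w => [a b] [c e]. Qed.
Lemma cImD z w : Im (z + w) = Im z + Im w. Proof. by case: z w => [a b] [c e]. Qed.
Lemma cReN z : Re (- z) = - Re z. Proof. by case: z. Qed.
Lemma cImN z : Im (- z) = - Im z. Proof. by case: z. Qed.
Lemma cReM z w : Re (z * w) = Re z * Re w - Im z * Im w.
Proof. by case: z w => [a b] [c e]. Qed.
Lemma cImM z w : Im (z * w) = Re z * Im w + Im z * Re w.
Proof. by case: z w => [a b] [c e]. Qed.
Lemma cReJ z : Re (conjc z) = Re z. Proof. by case: z. Qed.
Lemma cImJ z : Im (conjc z) = - Im z. Proof. by case: z. Qed.

Lemma complex_eq z w : Re z = Re w -> Im z = Im w -> z = w.
Proof. by case: z w => [a b] [c e] /= -> ->. Qed.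

Lemma normcE_ReIm z : normc z = Num.sqrt (Re z ^+ 2 + Im z ^+ 2).
Proof. by case: z. Qed.
Lemma normc_ge0 z : 0 <= normc z. Proof. by rewrite normcE_ReIm sqrtr_ge0. Qed.
Lemma normc_conj z : normc (conjc z) = normc z.
Proof. by rewrite !normcE_ReIm cReJ cImJ sqrrN. Qed.
Lemma le_Re_normc z : `|Re z| <= normc z.
Proof.
rewrite normcE_ReIm -sqrtr_sqr ler_sqrt ?lerDl ?sqr_ge0//.
by rewrite addr_ge0 ?sqr_ge0.
Qed.
Lemma le_Im_normc z : `|Im z| <= normc z.
Proof.
rewrite normcE_ReIm -sqrtr_sqr ler_sqrt ?lerDr ?sqr_ge0//.
by rewrite addr_ge0 ?sqr_ge0.
Qed.
Lemma normc_real (x : R) : normc x%:C = `|x|.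
Proof. by rewrite /= expr0n addr0 sqrtr_sqr. Qed.
Lemma sqr_normcE z : normc z ^+ 2 = Re z ^+ 2 + Im z ^+ 2.
Proof. by rewrite normcE_ReIm sqr_sqrtr// addr_ge0 ?sqr_ge0. Qed.
Lemma le_normc_ReIm z : normc z <= `|Re z| + `|Im z|.
Proof.
rewrite -(@ler_pXn2r _ 2)// ?nnegrE ?addr_ge0 ?normc_ge0//.
rewrite sqr_normcE sqrrD !real_normK ?num_real// addrAC lerDl.
by rewrite mulrn_wge0// mulr_ge0.
Qed.
Lemma normcB_le z w : normc (z - w) <= normc z + normc w.
Proof. by rewrite -(normcN w); exact: le_normcD. Qed.
Lemma normc_distC z w : normc (z - w) = normc (w - z).
Proof. by rewrite -normcN opprB. Qed.
Lemma conjcM z w : conjc (z * w) = conjc z * conjc w.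
Proof. exact: rmorphM. Qed.
Lemma mul_conjc z : z * conjc z = (normc z ^+ 2)%:C.
Proof.
apply: complex_eq; rewrite ?cReM ?cImM cReJ cImJ sqr_normcE /=; ring.
Qed.

Lemma expiD (s t : R) : expi (s + t) = expi s * expi t.
Proof. by apply: complex_eq; rewrite /= ?cosD ?sinD// addrC. Qed.
Lemma expi0 : expi (0 : R) = 1.
Proof. by rewrite /expi cos0 sin0. Qed.
Lemma expi_conj (t : R) : conjc (expi t) = expi (- t).
Proof. by rewrite /expi /= cosN sinN. Qed.
Lemma normc_expi (t : R) : normc (expi t) = 1.
Proof. by rewrite normcE_ReIm /= cos2Dsin2 sqrtr1. Qed.

End complex_numbers.

Section complex_integral.
Context {R : realType} d {T : measurableType d}.
Local Open Scope complex_scope.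
Implicit Types (f g : T -> R[i]).

Definition cmeas f := measurable_fun setT (Re \o f) /\
  measurable_fun setT (Im \o f).

Lemma cmeas_cst c : cmeas (fun=> c). Proof. by split; exact: measurable_cst. Qed.

Lemma cmeasD f g : cmeas f -> cmeas g -> cmeas (fun x => f x + g x).
Proof.
move=> [f1 f2] [g1 g2]; split.
- rewrite (_ : _ \o _ = (Re \o f) \+ (Re \o g)); first exact: measurable_funD.
  by apply/funext => x /=; rewrite cReD.
- rewrite (_ : _ \o _ = (Im \o f) \+ (Im \o g)); first exact: measurable_funD.
  by apply/funext => x /=; rewrite cImD.
Qed.

Lemma cmeasM f g : cmeas f -> cmeas g -> cmeas (fun x => f x * g x).
Proof.
move=> [f1 f2] [g1 g2]; split.
- rewrite (_ : _ \o _ = ((Re \o f) \* (Re \o g)) \- ((Im \o f) \* (Im \o g))).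
    by apply: measurable_funB; exact: measurable_funM.
  by apply/funext => x /=; rewrite cReM.
- rewrite (_ : _ \o _ = ((Re \o f) \* (Im \o g)) \+ ((Im \o f) \* (Re \o g))).
    by apply: measurable_funD; exact: measurable_funM.
  by apply/funext => x /=; rewrite cImM.
Qed.

Lemma cmeasN f : cmeas f -> cmeas (fun x => - f x).
Proof.
move=> mf; rewrite (_ : (fun _ => _) = (fun x => (-1) * f x)).
  by apply: cmeasM => //; exact: cmeas_cst.
by apply/funext => x; rewrite mulN1r.
Qed.

Lemma cmeasB f g : cmeas f -> cmeas g -> cmeas (fun x => f x - g x).
Proof. by move=> mf mg; apply: cmeasD => //; exact: cmeasN. Qed.

Lemma cmeas_conj f : cmeas f -> cmeas (fun x => conjc (f x)).
Proof.
move=> [f1 f2]; split.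
- by rewrite (_ : _ \o _ = (Re \o f))//; apply/funext => x /=; rewrite cReJ.
- rewrite (_ : _ \o _ = \- (Im \o f)); first exact: measurableT_comp.
  by apply/funext => x /=; rewrite cImJ.
Qed.

Lemma cmeas_real (f : T -> R) : measurable_fun setT f -> cmeas (fun x => (f x)%:C).
Proof. by move=> mf; split => //; exact: measurable_cst. Qed.

Lemma cmeas_expi (f : T -> R) : measurable_fun setT f ->
  cmeas (fun x => expi (f x)).
Proof.
move=> mf; split.
- apply: (@measurableT_comp _ _ _ _ _ _ (@cos R)) => //.
  by apply: continuous_measurable_fun; exact: continuous_cos.
- apply: (@measurableT_comp _ _ _ _ _ _ (@sin R)) => //.
  by apply: continuous_measurable_fun; exact: continuous_sin.
Qed.

Lemma measurable_normc f : cmeas f -> measurable_fun setT (fun x => normc (f x)).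
Proof.
move=> [f1 f2].
rewrite (_ : (fun _ => _) =
  Num.sqrt \o (fun x => (Re \o f) x ^+ 2 + (Im \o f) x ^+ 2)).
  apply: measurableT_comp.
    by apply: continuous_measurable_fun; exact: sqrt_continuous.
  by apply: measurable_funD; exact: measurable_funX.
by apply/funext => x /=; rewrite normcE_ReIm.
Qed.

Variable mu : {measure set T -> \bar R}.

Definition rint (f : T -> R) := mu.-integrable setT (EFin \o f).

Lemma rint_measurable (f : T -> R) : rint f -> measurable_fun setT f.
Proof. by move=> /integrableP[/measurable_EFinP]. Qed.

Lemma rint_le (f g : T -> R) : measurable_fun setT f ->
  (forall x, `|f x| <= g x) -> rint g -> rint f.
Proof.
move=> mf fg; apply: le_integrable => //; first exact/measurable_EFinP.
by move=> x _ /=; rewrite lee_fin; apply: (le_trans (fg x)); exact: ler_norm.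
Qed.

Lemma rintD (f g : T -> R) : rint f -> rint g -> rint (fun x => f x + g x).
Proof. by move=> If Ig; have := integrableD measurableT If Ig. Qed.

Lemma rintZ (c : R) (f : T -> R) : rint f -> rint (fun x => c * f x).
Proof. by move=> If; have := integrableZl measurableT c If. Qed.

Definition cintble f := rint (Re \o f) /\ rint (Im \o f).

(** At the measure [lebesgue_tuple R n] and the integrand [f \o @rowt R n] this is convertible to
    [cintegral f]; later casts of the form [-[LHS]/(cint ...)] rely on it. *)
Definition cint f : R[i] := (\int[mu]_x Re (f x)) +i* (\int[mu]_x Im (f x)).

Lemma cintble_cmeas f : cintble f -> cmeas f.
Proof. by move=> [f1 f2]; split; exact: rint_measurable. Qed.

Lemma cintble_le f (g : T -> R) : cmeas f -> (forall x, normc (f x) <= g x) ->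
  rint g -> cintble f.
Proof.
move=> [f1 f2] fg Ig; split; apply: rint_le Ig => // x /=.
- by apply: le_trans (fg x); exact: le_Re_normc.
- by apply: le_trans (fg x); exact: le_Im_normc.
Qed.

Lemma cintble_norm f : cintble f -> rint (fun x => normc (f x)).
Proof.
move=> If; have mf := cintble_cmeas If; case: If => f1 f2.
have := rintD (integrable_norm f1) (integrable_norm f2).
apply: rint_le; first exact: measurable_normc.
by move=> x; rewrite ger0_norm ?normc_ge0//; exact: le_normc_ReIm.
Qed.

Lemma cintbleD f g : cintble f -> cintble g -> cintble (fun x => f x + g x).
Proof.
move=> If Ig; apply: (cintble_le _ _ (rintD (cintble_norm If) (cintble_norm Ig))).
  by apply: cmeasD; exact: cintble_cmeas.
by move=> x; exact: le_normcD.
Qed.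

Lemma cintbleZ c f : cintble f -> cintble (fun x => c * f x).
Proof.
move=> If; apply: (cintble_le _ _ (rintZ (normc c) (cintble_norm If))).
  by apply: cmeasM; [exact: cmeas_cst|exact: cintble_cmeas].
by move=> x; rewrite Normc.normcM.
Qed.

Lemma cintble_conj f : cintble f -> cintble (fun x => conjc (f x)).
Proof.
move=> If; apply: (cintble_le _ _ (cintble_norm If)).
  by apply: cmeas_conj; exact: cintble_cmeas.
by move=> x; rewrite normc_conj.
Qed.

Lemma cintD f g : cintble f -> cintble g ->
  cint (fun x => f x + g x) = cint f + cint g.
Proof.
move=> [f1 f2] [g1 g2]; apply: complex_eq; rewrite /= -RintegralD//;
by apply: eq_Rintegral => x _; rewrite ?cReD ?cImD.
Qed.

Lemma cintZ c f : cintble f -> cint (fun x => c * f x) = c * cint f.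
Proof.
move=> [f1 f2]; apply: complex_eq; rewrite /= ?cReM ?cImM /= -!RintegralZl//.
- rewrite -RintegralB//; [|exact: rintZ|exact: rintZ].
  by apply: eq_Rintegral => x _; rewrite cReM.
- rewrite -RintegralD//; [|exact: rintZ|exact: rintZ].
  by apply: eq_Rintegral => x _; rewrite cImM.
Qed.

Lemma cintZr c f : cintble f -> cint (fun x => f x * c) = cint f * c.
Proof.
by move=> If; rewrite mulrC -cintZ//; congr cint; apply/funext => x; rewrite mulrC.
Qed.

Lemma cintB f g : cintble f -> cintble g ->
  cint (fun x => f x - g x) = cint f - cint g.
Proof.
move=> If Ig; rewrite -mulN1r -cintZ// -cintD//; last exact: cintbleZ.
by congr cint; apply/funext => x; rewrite mulN1r.
Qed.

Lemma cintbleB f g : cintble f -> cintble g -> cintble (fun x => f x - g x).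
Proof.
move=> If Ig; have := cintbleD If (cintbleZ (-1) Ig).
by congr cintble; apply/funext => x; rewrite mulN1r.
Qed.

Lemma cint_conj f : cintble f -> cint (fun x => conjc (f x)) = conjc (cint f).
Proof.
move=> [f1 f2]; apply: complex_eq; rewrite /=.
  by apply: eq_Rintegral => x _; rewrite cReJ.
rewrite -mulN1r -RintegralZl//.
by apply: eq_Rintegral => x _; rewrite cImJ mulN1r.
Qed.

Lemma cint0 : cint (fun=> 0) = 0.
Proof. by rewrite /cint Rintegral_cst// mul0r. Qed.

Lemma le_rint (f g : T -> R) : rint f -> rint g -> (forall x, f x <= g x) ->
  \int[mu]_x f x <= \int[mu]_x g x.
Proof. by move=> If Ig fg; apply: le_Rintegral. Qed.

(* Multiply by the conjugate of the integral, so that only a real part has to be estimated. *)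
Lemma normc_cint f : cintble f -> normc (cint f) <= \int[mu]_x normc (f x).
Proof.
move=> If; set c := cint f.
have [->|c0] := eqVneq (normc c) 0.
  by apply: Rintegral_ge0 => x _; exact: normc_ge0.
have cp : 0 < normc c by rewrite lt_neqAle eq_sym c0 normc_ge0.
have Inf := cintble_norm If.
rewrite -(ler_pM2l cp) -expr2 -RintegralZl//.
have -> : normc c ^+ 2 = Re (conjc c * c) by rewrite mulrC mul_conjc.
rewrite -cintZ//; have [I1 _] := cintbleZ (conjc c) If.
apply: le_rint => //; first exact: rintZ.
move=> x; apply: (le_trans (ler_norm _)); apply: (le_trans (le_Re_normc _)).
by rewrite Normc.normcM normc_conj.
Qed.

Lemma normc_cint_le f (g : T -> R) : cmeas f -> (forall x, normc (f x) <= g x) ->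
  rint g -> normc (cint f) <= \int[mu]_x g x.
Proof.
move=> mf fg Ig; have If := cintble_le mf fg Ig.
apply: (le_trans (normc_cint If)); apply: le_rint => //.
exact: cintble_norm.
Qed.

End complex_integral.
Arguments cmeas {R d T} f.

Lemma cmeas_comp (R : realType) d1 d2 (T1 : measurableType d1)
    (T2 : measurableType d2) (h : T1 -> T2) (f : T2 -> R[i]) :
  measurable_fun setT h -> cmeas f -> cmeas (f \o h).
Proof.
by move=> mh [f1 f2]; split; [exact: measurableT_comp f1 mh|exact: measurableT_comp f2 mh].
Qed.

(** * Fubini for functions dominated by a product *)

Section complex_fubini.
Context {R : realType} d1 d2 {T1 : measurableType d1} {T2 : measurableType d2}.
Variables (m1 : {sigma_finite_measure set T1 -> \bar R}).
Variables (m2 : {sigma_finite_measure set T2 -> \bar R}).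

Lemma rint_prodM (f : T1 -> R) (g : T2 -> R) : rint m1 f -> rint m2 g ->
  rint (m1 \x m2)%E (fun z => f z.1 * g z.2).
Proof.
move=> If Ig; have mf := rint_measurable If; have mg := rint_measurable Ig.
have mfg : measurable_fun setT (fun z : T1 * T2 => f z.1 * g z.2).
  by apply: measurable_funM; apply: measurableT_comp.
apply/integrable12ltyP => /=; first exact/measurable_EFinP.
under eq_integral => x _.
  under eq_integral => y _ do rewrite normrM EFinM.
  rewrite ge0_integralZl//; last exact/measurable_EFinP/measurableT_comp.
  over.
move: If Ig => /integrableP[_ If] /integrableP[_ Ig].
rewrite ge0_integralZr//; last 2 first.
- exact/measurable_EFinP/measurableT_comp.
- by apply: integral_ge0 => y _; rewrite lee_fin.
have I0 : (0 <= \int[m1]_x `|(f x)%:E|)%E by apply: integral_ge0.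
by apply: lte_mul_pinfty => //; rewrite ge0_fin_numE.
Qed.

Variables (a : T1 -> R) (b : T2 -> R).
Hypotheses (Ia : rint m1 a) (Ib : rint m2 b).

Let bound_section1 (f : T1 * T2 -> R) : measurable_fun setT f ->
  (forall z, `|f z| <= a z.1 * b z.2) ->
  forall x, rint m2 (fun y => f (x, y)).
Proof.
move=> mf fab x; apply: (rint_le _ _ (rintZ (a x) Ib)).
  exact: measurableT_comp.
by move=> y; exact: fab.
Qed.

Let bound_section2 (f : T1 * T2 -> R) : measurable_fun setT f ->
  (forall z, `|f z| <= a z.1 * b z.2) ->
  forall y, rint m1 (fun x => f (x, y)).
Proof.
move=> mf fab y; apply: (rint_le _ _ (rintZ (b y) Ia)).
  exact: measurableT_comp.
by move=> x; rewrite mulrC; exact: fab.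
Qed.

Let bound_rint (f : T1 * T2 -> R) : measurable_fun setT f ->
  (forall z, `|f z| <= a z.1 * b z.2) -> rint (m1 \x m2)%E f.
Proof. by move=> mf fab; exact: rint_le fab (rint_prodM Ia Ib). Qed.

(** The majorant makes every section integrable, not merely almost every one, so the inner real
    integral agrees with the extended one at each point and no null sets have to be carried
    along. *)
Lemma Rintegral_prod1 (f : T1 * T2 -> R) : measurable_fun setT f ->
  (forall z, `|f z| <= a z.1 * b z.2) ->
  rint m1 (fun x => \int[m2]_y f (x, y)) /\
  \int[(m1 \x m2)%E]_z f z = \int[m1]_x \int[m2]_y f (x, y).
Proof.
move=> mf fab; have If := bound_rint mf fab.
have FE : EFin \o (fun x => \int[m2]_y f (x, y)) = fubini_F m2 (EFin \o f).
  apply/funext => x /=; rewrite /fubini_F /Rintegral fineK//.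
  exact/integrable_fin_num/bound_section1.
split; first by rewrite /rint FE; exact: integrable_fubini_F.
by rewrite /Rintegral -integral12_prod_meas1// -FE.
Qed.

Lemma Rintegral_prod2 (f : T1 * T2 -> R) : measurable_fun setT f ->
  (forall z, `|f z| <= a z.1 * b z.2) ->
  rint m2 (fun y => \int[m1]_x f (x, y)) /\
  \int[(m1 \x m2)%E]_z f z = \int[m2]_y \int[m1]_x f (x, y).
Proof.
move=> mf fab; have If := bound_rint mf fab.
have FE : EFin \o (fun y => \int[m1]_x f (x, y)) = fubini_G m1 (EFin \o f).
  apply/funext => y /=; rewrite /fubini_G /Rintegral fineK//.
  exact/integrable_fin_num/bound_section2.
split.
  apply: (rint_le _ _ (rintZ (\int[m1]_x a x) Ib)).
    by apply/measurable_EFinP; rewrite FE; exact: (measurable_fubini_G If).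
  move=> y; have Ify := bound_section2 mf fab y.
  apply: (le_trans (le_normr_Rintegral measurableT Ify)).
  rewrite -RintegralZr//; apply: le_rint => [||x]; last exact: fab.
    exact: integrable_norm.
  by have := rintZ (b y) Ia; congr rint; apply/funext => x; rewrite mulrC.
by rewrite /Rintegral -integral21_prod_meas1// -FE.
Qed.

Section cint_prod.
Variable f : T1 * T2 -> R[i].
Hypotheses (mf : cmeas f) (fab : forall z, normc (f z) <= a z.1 * b z.2).

Let Rfab z : `|(Re \o f) z| <= a z.1 * b z.2.
Proof. by apply: (le_trans _ (fab z)); exact: le_Re_normc. Qed.
Let Ifab z : `|(Im \o f) z| <= a z.1 * b z.2.
Proof. by apply: (le_trans _ (fab z)); exact: le_Im_normc. Qed.

Lemma cintble_prod : cintble (m1 \x m2)%E f.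
Proof. by apply: cintble_le fab (rint_prodM Ia Ib). Qed.

Lemma cint_prod1 : cint (m1 \x m2)%E f = cint m1 (fun x => cint m2 (fun y => f (x, y))).
Proof.
case: mf => m1f m2f; rewrite /cint; congr Complex.
  by case: (Rintegral_prod1 m1f Rfab).
by case: (Rintegral_prod1 m2f Ifab).
Qed.

Lemma cint_prod2 : cint (m1 \x m2)%E f = cint m2 (fun y => cint m1 (fun x => f (x, y))).
Proof.
case: mf => m1f m2f; rewrite /cint; congr Complex.
  by case: (Rintegral_prod2 m1f Rfab).
by case: (Rintegral_prod2 m2f Ifab).
Qed.

Lemma cint_swap : cint m1 (fun x => cint m2 (fun y => f (x, y))) =
  cint m2 (fun y => cint m1 (fun x => f (x, y))).
Proof. by rewrite -cint_prod1 cint_prod2. Qed.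

End cint_prod.

End complex_fubini.

(** * Lebesgue measure on R^n *)

Section image_measure.
Context {R : realType} d1 d2 {X : measurableType d1} {Y : measurableType d2}.
Variables (phi : X -> Y) (mphi : measurable_fun setT phi).
Variables (mu : {measure set X -> \bar R}) (nu : {measure set Y -> \bar R}).
Hypothesis nuE : forall A, measurable A -> nu A = mu (phi @^-1` A).

Lemma ge0_integral_image (f : Y -> \bar R) : measurable_fun setT f ->
  (forall y, 0 <= f y)%E -> (\int[nu]_y f y = \int[mu]_x f (phi x))%E.
Proof.
move=> mf f0.
have := ge0_integral_pushforward mphi mu measurableT mf (fun y _ => f0 y).
rewrite preimage_setT => <-.
by apply: eq_measure_integral => A mA _; exact: nuE.
Qed.

Lemma rint_image (f : Y -> R) : measurable_fun setT f ->
  rint mu (f \o phi) ->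
  rint nu f /\ \int[nu]_y f y = \int[mu]_x f (phi x).
Proof.
move=> mf If.
have mf' : measurable_fun setT (EFin \o f) by exact/measurable_EFinP.
have Inf : rint nu f.
  apply/integrableP; split => //.
  rewrite (ge0_integral_image (f := fun y => `|(f y)%:E|%E))//.
    by move/integrableP : If => [].
  exact: measurableT_comp.
split => //; rewrite /Rintegral.
have Ep := ge0_integral_image (measurable_funepos mf') (fun y => funepos_ge0 _ y).
have En := ge0_integral_image (measurable_funeneg mf') (fun y => funeneg_ge0 _ y).
congr fine; rewrite [LHS]integralE [RHS]integralE.
rewrite Ep En.
congr (_ - _)%E; apply: eq_integral => x _.
- by rewrite !funeposE.
- by rewrite !funenegE.
Qed.

End image_measure.

(** * Affine changes of variables on the line *)

Section lebesgue_affine.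
Context {R : realType}.
Local Notation mR := (measurableTypeR R).
Local Notation leb := (@lebesgue_measure R).

Definition aff (a c : R) (x : mR) : mR := a + c * x.

Lemma measurable_aff a c : measurable_fun setT (aff a c).
Proof.
apply: measurable_funD; first exact: measurable_cst.
by apply: measurable_funM => //; exact: measurable_cst.
Qed.

(** Uniqueness of Lebesgue measure: its image under x |-> a + c x, scaled by [|c|], agrees with it
    on half-open intervals. *)
Lemma lebesgue_measure_affine (a c : R) (A : set mR) : c != 0 -> measurable A ->
  leb A = (`|c|%:E * leb (aff a c @^-1` A))%E.
Proof.
move=> c0 mA.
have c0' : 0 <= `|c| by [].
pose pf := @measure_function_pushforward__canonical__measure_function_Measure
  _ _ _ _ R leb _ (measurable_aff a c).
pose nu := mscale (NngNum c0') pf.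
suff E : forall X, ocitv X -> leb X = nu X by exact: lebesgue_measure_unique E _ mA.
move=> X [[p q] _ <-]; rewrite /nu /mscale /= /pushforward /aff /=.
have [cp|cn|//] := ltgtP 0 c; last by move=> c00; rewrite c00 eqxx in c0.
- have -> : (fun x : mR => a + c * x) @^-1` `]p, q] =
     `](p - a) / c, (q - a) / c]%classic.
    apply/seteqP; split => x /=; rewrite !in_itv /=;
    by rewrite ltr_pdivrMr// ler_pdivlMr// [x * c]mulrC ltrBlDl lerBrDl.
  rewrite !lebesgue_measure_itv /= !lte_fin ltr_pM2r ?invr_gt0// ltrD2r.
  case: ifP => pq; last by rewrite mule0.
  rewrite -!EFinB -EFinM gtr0_norm//; congr EFin.
  by field; rewrite gt_eqF.
(* For c < 0 the preimage of []p, q]] is closed on the left and open on the right, which leaves its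
   length unaffected. *)
- have -> : (fun x : mR => a + c * x) @^-1` `]p, q] =
     `[(q - a) / c, (p - a) / c[%classic.
    apply/seteqP; split => x /=; rewrite !in_itv /=;
    by rewrite ltr_ndivlMr// ler_ndivrMr// [x * c]mulrC ltrBlDl lerBrDl andbC.
  rewrite !lebesgue_measure_itv /= !lte_fin ltr_nM2r ?invr_lt0// ltrD2r.
  case: ifP => pq; last by rewrite mule0.
  rewrite -!EFinB -EFinM ltr0_norm//; congr EFin.
  by field; rewrite lt_eqF.
Qed.

Lemma ge0_integral_affine1 (a c : R) (f : mR -> \bar R) : c != 0 ->
  measurable_fun setT f -> (forall x, 0 <= f x)%E ->
  (\int[leb]_x f (a + c * x)%R = (`|c|^-1)%:E * \int[leb]_x f x)%E.
Proof.
move=> c0 mf f0.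
have := ge0_integral_image (measurable_aff a c) (mu := leb)
  (nu := mscale (NngNum (normr_ge0 c^-1)) leb).
move=> <-//; first by rewrite ge0_integral_mscale//= normfV.
move=> A mA; rewrite /= /mscale /= (lebesgue_measure_affine a c0 mA) muleA.
by rewrite normfV -EFinM mulVf ?normr_eq0// mul1e.
Qed.

End lebesgue_affine.

Section lebesgue_tuple_theory.
Context {R : realType}.
Local Notation mR := (measurableTypeR R).
Local Notation leb := (@lebesgue_measure R).
Local Notation L := (lebesgue_tuple R).

Lemma ge0_integral_tuple0 (f : 0.-tuple mR -> \bar R) :
  measurable_fun setT f -> (\int[L 0]_t f t = f [tuple])%E.
Proof. by move=> mf; rewrite /= integral_dirac// diracT mul1e. Qed.

Lemma ge0_integral_tupleS n (f : n.+1.-tuple mR -> \bar R) :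
  measurable_fun setT f -> (forall t, 0 <= f t)%E ->
  (\int[L n.+1]_t f t = \int[leb]_x \int[L n]_t f (tcons (x, t)))%E.
Proof.
move=> mf f0.
rewrite (ge0_integral_image (@measurable_tcons R n) (mu := (leb \x L n)%E))//.
rewrite fubini_tonelli1//.
by apply: measurableT_comp => //; exact: measurable_tcons.
Qed.

Lemma integrable_tupleS n (f : n.+1.-tuple mR -> R) : measurable_fun setT f ->
  rint (leb \x L n)%E (f \o @tcons R n) ->
  rint (L n.+1) f /\ \int[L n.+1]_t f t = \int[(leb \x L n)%E]_z f (tcons z).
Proof.
exact: rint_image (@measurable_tcons R n) _ _ (fun=> _) f.
Qed.

Definition taff n (a : 'I_n -> R) (c : R) (t : n.-tuple mR) : n.-tuple mR :=
  [tuple a i + c * tnth t i | i < n].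

Lemma measurable_taff n (a : 'I_n -> R) c : measurable_fun setT (taff a c).
Proof.
apply/measurable_fun_tnthP => i.
rewrite (_ : _ \o _ = fun t => a i + c * tnth t i).
  apply: measurable_funD; first exact: measurable_cst.
  apply: measurable_funM; first exact: measurable_cst.
  exact: measurable_tnth.
by apply/funext => t /=; rewrite tnth_mktuple.
Qed.

Lemma taff_tcons n (a : 'I_n.+1 -> R) c (x : mR) (t : n.-tuple mR) :
  taff a c (tcons (x, t)) =
  tcons (a ord0 + c * x, taff (fun i => a (lift ord0 i)) c t).
Proof.
apply: eq_from_tnth => i; rewrite tnth_mktuple.
by case: (unliftP ord0 i) => [j ->|->]; rewrite /tcons ?tnthS ?tnth0 ?tnth_mktuple.
Qed.

(** Tonelli peels off the first coordinate; the substitution there contributes one factor [|c|^-1],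
    the induction hypothesis the others. *)
Lemma ge0_integral_taff n (a : 'I_n -> R) c (f : n.-tuple mR -> \bar R) :
  c != 0 -> measurable_fun setT f -> (forall t, 0 <= f t)%E ->
  (\int[L n]_t f (taff a c t) = (`|c| ^- n)%:E * \int[L n]_t f t)%E.
Proof.
move=> c0; elim: n a f => [|n IHn] a f mf f0.
  rewrite !ge0_integral_tuple0//; last first.
    by apply: measurableT_comp => //; exact: measurable_taff.
  by rewrite expr0 invr1 mul1e; congr f; apply: eq_from_tnth; case.
have mft : measurable_fun setT (fun z : mR * n.-tuple mR => f (tcons z)).
  by apply: measurableT_comp => //; exact: measurable_tcons.
rewrite !ge0_integral_tupleS//; last first.
  by apply: measurableT_comp => //; exact: measurable_taff.
pose F x := (\int[L n]_t f (tcons (x, t)))%E.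
have mF : measurable_fun setT F.
  exact: (measurable_fun_fubini_tonelli_F (m2 := L n) (fun z => f (tcons z))).
have F0 x : (0 <= F x)%E by apply: integral_ge0.
under eq_integral => x _.
  under eq_integral => t _ do rewrite taff_tcons.
  rewrite (IHn _ (fun t => f (tcons (a ord0 + c * x, t))))//; last first.
    exact: (measurableT_comp mft (measurable_pair1 _)).
  rewrite -/(F _); over.
have mFa : measurable_fun [set: mR] (fun x : mR => F (a ord0 + c * x)).
  exact: (measurableT_comp mF (@measurable_aff R (a ord0) c)).
have k0 : (0 <= (`|c| ^- n)%:E)%E by rewrite lee_fin invr_ge0 exprn_ge0.
apply: (etrans (ge0_integralZl leb measurableT mFa (fun x _ => F0 _) k0)).
rewrite (ge0_integral_affine1 (a ord0) c0 mF F0) muleA -EFinM.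
by rewrite exprSr invfM mulrC.
Qed.

Lemma rint_taff n (a : 'I_n -> R) c (f : n.-tuple mR -> R) : c != 0 ->
  rint (L n) f -> rint (L n) (fun t => f (taff a c t)) /\
  \int[L n]_t f (taff a c t) = `|c| ^- n * \int[L n]_t f t.
Proof.
move=> c0 If; have mf := rint_measurable If.
have mf' : measurable_fun setT (EFin \o f) by exact/measurable_EFinP.
have E := @ge0_integral_taff n a c _ c0.
split.
  apply/integrableP; split.
    by apply: measurableT_comp mf' _; exact: measurable_taff.
  rewrite (E (fun t => `|(f t)%:E|%E))//; last exact: measurableT_comp.
  move/integrableP : If => [_ If]; apply: lte_mul_pinfty => //.
have Ep := E _ (measurable_funepos mf') (fun y => funepos_ge0 _ y).
have En := E _ (measurable_funeneg mf') (fun y => funeneg_ge0 _ y).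
rewrite /Rintegral -[`|c| ^- n]/(fine (`|c| ^- n)%:E) -fineM//; last first.
  exact: integrable_fin_num.
congr fine; rewrite [LHS]integralE [in RHS]integralE.
rewrite muleBr//; last exact: integrable_add_def.
rewrite -Ep -En.
congr (_ - _)%E; apply: eq_integral => x _.
- by rewrite !funeposE.
- by rewrite !funenegE.
Qed.

Definition rowt n (t : n.-tuple mR) : 'rV[R]_n := \row_i tnth t i.

Lemma rowtE n (t : n.-tuple mR) i : rowt t 0 i = tnth t i.
Proof. by rewrite mxE. Qed.

Lemma rowt_taff n (a : 'rV[R]_n) c (t : n.-tuple mR) :
  rowt (taff (fun i => a 0 i) c t) = a + c *: rowt t.
Proof. by apply/rowP => i; rewrite !mxE tnth_mktuple. Qed.

Definition vint n (f : 'rV[R]_n -> R) := rint (L n) (f \o @rowt n).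
Definition vcint n (f : 'rV[R]_n -> R[i]) := cintble (L n) (f \o @rowt n).
Definition vcmeas n (f : 'rV[R]_n -> R[i]) := cmeas (f \o @rowt n).

Lemma vint_affine n (a : 'rV[R]_n) c (f : 'rV[R]_n -> R) : c != 0 ->
  vint f -> vint (fun y => f (a + c *: y)) /\
  \int[L n]_t f (a + c *: rowt t) = `|c| ^- n * \int[L n]_t f (rowt t).
Proof.
move=> c0 If; have [I E] := rint_taff (fun i => a 0 i) c0 If; split.
  by move: I; congr rint; apply/funext => t /=; rewrite rowt_taff.
by rewrite -E; apply: eq_Rintegral => t _ /=; rewrite rowt_taff.
Qed.

Lemma vcint_affine n (a : 'rV[R]_n) c (f : 'rV[R]_n -> R[i]) : c != 0 ->
  vcint f -> vcint (fun y => f (a + c *: y)) /\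
  cintegral (fun y => f (a + c *: y)) = (`|c| ^- n)%:C%C * cintegral f.
Proof.
move=> c0 [f1 f2].
have [I1 E1] := @vint_affine n a c (Re \o f) c0 f1.
have [I2 E2] := @vint_affine n a c (Im \o f) c0 f2.
split => //; apply: complex_eq; rewrite ?cReM ?cImM /= mul0r ?subr0 ?addr0.
- exact: E1.
- exact: E2.
Qed.

Lemma cint_tuple0 (f : 0.-tuple mR -> R[i]) : cmeas f ->
  cintble (L 0) f /\ cint (L 0) f = f [tuple].
Proof.
move=> [m1 m2]; split.
  split; apply/integrableP; split; try exact/measurable_EFinP.
  - by rewrite ge0_integral_tuple0 ?ltry//; exact/measurable_EFinP/measurableT_comp.
  - by rewrite ge0_integral_tuple0 ?ltry//; exact/measurable_EFinP/measurableT_comp.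
apply: complex_eq => /=; rewrite /Rintegral ge0_integral_tuple0//;
exact/measurable_EFinP.
Qed.

Lemma cint_tupleS n (f : n.+1.-tuple mR -> R[i]) : cmeas f ->
  cintble (leb \x L n)%E (f \o @tcons R n) ->
  cintble (L n.+1) f /\ cint (L n.+1) f = cint (leb \x L n)%E (f \o @tcons R n).
Proof.
move=> [m1 m2] [I1 I2].
have [J1 E1] := integrable_tupleS m1 I1; have [J2 E2] := integrable_tupleS m2 I2.
by split => //; apply: complex_eq => /=; [rewrite E1|rewrite E2].
Qed.

Lemma cmeas_prod I (r : seq I) d (T : measurableType d) (h : I -> T -> R[i]) :
  (forall i, cmeas (h i)) -> cmeas (fun t => \prod_(i <- r) h i t).
Proof.
move=> mh; elim: r => [|i r IH].
  by under eq_fun do rewrite big_nil; exact: cmeas_cst.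
by under eq_fun do rewrite big_cons; exact: cmeasM.
Qed.

(** Induction on n with Fubini on the first coordinate. The modulus of the integrand is itself a
    product of integrable functions, which is the majorant that Fubini asks for. *)
Lemma cint_prod_tuple n (h : 'I_n -> mR -> R[i]) :
  (forall i, cintble leb (h i)) ->
  cintble (L n) (fun t => \prod_(i < n) h i (tnth t i)) /\
  cint (L n) (fun t => \prod_(i < n) h i (tnth t i)) =
    \prod_(i < n) cint leb (h i).
Proof.
elim: n h => [|n IHn] h Ih.
  rewrite big_ord0; under eq_fun do rewrite big_ord0.
  have [I0 E0] := cint_tuple0 (cmeas_cst 1).
  by split => //; rewrite E0.
have mh k : cmeas (fun t : n.+1.-tuple mR => h k (tnth t k)).
  apply: (cmeas_comp (h := fun t : n.+1.-tuple mR => tnth t k)).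
    exact: measurable_tnth.
  exact: (cintble_cmeas (Ih k)).
have mf : cmeas (fun t : n.+1.-tuple mR => \prod_(i < n.+1) h i (tnth t i)).
  exact: cmeas_prod.
pose h' i := h (lift ord0 i).
have [IH1 IH2] := IHn h' (fun i => Ih (lift ord0 i)).
pose g (z : mR * n.-tuple mR) :=
  h ord0 z.1 * (\prod_(i < n) h' i (tnth z.2 i)).
have fg : (fun t : n.+1.-tuple mR => \prod_(i < n.+1) h i (tnth t i)) \o
    @tcons R n = g.
  apply/funext => -[x t] /=; rewrite big_ord_recl /g /=; congr (h _ _ * _).
  by apply: eq_bigr => i _; rewrite tnthS.
have mg : cmeas g by rewrite -fg; exact: cmeas_comp (@measurable_tcons R n) mf.
have gE z : normc (g z) <= normc (h ord0 z.1) *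
    normc (\prod_(i < n) h' i (tnth z.2 i)) by rewrite /g Normc.normcM.
have N1 := cintble_norm (Ih ord0); have N2 := cintble_norm IH1.
have Ig := cintble_prod N1 N2 mg gE.
have [|J E] := cint_tupleS mf.
  by rewrite fg; exact: Ig.
split => //; rewrite E fg (cint_prod1 N1 N2 mg gE) big_ord_recl -IH2.
rewrite -cintZr//; congr cint; apply/funext => x.
by rewrite /g /= cintZ.
Qed.

End lebesgue_tuple_theory.

(** * Cauchy and Poisson kernels *)

Section poisson.
Context {R : realType}.
Local Notation mR := (measurableTypeR R).
Local Notation leb := (@lebesgue_measure R).

Lemma rint_opp (f : mR -> R) : rint leb f ->
  rint leb (fun x => f (- x)) /\ \int[leb]_x f (- x) = \int[leb]_x f x.
Proof.
move=> If; have mf := rint_measurable If.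
have mo : measurable_fun setT (fun x : mR => - x : mR) by exact: oppr_measurable.
have nuE A : measurable A -> leb A = leb ((fun x : mR => - x : mR) @^-1` A).
  move=> mA; have m1 : (-1 : R) != 0 by rewrite oppr_eq0 oner_eq0.
  rewrite (lebesgue_measure_affine 0 m1 mA) normrN1 mul1e.
  by congr (leb _); apply/seteqP; split => x /=; rewrite /aff add0r mulN1r.
have mfo : measurable_fun setT (fun x : mR => f (- x)) by exact: measurableT_comp.
have Ifo : rint leb (fun x => f (- x)).
  have [|] := rint_image mo nuE mfo; last by [].
  by rewrite /comp; under eq_fun do rewrite opprK.
by split => //; case: (rint_image mo nuE mf Ifo) => _ ->.
Qed.

Lemma Rintegral_odd (f : mR -> R) : rint leb f -> (forall x, f (- x) = - f x) ->
  \int[leb]_x f x = 0.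
Proof.
move=> If of_; have [_] := rint_opp If.
under eq_Rintegral do rewrite of_ -mulN1r.
rewrite RintegralZl// mulN1r; move: (\int[leb]_x f x) => I E; lra.
Qed.

Let nnegE : [set x : R | 0 <= x] = `[0, +oo[%classic.
Proof. by apply/seteqP; split => x /=; rewrite in_itv /= andbT. Qed.

Lemma rint_even (f : R -> R) (l : R) : (forall x, 0 <= f x) -> continuous f ->
  (forall x, f (- x) = f x) ->
  (\int[leb]_(x in `[0%R, +oo[) (f x)%:E = l%:E)%E ->
  rint leb f /\ \int[leb]_x f x = 2 * l.
Proof.
move=> f0 cf ef fl.
have E : (\int[leb]_x (f x)%:E = (2 * l)%:E)%E.
  rewrite ge0_symfun_integralT//; last by move=> x /=; rewrite ef.
  by rewrite nnegE fl -EFinM.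
split; last by rewrite /Rintegral E.
apply/integrableP; split.
  by apply/measurable_EFinP; exact: continuous_measurable_fun.
under eq_integral do rewrite /= ger0_norm//.
by rewrite E ltry.
Qed.

Lemma rint_cauchy : rint leb (fun x : R => (1 + x ^+ 2)^-1) /\
  \int[leb]_x (1 + x ^+ 2)^-1 = pi.
Proof.
have [||||I E] := @rint_even (fun x : R => (1 + x ^+ 2)^-1) (pi / 2).
- by move=> x; rewrite invr_ge0 addr_ge0 ?sqr_ge0.
- exact: continuous_oneDsqrV.
- by move=> x; rewrite sqrrN.
- exact: integral0y_oneDsqr.
by split => //; rewrite E mulrC divfK.
Qed.

(** A primitive of [f s]. Adding 1 to the cosine keeps the integrand nonnegative, as the improper
    form of the fundamental theorem of calculus in [intG] requires; the contribution of the 1 is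
    subtracted again in [cint_poisson]. *)
Let F (s x : R) : R := expR (- x) * (s * sin (s * x) - cos (s * x)) / (1 + s ^+ 2)
  - expR (- x).
Let f (s x : R) : R := expR (- x) * (1 + cos (s * x)).

Let dF s (x : R) : is_derive x 1 (F s) (f s x).
Proof.
have s1 : 1 + s ^+ 2 != 0 by rewrite gt_eqF// ltr_pwDl// sqr_ge0.
rewrite /F /f; apply: is_derive_eq.
by rewrite /GRing.scale /=; field.
Qed.

Let F_cvg0 s : F s x @[x --> +oo] --> 0.
Proof.
have s1 : 1 <= 1 + s ^+ 2 by rewrite lerDl sqr_ge0.
apply/norm_cvg0P.
have e0 : (fun x : R => (`|s| + 2) * expR (- x)) x @[x --> +oo] --> 0.
  by rewrite -[X in _ --> X](mulr0 (`|s| + 2)); apply: cvgMr; exact: cvgr_expR.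
apply: (squeeze_cvgr _ (cvg_cst 0) e0); near=> x; rewrite normr_ge0 /=.
rewrite /F; apply: (le_trans (ler_normB _ _)).
rewrite normrM normfV (ger0_norm (expR_ge0 _)) normrM (ger0_norm (expR_ge0 _)).
have -> : (`|s| + 2) * expR (- x) = expR (- x) * (`|s| + 1) + expR (- x) by ring.
rewrite lerD2r ler_pdivrMr ?normr_gt0 ?gt_eqF ?(lt_le_trans ltr01)//.
rewrite -mulrA ler_wpM2l ?expR_ge0//.
rewrite (ger0_norm (le_trans ler01 s1)).
apply: (@le_trans _ _ (`|s| + 1)).
  apply: (le_trans (ler_normB _ _)); rewrite lerD ?cos_max//.
  by rewrite normrM ler_piMr ?sin_max.
by rewrite ler_peMr ?addr_ge0.
Unshelve. all: by end_near. Qed.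

Let G (s x : R) : R := expR (- `|x|) * (1 + cos (s * x)).

Let continuous_expabs : continuous (fun x : R => expR (- `|x|)).
Proof.
move=> x; apply: (@continuous_comp R R R (fun x : R => - `|x|) expR).
  by apply: continuousN; exact: norm_continuous.
exact: continuous_expR.
Qed.

Let continuous_cosM (s : R) : continuous (fun x : R => cos (s * x)).
Proof.
move=> x; apply: (@continuous_comp R R R (fun x : R => s * x) cos).
  exact: mulrl_continuous.
exact: continuous_cos.
Qed.

Let intG s : rint leb (G s) /\ \int[leb]_x G s x = 2 * (1 + (1 + s ^+ 2)^-1).
Proof.
apply: rint_even.
- by move=> x; rewrite mulr_ge0 ?expR_ge0// -lerBlDl sub0r cos_geN1.
- move=> x; apply: cvgM; first exact: continuous_expabs.
  by apply: cvgD; [exact: cvg_cst|exact: continuous_cosM].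
- by move=> x; rewrite /G normrN mulrN cosN.
transitivity (\int[leb]_(x in `[0%R, +oo[) (f s x)%:E)%E.
  apply: eq_integral => x; rewrite inE /= in_itv /= andbT => x0.
  by rewrite /G /f ger0_norm.
have cf : continuous (f s).
  move=> x; apply: cvgM.
    apply: (@continuous_comp R R R (fun x : R => - x) expR); last exact: continuous_expR.
    exact: opp_continuous.
  by apply: cvgD; [exact: cvg_cst|exact: continuous_cosM].
have cF : continuous (F s).
  move=> x; apply/differentiable_continuous/derivable1_diffP.
  by have [] := dF s x.
rewrite (ge0_continuous_FTC2y _ _ (F_cvg0 s)).
- rewrite /F oppr0 expR0 mulr0 sin0 cos0; rewrite -EFinB; congr EFin.
  by rewrite mulr0 sub0r mul1r sub0r mulN1r opprB opprK.
- by move=> x _; rewrite mulr_ge0 ?expR_ge0// -lerBlDl sub0r cos_geN1.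
- exact: continuous_subspaceT.
- by move=> x _; have [] := dF s x.
- by apply: cvg_at_right_filter; exact: cF.
- by move=> x _; rewrite derive1E; exact: (@derive_val _ _ _ _ _ _ _ (dF s x)).
Qed.

(** The case s = 0 of [intG], where [G 0] is twice the exponential. *)
Let intE : rint leb (fun x => expR (- `|x|)) /\
  \int[leb]_x expR (- `|x|) = 2.
Proof.
have [I E] := intG 0; have := rintZ 2^-1 I.
have -> : (fun x => 2^-1 * G 0 x) = (fun x => expR (- `|x|)).
  by apply/funext => x; rewrite /G mul0r cos0; field.
split => //.
have <- : (fun x => 2^-1 * G 0 x) = (fun x => expR (- `|x|)).
  by apply/funext => x; rewrite /G mul0r cos0; field.
by rewrite RintegralZl// E expr0n addr0 invr1; field.
Qed.

(** The real part is [G s] minus the exponential, so [intG] and [intE] evaluate it; the imaginary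
    part is odd. *)
Lemma cint_poisson (s : R) :
  cintble leb (fun x => (expR (- `|x|))%:C%C * expi (- (s * x))) /\
  cint leb (fun x => (expR (- `|x|))%:C%C * expi (- (s * x))) =
    (2 * (1 + s ^+ 2)^-1)%:C%C.
Proof.
have [IG EG] := intG s; have [IE EE] := intE.
have I : cintble leb (fun x => (expR (- `|x|))%:C%C * expi (- (s * x))).
  apply: (cintble_le _ _ IE).
    apply: cmeasM.
      by apply: cmeas_real; exact: rint_measurable IE.
    apply: cmeas_expi; apply: continuous_measurable_fun => x.
    by apply: continuousN; exact: mulrl_continuous.
  by move=> x; rewrite Normc.normcM normc_expi mulr1 normc_real ger0_norm ?expR_ge0.
split => //; case: (I) => _ I2; apply: complex_eq => /=.
- transitivity (\int[leb]_x (G s x - expR (- `|x|))).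
    by apply: eq_Rintegral => x _ /=; rewrite cosN /G; ring.
  by rewrite RintegralB// EE EG; ring.
- apply: (Rintegral_odd I2) => x /=.
  by rewrite normrN !mulrN opprK !sinN; ring.
Qed.

End poisson.

(** * Product kernels in dimension n *)

Section decay_kernels.
Context {R : realType}.
Local Notation mR := (measurableTypeR R).
Local Notation L := (lebesgue_tuple R).

(** Up to a factor this is the Fourier transform of [expabsn]; it is also the integrable majorant
    for whatever decays against the weight. *)
Definition cauchyn n (y : 'rV[R]_n) : R := \prod_(i < n) (1 + y 0 i ^+ 2)^-1.

Lemma cauchyn_ge0 n (y : 'rV[R]_n) : 0 <= cauchyn y.
Proof. by apply: prodr_ge0 => i _; rewrite invr_ge0 addr_ge0 ?sqr_ge0. Qed.

Lemma vint_cauchyn n : vint (@cauchyn n) /\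
  \int[L n]_t cauchyn (rowt t) = pi ^+ n.
Proof.
have [I1 E1] := @rint_cauchy R.
have Ic : cintble (@lebesgue_measure R) (fun x : mR => ((1 + x ^+ 2)^-1)%:C%C).
  by split => //; exact: integrable0.
have [I E] := @cint_prod_tuple R n (fun _ x => ((1 + x ^+ 2)^-1)%:C%C) (fun=> Ic).
have PE t : \prod_(i < n) ((1 + tnth t i ^+ 2)^-1)%:C%C = (cauchyn (rowt t))%:C%C.
  rewrite /cauchyn rmorph_prod; apply: eq_bigr => i _.
  by rewrite rowtE.
move: I E; under eq_fun do rewrite PE.
move=> [I _] E; split => //.
have -> : \int[L n]_t cauchyn (rowt t) =
  complex.Re (cint (L n) (fun t => (cauchyn (rowt t))%:C%C)) by [].
rewrite E prodr_const card_ord.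
have -> : cint (@lebesgue_measure R) (fun x : mR => ((1 + x ^+ 2)^-1)%:C%C) = pi%:C%C.
  by apply: complex_eq => /=; rewrite ?E1// Rintegral_cst// mul0r.
by rewrite -rmorphXn.
Qed.

(** Convergence factor for Fourier inversion. The l^1 norm in the exponent makes it factor over the
    coordinates, which reduces its transform to [cint_poisson]. *)
Definition expabsn n (y : 'rV[R]_n) : R := \prod_(i < n) expR (- `|y 0 i|).

Lemma expabsn_ge0 n (y : 'rV[R]_n) : 0 <= expabsn y.
Proof. by apply: prodr_ge0 => i _; exact: expR_ge0. Qed.

Lemma expabsn_le1 n (y : 'rV[R]_n) : expabsn y <= 1.
Proof.
by apply: prodr_ile1 => i _; rewrite expR_ge0 /= -expR0 ler_expR oppr_le0.
Qed.

Lemma expi_dotv n (x y : 'rV[R]_n) :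
  expi (- dotv x y) = \prod_(i < n) expi (- (x 0 i * y 0 i)).
Proof.
rewrite /dotv -sumrN; elim/big_rec2: _ => [|i a b _ <-]; first by rewrite expi0.
by rewrite expiD.
Qed.

Lemma fourier_expabsn n (s : 'rV[R]_n) :
  vcint (fun x => (expabsn x)%:C%C * expi (- dotv x s)) /\
  cintegral (fun x => (expabsn x)%:C%C * expi (- dotv x s)) =
    (2 ^+ n * cauchyn s)%:C%C.
Proof.
have H i := cint_poisson (s 0 i).
pose h i (x : mR) := (expR (- `|x|))%:C%C * expi (- (s 0 i * x)).
have [I E] := @cint_prod_tuple R n h (fun i => (H i).1).
have hE (t : n.-tuple mR) : \prod_(i < n) h i (tnth t i) =
    (expabsn (rowt t))%:C%C * expi (- dotv (rowt t) s).
  rewrite big_split /= expi_dotv rmorph_prod; congr (_ * _).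
    by apply: eq_bigr => i _; rewrite rowtE.
  by apply: eq_bigr => i _; rewrite rowtE mulrC.
move: I E; under eq_fun do rewrite hE.
move=> I E; split => //; rewrite /cintegral -/(cint _ _).
transitivity (\prod_(i < n) cint (@lebesgue_measure R) (h i)); first exact: E.
rewrite (eq_bigr (fun i => (2 * (1 + s 0 i ^+ 2)^-1)%:C%C)); last first.
  by move=> i _; exact: (H i).2.
by rewrite -rmorph_prod big_split /= prodr_const card_ord.
Qed.

Lemma vint_expabsn n : vint (@expabsn n).
Proof.
(* At frequency 0 the integrand of the transform is the kernel itself. *)
have [I _] := fourier_expabsn (0 : 'rV[R]_n).
have [J _] := I; move: J; rewrite /vint; congr rint; apply/funext => t /=.
have -> : dotv (rowt t) 0 = 0 by rewrite /dotv big1// => i _; rewrite !mxE mulr0.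
by rewrite oppr0 cos0 sin0; ring.
Qed.

End decay_kernels.

(** * Functions of row vectors *)

Section row_vectors.
Context {R : realType}.

Definition box n (q : 'rV[R]_n) (r : R) : set 'rV[R]_n :=
  [set x | forall i, `|x 0 i - q 0 i| < r].

Lemma box_ball n (q : 'rV[R]_n) (r : R) : 0 < r -> box q r = ball q r.
Proof.
move=> r0; apply/seteqP; split => x /=.
  by move=> H; split => // i j; rewrite (ord1 i) /ball /= distrC; exact: H.
by move=> [_ H] i; rewrite distrC; exact: (H 0 i).
Qed.

Lemma nbhs_box n (q : 'rV[R]_n) (U : set 'rV[R]_n) :
  nbhs q U <-> exists2 r, 0 < r & box q r `<=` U.
Proof.
split.
  by move=> /nbhs_ballP[r /= r0 H]; exists r => //; rewrite box_ball.
by move=> [r r0 H]; apply/nbhs_ballP; exists r => //; rewrite -box_ball.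
Qed.

Section measurable_row.
Context d {Z : measurableType d} {n : nat} (c : Z -> 'rV[R]_n).
Hypothesis mc : forall i, measurable_fun setT (fun z => c z 0 i : measurableTypeR R).

Lemma measurable_box (q : 'rV[R]_n) (r : R) : measurable (c @^-1` box q r).
Proof.
have -> : c @^-1` box q r =
    \bigcap_(i in [set: 'I_n]) ((fun z => c z 0 i) @^-1` ball (q 0 i) r).
  apply/seteqP; split => z /=.
    by move=> H i _; rewrite /ball /= distrC; exact: H.
  by move=> H i; have := H i Logic.I; rewrite /ball /= distrC.
apply: fin_bigcap_measurable => // i _; rewrite -[X in measurable X]setTI.
by apply: (mc i) => //; exact: measurable_ball.
Qed.

(** Measurability of a vector-valued map means that of its coordinates. An open set is a countable
    union of boxes with rational centres and radii 1/(k+1), and preimages of boxes are finite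
    intersections of measurable sets. *)
Lemma measurable_open_row (U : set 'rV[R]_n) : open U -> measurable (c @^-1` U).
Proof.
move=> oU; pose q2r (q : 'rV[rat]_n) : 'rV[R]_n := map_mx ratr q.
pose F (p : 'rV[rat]_n * nat) : set Z :=
  if `[< box (q2r p.1) p.2.+1%:R^-1 `<=` U >]
  then c @^-1` box (q2r p.1) p.2.+1%:R^-1 else set0.
have -> : c @^-1` U = \bigcup_p F p.
  apply/seteqP; split => z /=; last first.
    by move=> [p _]; rewrite /F; case: ifPn => // /asboolP; exact.
  move=> Uz; have [r r0 rU] := (nbhs_box (c z) U).1 (open_nbhs_nbhs (conj oU Uz)).
  (* With s = 1/(k+1), a rational centre within s of [c z] and box radius s keep the box within 2 s
     < r of [c z]. *)
  have [k kr] : exists k : nat, k.+1%:R^-1 < r / 2 :> R.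
    have r2 : 0 < r / 2 by rewrite divr_gt0.
    have [k _ /(_ k (leqnn k))] := near_infty_natSinv_lt (PosNum r2).
    by exists k.
  set s : R := k.+1%:R^-1 in kr; have s0 : 0 < s by rewrite invr_gt0.
  have /choice[q qP] i : exists q : rat, `|c z 0 i - ratr q| < s.
    have [q /itvP qi] : exists q, ratr q \in `]c z 0 i - s, c z 0 i + s[.
      by apply: rat_in_itvoo; lra.
    exists q; rewrite ltr_distlC; have := qi.1; rewrite !qi; lra.
  exists (\row_i q i, k) => //; rewrite /F /= asboolT.
    by move=> i; rewrite !mxE; exact: qP.
  move=> x xb; apply: rU => i; have := xb i; have := qP i; rewrite !mxE => H1 H2.
  rewrite -(subrK (ratr (q i)) (x 0 i)) -addrA.
  apply: (le_lt_trans (ler_normD _ _)); rewrite [`|ratr _ - _|]distrC -/s in H2 *.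
  lra.
apply: countable_bigcupT_measurable; first exact: countableP.
move=> p; rewrite /F; case: ifP => _ //; exact: measurable_box.
Qed.

Lemma measurable_comp_row (f : 'rV[R]_n -> R) : continuous f ->
  measurable_fun setT (fun z => f (c z) : measurableTypeR R).
Proof.
move=> /continuousP cf; apply: (measurability _ (RGenOpens.measurableE R)).
move=> _ [_ [a [b ->]] <-]; rewrite setTI.
apply: (@measurable_open_row (f @^-1` `]a, b[)).
exact/cf/interval_open.
Qed.

End measurable_row.

Definition ccont n (f : 'rV[R]_n -> R[i]) :=
  continuous (fun x => Re (f x)) /\ continuous (fun x => Im (f x)).

Lemma measurable_rowt n (i : 'I_n) :
  measurable_fun setT
    (fun t : n.-tuple (measurableTypeR R) => rowt t 0 i : measurableTypeR R).
Proof.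
rewrite (_ : (fun t => _) = (fun t => tnth t i)); first exact: measurable_tnth.
by apply/funext => t; rewrite rowtE.
Qed.

Lemma cmeas_comp_row d (Z : measurableType d) n (c : Z -> 'rV[R]_n)
    (f : 'rV[R]_n -> R[i]) :
  (forall i, measurable_fun setT (fun z => c z 0 i : measurableTypeR R)) ->
  ccont f -> cmeas (fun z => f (c z)).
Proof.
move=> mc [f1 f2]; split; first exact: (measurable_comp_row mc f1).
exact: (measurable_comp_row mc f2).
Qed.

Lemma ccont_vcmeas n (f : 'rV[R]_n -> R[i]) : ccont f -> vcmeas f.
Proof. by move=> cf; exact: (cmeas_comp_row (@measurable_rowt n) cf). Qed.

Lemma dotvC n (x y : 'rV[R]_n) : dotv x y = dotv y x.
Proof. by apply: eq_bigr => i _; rewrite mulrC. Qed.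
Lemma dotvDl n (x y z : 'rV[R]_n) : dotv (x + y) z = dotv x z + dotv y z.
Proof. by rewrite -big_split; apply: eq_bigr => i _; rewrite mxE mulrDl. Qed.
Lemma dotvZl n (c : R) (x y : 'rV[R]_n) : dotv (c *: x) y = c * dotv x y.
Proof. by rewrite mulr_sumr; apply: eq_bigr => i _; rewrite mxE mulrA. Qed.
Lemma dotvNl n (x y : 'rV[R]_n) : dotv (- x) y = - dotv x y.
Proof. by rewrite -scaleN1r dotvZl mulN1r. Qed.
Lemma dotvBl n (x y z : 'rV[R]_n) : dotv (x - y) z = dotv x z - dotv y z.
Proof. by rewrite dotvDl dotvNl. Qed.
Lemma dotvDr n (x y z : 'rV[R]_n) : dotv x (y + z) = dotv x y + dotv x z.
Proof. by rewrite dotvC dotvDl !(dotvC x). Qed.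
Lemma dotvZr n (c : R) (x y : 'rV[R]_n) : dotv x (c *: y) = c * dotv x y.
Proof. by rewrite dotvC dotvZl dotvC. Qed.
Lemma dotvNr n (x y : 'rV[R]_n) : dotv x (- y) = - dotv x y.
Proof. by rewrite dotvC dotvNl dotvC. Qed.
Lemma dotvBr n (x y z : 'rV[R]_n) : dotv x (y - z) = dotv x y - dotv x z.
Proof. by rewrite dotvDr dotvNr. Qed.

Lemma measurable_dotv d (Z : measurableType d) n (a b : Z -> 'rV[R]_n) :
  (forall i, measurable_fun setT (fun z => a z 0 i : measurableTypeR R)) ->
  (forall i, measurable_fun setT (fun z => b z 0 i : measurableTypeR R)) ->
  measurable_fun setT (fun z => dotv (a z) (b z) : measurableTypeR R).
Proof.
move=> ma mb; apply: measurable_sum => i; apply: measurable_funM.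
- exact: ma.
- exact: mb.
Qed.

End row_vectors.

(** * Dominated convergence for complex sequences *)

Section dominated.
Context {R : realType} d {T : measurableType d} (mu : {measure set T -> \bar R}).

Definition cvgc (u : nat -> R[i]) (l : R[i]) :=
  (Re (u n) @[n --> \oo] --> Re l) /\ (Im (u n) @[n --> \oo] --> Im l).

Lemma cvgc_unique u l l' : cvgc u l -> cvgc u l' -> l = l'.
Proof.
by move=> [a b] [a' b']; apply: complex_eq; [exact: cvg_unique a a'|exact: cvg_unique b b'].
Qed.

Lemma cvgc_cst c : cvgc (fun=> c) c.
Proof. by split; exact: cvg_cst. Qed.

Lemma cvgc_real (u : nat -> R) (l : R) : u n @[n --> \oo] --> l ->
  cvgc (fun n => (u n)%:C%C) l%:C%C.
Proof. by move=> ul; split => //=; exact: cvg_cst. Qed.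

Lemma cvgcM u v l m : cvgc u l -> cvgc v m -> cvgc (fun n => u n * v n) (l * m).
Proof.
move=> [u1 u2] [v1 v2]; split.
- have -> : (fun n => Re (u n * v n)) =
      (fun n => Re (u n) * Re (v n) - Im (u n) * Im (v n)).
    by apply/funext => n; rewrite cReM.
  by rewrite cReM; apply: cvgB; exact: cvgM.
- have -> : (fun n => Im (u n * v n)) =
      (fun n => Re (u n) * Im (v n) + Im (u n) * Re (v n)).
    by apply/funext => n; rewrite cImM.
  by rewrite cImM; apply: cvgD; exact: cvgM.
Qed.

Lemma Rdominated (f_ : nat -> T -> R) (f g : T -> R) :
  (forall n, measurable_fun setT (f_ n)) -> measurable_fun setT f ->
  (forall x, f_ n x @[n --> \oo] --> f x) -> rint mu g ->
  (forall n x, `|f_ n x| <= g x) ->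
  \int[mu]_x f_ n x @[n --> \oo] --> \int[mu]_x f x.
Proof.
move=> mf_ mf f_f Ig fg.
have mf_' n : measurable_fun setT (EFin \o f_ n) by exact/measurable_EFinP.
have mf' : measurable_fun setT (EFin \o f) by exact/measurable_EFinP.
have cv : {ae mu, forall x, setT x -> (EFin \o f_ n) x @[n --> \oo] --> (EFin \o f) x}.
  by apply: aeW => x _; apply: cvg_EFin; [exact: nearW|exact: f_f].
have le : {ae mu, forall x n, setT x -> (`|(EFin \o f_ n) x| <= (EFin \o g) x)%E}.
  by apply: aeW => x n _ /=; rewrite lee_fin.
have [If _ H] := dominated_convergence measurableT mf_' mf' cv Ig le.
have F : (\int[mu]_x (EFin \o f) x)%E \is a fin_num by exact: integrable_fin_num.
have := fine_cvg; move: H; rewrite -[X in _ --> X](fineK F).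
by move=> /fine_cvg.
Qed.

Lemma cdominated (f_ : nat -> T -> R[i]) (f : T -> R[i]) (g : T -> R) :
  (forall n, cmeas (f_ n)) -> cmeas f ->
  (forall x, cvgc (fun n => f_ n x) (f x)) -> rint mu g ->
  (forall n x, normc (f_ n x) <= g x) ->
  cvgc (fun n => cint mu (f_ n)) (cint mu f).
Proof.
move=> mf_ [mf1 mf2] f_f Ig fg; split; apply: (Rdominated _ _ _ Ig) => //.
- by move=> n; case: (mf_ n).
- by move=> x; case: (f_f x).
- by move=> n x; apply: le_trans (fg n x); exact: le_Re_normc.
- by move=> n; case: (mf_ n).
- by move=> x; case: (f_f x).
- by move=> n x; apply: le_trans (fg n x); exact: le_Im_normc.
Qed.

End dominated.

(** * Fourier inversion *)

Section fourier_inversion.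
Context {R : realType} {n : nat}.
Local Notation L := (lebesgue_tuple R).
Local Notation V := 'rV[R]_n.
Implicit Types (f : V -> R[i]).

Lemma cmeas_expi_dotv d (Z : measurableType d) (a b : Z -> V) :
  (forall i, measurable_fun setT (fun z => a z 0 i : measurableTypeR R)) ->
  (forall i, measurable_fun setT (fun z => b z 0 i : measurableTypeR R)) ->
  cmeas (fun z => expi (dotv (a z) (b z))).
Proof. by move=> ma mb; apply: cmeas_expi; exact: measurable_dotv. Qed.

Lemma measurable_cst_row d (Z : measurableType d) (q : V) i :
  measurable_fun setT (fun z : Z => q 0 i : measurableTypeR R).
Proof. exact: measurable_cst. Qed.

Lemma measurable_addr_row d (Z : measurableType d) (a b : Z -> V) :
  (forall i, measurable_fun setT (fun z => a z 0 i : measurableTypeR R)) ->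
  (forall i, measurable_fun setT (fun z => b z 0 i : measurableTypeR R)) ->
  forall i, measurable_fun setT (fun z => (a z + b z) 0 i : measurableTypeR R).
Proof.
move=> ma mb i.
rewrite (_ : (fun _ => _) = (fun z => a z 0 i + b z 0 i)); last first.
  by apply/funext => z; rewrite mxE.
exact: (measurable_funD (ma i) (mb i)).
Qed.

Lemma measurable_scaler_row d (Z : measurableType d) (k : R) (a : Z -> V) :
  (forall i, measurable_fun setT (fun z => a z 0 i : measurableTypeR R)) ->
  forall i, measurable_fun setT (fun z => (k *: a z) 0 i : measurableTypeR R).
Proof.
move=> ma i.
rewrite (_ : (fun _ => _) = (fun z => k * a z 0 i)); last first.
  by apply/funext => z; rewrite mxE.
exact: (measurable_funM (measurable_cst _) (ma i)).
Qed.

Lemma measurable_oppr_row d (Z : measurableType d) (a : Z -> V) :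
  (forall i, measurable_fun setT (fun z => a z 0 i : measurableTypeR R)) ->
  forall i, measurable_fun setT (fun z => (- a z) 0 i : measurableTypeR R).
Proof.
move=> ma i; rewrite (_ : (fun _ => _) = (fun z => ((-1) *: a z) 0 i)).
  exact: (measurable_scaler_row (-1) ma i).
by apply/funext => z; rewrite scaleN1r.
Qed.

Lemma measurable_row_mx d (Z : measurableType d) (a b : Z -> V) :
  (forall i, measurable_fun setT (fun z => a z 0 i : measurableTypeR R)) ->
  (forall i, measurable_fun setT (fun z => b z 0 i : measurableTypeR R)) ->
  forall i, measurable_fun setT
    (fun z => (row_mx (a z) (b z) : 'rV[R]_(n + n)) 0 i : measurableTypeR R).
Proof.
move=> ma mb i; case: (split_ordP i) => j ->.
- by rewrite (_ : (fun _ => _) = (fun z => a z 0 j))//; apply/funext => z; rewrite row_mxEl.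
- by rewrite (_ : (fun _ => _) = (fun z => b z 0 j))//; apply/funext => z; rewrite row_mxEr.
Qed.

Lemma measurable_rowt1 d (Z : measurableType d) i :
  measurable_fun setT
    (fun z : n.-tuple (measurableTypeR R) * Z => rowt z.1 0 i : measurableTypeR R).
Proof. exact: (measurableT_comp (measurable_rowt i) measurable_fst). Qed.

Lemma measurable_rowt2 d (Z : measurableType d) i :
  measurable_fun setT
    (fun z : Z * n.-tuple (measurableTypeR R) => rowt z.2 0 i : measurableTypeR R).
Proof. exact: (measurableT_comp (measurable_rowt i) measurable_snd). Qed.

Let eps (k : nat) : R := k.+1%:R^-1.
Let eps_gt0 k : 0 < eps k. Proof. by rewrite invr_gt0. Qed.
Let eps_cvg : eps k @[k --> \oo] --> 0.
Proof. exact: (@cvg_harmonic R). Qed.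

Let vint_K k : vint (fun x : V => expabsn (eps k *: x)).
Proof.
have [+ _] := vint_affine 0 (lt0r_neq0 (eps_gt0 k)) (@vint_expabsn R n).
by congr vint; apply/funext => x; rewrite add0r.
Qed.

Let expabsn_cvg (x : V) : expabsn (eps k *: x) @[k --> \oo] --> (1 : R).
Proof.
have E : forall k, expabsn (eps k *: x) = expR (eps k * - \sum_(i < n) `|x 0 i|).
  move=> k; rewrite /expabsn -sumrN mulr_sumr expR_sum.
  apply: eq_bigr => i _; rewrite mxE normrM ger0_norm ?mulrN//.
  exact/ltW/eps_gt0.
have H : eps k * - \sum_(i < n) `|x 0 i| @[k --> \oo] --> (0 : R).
  rewrite -[X in _ --> X](mul0r (- \sum_(i < n) `|x 0 i|)).
  by apply: cvgMl; exact: eps_cvg.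
under eq_cvg do rewrite E.
rewrite -expR0; apply: continuous_cvg H; exact: continuous_expR.
Qed.

Lemma vcint_expi f (xi : V) : vcint f -> vcint (fun x => expi (- dotv x xi) * f x).
Proof.
move=> If; apply: (cintble_le _ _ (cintble_norm If)) => [|t /=].
  apply: cmeasM; last exact: cintble_cmeas If.
  apply: cmeas_expi; apply: measurableT_comp => //; apply: measurable_dotv.
    exact: measurable_rowt.
  exact: measurable_cst_row.
by rewrite Normc.normcM normc_expi mul1r.
Qed.

Variables (f : V -> R[i]) (M : R).
Hypotheses (cf : ccont f) (fM : forall x, normc (f x) <= M).
Hypotheses (If : vcint f) (Iff : vcint (fourier f)).

(** The inverse integral with a convergence factor. Its limit is computed twice: by dominated
    convergence in the frequency ([A_cvg]) and, after Fubini and rescaling ([AE], [AE']), as an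
    average of values of f near y. *)
Let A k (y : V) : R[i] := cintegral (fun xi =>
  (expi (dotv y xi) * fourier f xi) * (expabsn (eps k *: xi))%:C%C).

Let mA (y : V) : vcmeas (fun xi => expi (dotv y xi) * fourier f xi).
Proof.
apply: cmeasM; last exact: cintble_cmeas Iff.
apply: cmeas_expi_dotv; [exact: measurable_cst_row|exact: measurable_rowt].
Qed.

Let A_cvg y : cvgc (A ^~ y) (cintegral (fun xi => expi (dotv y xi) * fourier f xi)).
Proof.
apply: (cdominated _ _ _ (cintble_norm Iff)).
- move=> k; apply: cmeasM; first exact: (mA y).
  by apply: cmeas_real; exact: rint_measurable (vint_K k).
- exact: (mA y).
- move=> t; have := cvgcM (cvgc_cst (expi (dotv y (rowt t)) * fourier f (rowt t)))
    (cvgc_real (expabsn_cvg (rowt t))).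
  by rewrite mulr1.
- move=> k t; rewrite /comp !Normc.normcM normc_expi mul1r normc_real.
  by rewrite ler_piMr ?normc_ge0// ger0_norm ?expabsn_ge0// expabsn_le1.
Qed.

Let inner k (v : V) :
  vcint (fun xi => (expabsn (eps k *: xi))%:C%C * expi (- dotv v xi)) /\
  cintegral (fun xi => (expabsn (eps k *: xi))%:C%C * expi (- dotv v xi)) =
  (eps k ^- n * (2 ^+ n * cauchyn ((eps k)^-1 *: v)))%:C%C.
Proof.
have e0 := lt0r_neq0 (eps_gt0 k).
have [I E] := fourier_expabsn ((eps k)^-1 *: v).
have [I' E'] := vcint_affine 0 e0 I.
have hE : (fun y : V => (expabsn (0 + eps k *: y))%:C%C *
    expi (- dotv (0 + eps k *: y) ((eps k)^-1 *: v))) =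
  (fun xi => (expabsn (eps k *: xi))%:C%C * expi (- dotv v xi)).
  apply/funext => xi; rewrite !add0r; congr (_ * expi (- _)).
  by rewrite dotvZl dotvZr mulrA divff// mul1r dotvC.
rewrite hE in I' E'; split => //; rewrite E' E -rmorphM.
by rewrite gtr0_norm.
Qed.

Let AE k y : A k y = cintegral (fun x =>
  f x * (eps k ^- n * (2 ^+ n * cauchyn ((eps k)^-1 *: (x - y))))%:C%C).
Proof.
pose F (z : n.-tuple (measurableTypeR R) * n.-tuple (measurableTypeR R)) : R[i] :=
  f (rowt z.2) * ((expabsn (eps k *: rowt z.1))%:C%C *
    expi (- dotv (rowt z.2 - y) (rowt z.1))).
have mF : cmeas F.
  apply: cmeasM.
    exact: cmeas_comp (measurable_snd) (cintble_cmeas If).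
  apply: cmeasM.
    apply: cmeas_real.
    exact: (measurableT_comp (rint_measurable (vint_K k)) measurable_fst).
  apply: cmeas_expi; apply: measurableT_comp => //; apply: measurable_dotv.
    apply: measurable_addr_row; first exact: measurable_rowt2.
    exact: measurable_cst_row.
  exact: measurable_rowt1.
have bF z : normc (F z) <= expabsn (eps k *: rowt z.1) * normc (f (rowt z.2)).
  rewrite /F !Normc.normcM normc_expi mulr1 normc_real ger0_norm ?expabsn_ge0//.
  by rewrite mulrC.
have := cint_swap (vint_K k) (cintble_norm If) mF bF.
rewrite /F /= => E.
transitivity (cint (L n) (fun x => cint (L n) (fun t => F (x, t)))).
  congr cint; apply/funext => x /=; rewrite mulrAC /fourier /cintegral.
  rewrite -[Complex _ _]/(cint (L n) (fun t => expi (- dotv (rowt t) (rowt x)) *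
    f (rowt t))) -cintZ; last exact: vcint_expi.
  congr cint; apply/funext => t; rewrite /F /=.
  by rewrite dotvBl opprB expiD; ring.
rewrite E; congr cint; apply/funext => t /=.
rewrite cintZ; last exact: (inner k (rowt t - y)).1.
by congr (_ * _); exact: (inner k (rowt t - y)).2.
Qed.

(** The substitution moves [eps k] from the kernel into the argument of f, where continuity at y can
    act under a majorant that does not depend on k. *)
Let AE' k y : A k y = cintegral (fun x =>
  f (y + eps k *: x) * (2 ^+ n * cauchyn x)%:C%C).
Proof.
have e0 := lt0r_neq0 (eps_gt0 k).
rewrite AE; set H := (fun x => f x * _).
have IH : vcint H.
  have [I _] := vint_affine (- ((eps k)^-1 *: y)) (invr_neq0 e0) (@vint_cauchyn R n).1.
  have bd : forall t, normc (H (rowt t)) <=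
      M * (eps k ^- n * 2 ^+ n) * cauchyn (- ((eps k)^-1 *: y) + (eps k)^-1 *: rowt t).
    move=> t; rewrite /H Normc.normcM normc_real ger0_norm; last first.
      by rewrite !mulr_ge0 ?invr_ge0 ?exprn_ge0 ?cauchyn_ge0// ltW.
    rewrite [- _ + _]addrC -scalerBr -!mulrA ler_wpM2r ?fM//.
    by rewrite !mulr_ge0 ?invr_ge0 ?exprn_ge0 ?cauchyn_ge0// ltW.
  apply: (cintble_le _ bd); last exact: rintZ I.
  apply: cmeasM; first exact: cintble_cmeas If.
  apply: cmeas_real; apply: measurable_funM; first exact: measurable_cst.
  apply: measurable_funM; first exact: measurable_cst.
  have := rint_measurable I; congr measurable_fun; apply/funext => t /=.
  by rewrite scalerBr addrC.
have [I E] := vcint_affine y e0 IH.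
have -> : cintegral H = (eps k ^+ n)%:C%C * cintegral (fun x => H (y + eps k *: x)).
  rewrite E mulrA -rmorphM gtr0_norm// divff ?mul1r//.
  by rewrite expf_neq0.
rewrite /cintegral -/(cint (L n) (fun t => H (y + eps k *: rowt t))) -cintZ//.
congr cint; apply/funext => t; rewrite /H mulrCA -rmorphM; congr (_ * (_)%:C%C).
rewrite mulrA divff ?expf_neq0// mul1r addrAC subrr add0r scalerA mulVf// scale1r.
by [].
Qed.

(** Uniqueness of the limit of [A k y]. The constant is the total mass of the limiting kernel: 2^n
    from [fourier_expabsn] and pi^n from [vint_cauchyn]. *)
Lemma fourier_inversion y :
  cintegral (fun xi => expi (dotv y xi) * fourier f xi) =
  ((2 * pi) ^+ n)%:C%C * f y.
Proof.
apply: (cvgc_unique (A_cvg y)).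
have [Ic Ec] := @vint_cauchyn R n.
have c0 (x : V) : 0 <= 2 ^+ n * cauchyn x by rewrite mulr_ge0 ?exprn_ge0 ?cauchyn_ge0.
have mc : cmeas (fun t : n.-tuple (measurableTypeR R) =>
    (2 ^+ n * cauchyn (rowt t))%:C%C).
  by apply: cmeas_real; exact: (rint_measurable (rintZ (2 ^+ n) Ic)).
have -> : ((2 * pi) ^+ n)%:C%C * f y =
    cintegral (fun x : V => f y * (2 ^+ n * cauchyn x)%:C%C).
  rewrite /cintegral -/(cint (L n) (fun t => f y * (2 ^+ n * cauchyn (rowt t))%:C%C)).
  rewrite cintZ; last first.
    apply: (cintble_le mc _ (rintZ (2 ^+ n) Ic)) => t.
    by rewrite normc_real ger0_norm.
  rewrite mulrC; congr (_ * _); apply: complex_eq => /=.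
    by rewrite RintegralZl// Ec -exprMn.
  by rewrite Rintegral_cst// mul0r.
have -> : A ^~ y = (fun k => cint (L n) (fun t =>
    f (y + eps k *: rowt t) * (2 ^+ n * cauchyn (rowt t))%:C%C)).
  by apply/funext => k; exact: AE'.
apply: (cdominated (g := fun t => M * (2 ^+ n * cauchyn (rowt t)))).
- move=> k; apply: cmeasM => //; apply: cmeas_comp_row cf.
  apply: measurable_addr_row; first exact: measurable_cst_row.
  by apply: measurable_scaler_row; exact: measurable_rowt.
- by apply: cmeasM => //; exact: cmeas_cst.
- move=> t; apply: cvgcM; last exact: cvgc_cst.
  have yt : y + eps k *: rowt t @[k --> \oo] --> y.
    rewrite -[X in _ --> X]addr0 -[X in _ + X](scale0r (rowt t)).
    by apply: cvgD; [exact: cvg_cst|apply: cvgZl; exact: eps_cvg].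
  case: cf => c1 c2; split.
    exact: (cvg_comp _ _ yt (c1 y)).
  exact: (cvg_comp _ _ yt (c2 y)).
- by apply: rintZ; exact: rintZ.
- move=> k t; rewrite Normc.normcM normc_real ger0_norm//.
  by rewrite ler_wpM2r.
Qed.

End fourier_inversion.

(** * Partial derivatives *)

Section partial_derivatives.
Context {R : realType} {n : nat}.
Local Notation V := 'rV[R]_n.
Implicit Types (f g : V -> R[i]) (x y : V).

Definition cder f x v (l : R[i]) :=
  is_derive x v (fun y => Re (f y)) (Re l) /\
  is_derive x v (fun y => Im (f y)) (Im l).

Local Notation ei i := (delta_mx 0 i : V).
Local Notation pd s f := (foldr (@partial R n) f s).

Lemma cder_partial f x i l : cder f x (ei i) l -> partial i f x = l.
Proof.
move=> [d1 d2]; apply: complex_eq => /=.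
- exact: (@derive_val _ _ _ _ _ _ _ d1).
- exact: (@derive_val _ _ _ _ _ _ _ d2).
Qed.

Lemma partial_funext f g i : (forall x, cder f x (ei i) (g x)) -> partial i f = g.
Proof. by move=> H; apply/funext => x; exact: cder_partial. Qed.

Lemma cder_cst c x v : cder (fun=> c) x v 0.
Proof. by split; exact: is_derive_cst. Qed.

Lemma cderD f g x v l m : cder f x v l -> cder g x v m ->
  cder (fun y => f y + g y) x v (l + m).
Proof.
move=> [f1 f2] [g1 g2]; split.
- rewrite cReD (_ : (fun _ => _) = (fun y => Re (f y)) + (fun y => Re (g y))).
    exact: is_deriveD.
  by apply/funext => y; rewrite cReD.
- rewrite cImD (_ : (fun _ => _) = (fun y => Im (f y)) + (fun y => Im (g y))).
    exact: is_deriveD.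
  by apply/funext => y; rewrite cImD.
Qed.

Lemma cderM f g x v l m : cder f x v l -> cder g x v m ->
  cder (fun y => f y * g y) x v (l * g x + f x * m).
Proof.
move=> [f1 f2] [g1 g2]; split.
- rewrite (_ : (fun _ => _) = (fun y => Re (f y)) * (fun y => Re (g y)) -
      (fun y => Im (f y)) * (fun y => Im (g y))).
    have H := is_deriveB (is_deriveM f1 g1) (is_deriveM f2 g2).
    by apply: (is_derive_eq H); rewrite cReD !cReM /GRing.scale /=; ring.
  by apply/funext => y; rewrite cReM.
- rewrite (_ : (fun _ => _) = (fun y => Re (f y)) * (fun y => Im (g y)) +
      (fun y => Im (f y)) * (fun y => Re (g y))).
    have H := is_deriveD (is_deriveM f1 g2) (is_deriveM f2 g1).
    by apply: (is_derive_eq H); rewrite cImD !cImM /GRing.scale /=; ring.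
  by apply/funext => y; rewrite cImM.
Qed.

Lemma cderZ c f x v l : cder f x v l -> cder (fun y => c * f y) x v (c * l).
Proof. by move=> fl; have := cderM (cder_cst c x v) fl; rewrite mul0r add0r. Qed.

Lemma cder_conj f x v l : cder f x v l -> cder (fun y => conjc (f y)) x v (conjc l).
Proof.
move=> [f1 f2]; split.
- by rewrite cReJ; under eq_fun do rewrite cReJ.
- rewrite cImJ (_ : (fun _ => _) = - (fun y => Im (f y))); first exact: is_deriveN.
  by apply/funext => y; rewrite cImJ.
Qed.

(** Reduces a directional derivative to an ordinary one at 0, so that the one-variable chain rule
    applies along lines. *)
Lemma is_derive_line (h : V -> R) x v l :
  is_derive x v h l <-> is_derive (0 : R) 1 (fun t : R => h (t *: v + x)) l.
Proof.
have E : (fun t : R => t^-1 *: ((h \o shift x) (t *: v) - h x)) =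
  (fun t : R => t^-1 *: (((fun t : R => h (t *: v + x)) \o shift 0) (t *: (1 : R)) -
     (fun t : R => h (t *: v + x)) 0)).
  by apply/funext => t /=; rewrite addr0 scale0r add0r /GRing.scale /= mulr1.
split => -[d1 d2].
- by split; [rewrite /derivable -E|rewrite /derive -E].
- by split; [rewrite /derivable E|rewrite /derive E].
Qed.

Lemma is_derive_line_at (h : V -> R) x v l (s : R) :
  is_derive (s *: v + x) v h l ->
  is_derive s 1 (fun t : R => h (t *: v + x)) l.
Proof.
move=> /is_derive_line H.
have H1 : is_derive s 1 (fun t : R => t - s) 1.
  by apply: is_derive_eq; rewrite subr0.
have H2 : is_derive (s - s) 1 (fun t : R => h (t *: v + (s *: v + x))) l.
  by rewrite subrr.
have := @is_derive1_comp R (fun t : R => h (t *: v + (s *: v + x)))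
  (fun t => t - s) s l 1 H2 H1; rewrite mulr1.
congr (is_derive _ _ _ _); apply/funext => t /=.
by rewrite addrA -scalerDl subrK.
Qed.

Lemma is_derive_affine (h : V -> R) a (c : R) x v l :
  is_derive (a + c *: x) v h l ->
  is_derive x v (fun y => h (a + c *: y)) (c * l).
Proof.
move=> /is_derive_line H; apply/is_derive_line.
have H1 : is_derive (0 : R) 1 (fun t : R => c * t) c.
  by apply: is_derive_eq; rewrite /GRing.scale /= ?mulr1 ?mulr0 ?addr0.
have H2 : is_derive (c * 0 : R) 1 (fun t : R => h (t *: v + (a + c *: x))) l.
  by rewrite mulr0.
have := @is_derive1_comp R (fun t : R => h (t *: v + (a + c *: x)))
  (fun t => c * t) 0 l c H2 H1; rewrite mulrC.
congr (is_derive _ _ _ _); apply/funext => t /=.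
by rewrite scalerDr scalerA addrCA.
Qed.

Lemma cder_affine f a (c : R) x v l : cder f (a + c *: x) v l ->
  cder (fun y => f (a + c *: y)) x v (c%:C%C * l).
Proof.
move=> [f1 f2]; split.
- rewrite cReM /= mul0r subr0; exact: (@is_derive_affine (fun y => Re (f y))).
- rewrite cImM /= mul0r addr0; exact: (@is_derive_affine (fun y => Im (f y))).
Qed.

Lemma cder_expi_dotv b x i :
  cder (fun y => expi (dotv y b)) x (ei i) (Complex 0 (b 0 i) * expi (dotv x b)).
Proof.
have L t : dotv (t *: ei i + x) b = t * b 0 i + dotv x b.
  rewrite dotvDl dotvZl; congr (_ * _ + _).
  rewrite /dotv (bigD1 i)//= big1 ?addr0 => [|j ji].
    by rewrite mxE !eqxx mul1r.
  by rewrite mxE eqxx (negbTE ji) mul0r.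
split; apply/is_derive_line.
- rewrite (_ : (fun _ => _) = (fun t => cos (t * b 0 i + dotv x b))); last first.
    by apply/funext => t; rewrite L.
  apply: is_derive_eq.
  by rewrite /GRing.scale /= mul0r add0r; ring.
- rewrite (_ : (fun _ => _) = (fun t => sin (t * b 0 i + dotv x b))); last first.
    by apply/funext => t; rewrite L.
  apply: is_derive_eq.
  by rewrite /GRing.scale /= mul0r add0r; ring.
Qed.

Lemma ccontD f g : ccont f -> ccont g -> ccont (fun x => f x + g x).
Proof.
move=> [f1 f2] [g1 g2]; split => x.
- rewrite (_ : (fun _ => _) = (fun x => Re (f x) + Re (g x))); last first.
    by apply/funext => y; rewrite cReD.
  exact: (cvgD (f1 x) (g1 x)).
- rewrite (_ : (fun _ => _) = (fun x => Im (f x) + Im (g x))); last first.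
    by apply/funext => y; rewrite cImD.
  exact: (cvgD (f2 x) (g2 x)).
Qed.

Lemma ccontM f g : ccont f -> ccont g -> ccont (fun x => f x * g x).
Proof.
move=> [f1 f2] [g1 g2]; split => x.
- rewrite (_ : (fun _ => _) =
      (fun x => Re (f x) * Re (g x) - Im (f x) * Im (g x))); last first.
    by apply/funext => y; rewrite cReM.
  exact: (cvgB (cvgM (f1 x) (g1 x)) (cvgM (f2 x) (g2 x))).
- rewrite (_ : (fun _ => _) =
      (fun x => Re (f x) * Im (g x) + Im (f x) * Re (g x))); last first.
    by apply/funext => y; rewrite cImM.
  exact: (cvgD (cvgM (f1 x) (g2 x)) (cvgM (f2 x) (g1 x))).
Qed.

Lemma ccont_conj f : ccont f -> ccont (fun x => conjc (f x)).
Proof.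
move=> [f1 f2]; split => x.
- rewrite (_ : (fun _ => _) = (fun x => Re (f x))); first exact: f1.
  by apply/funext => y; rewrite cReJ.
- rewrite (_ : (fun _ => _) = (fun x => - Im (f x))); first exact: (cvgN (f2 x)).
  by apply/funext => y; rewrite cImJ.
Qed.

Lemma ccont_cst c : ccont (fun _ : V => c : R[i]).
Proof. by split; exact: cst_continuous. Qed.

Lemma ccont_affine f a (c : R) : ccont f -> ccont (fun x => f (a + c *: x)).
Proof.
have ca : continuous (fun x : V => a + c *: x).
  by move=> x; exact: (continuousD (@cst_continuous _ _ a x) (@scaler_continuous _ _ c x)).
by move=> [f1 f2]; split => x; [exact: (cvg_comp _ _ (ca x) (f1 _))|
  exact: (cvg_comp _ _ (ca x) (f2 _))].
Qed.

Lemma continuous_dotv b : continuous (fun y : V => dotv y b).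
Proof.
have addc : continuous (fun z : R * R => z.1 + z.2) by exact: add_continuous.
apply: (@continuous_big R 'I_n +%R 0 xpredT addc V (index_enum 'I_n)
  (fun i y => y 0 i * b 0 i)) => i _ x.
exact: (continuousM (@coord_continuous R 1 n 0 i x) (@cst_continuous _ _ (b 0 i) x)).
Qed.

Lemma ccont_expi_dotv b : ccont (fun y => expi (dotv y b)).
Proof.
split => x.
- exact: (cvg_comp _ _ (@continuous_dotv b x) (@continuous_cos R _)).
- exact: (cvg_comp _ _ (@continuous_dotv b x) (@continuous_sin R _)).
Qed.

(** Coinduction principle: membership in [P] propagates along a word of partial derivatives, so no
    formula for an iterated derivative has to be found. *)
Lemma smooth_coind (P : (V -> R[i]) -> Prop) :
  (forall f, P f -> ccont f /\
     forall i, exists2 g, P g & forall x, cder f x (ei i) (g x)) ->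
  forall f, P f -> smooth f.
Proof.
move=> HP f Pf s.
have : P (pd s f).
  elim: s => [//|i s IH] /=.
  have [_ /(_ i) [g Pg gE]] := HP _ IH.
  by rewrite (partial_funext gE).
move=> /HP [[c1 c2] H]; split => // i x.
have [g _ /(_ x) [[g1 _] [g2 _]]] := H i.
exact: conj g1 g2.
Qed.

Lemma smooth_ccont f s : smooth f -> ccont (pd s f).
Proof. by move=> /(_ s) [? ? _]; split. Qed.

Lemma smooth_cder f s i x : smooth f ->
  cder (pd s f) x (ei i) (pd (i :: s) f x).
Proof.
move=> /(_ s) [_ _ /(_ i x) [d1 d2]].
by split; [exact: (DeriveDef d1 erefl)|exact: (DeriveDef d2 erefl)].
Qed.

Lemma smooth_partial f i : smooth f -> smooth (partial i f).
Proof.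
by move=> sf s; have := sf (rcons s i); rewrite /= foldr_rcons.
Qed.

Lemma smooth_pd f s : smooth f -> smooth (pd s f).
Proof. by move=> sf; elim: s => [//|i s IH]; exact: smooth_partial. Qed.

Lemma smooth_cst c : smooth (fun _ : V => c : R[i]).
Proof.
apply: (@smooth_coind (fun f => exists c, f = fun=> c)); last by exists c.
move=> f [c' ->]; split; first exact: ccont_cst.
by move=> i; exists (fun=> 0); [exists 0|move=> x; exact: cder_cst].
Qed.

(** Products alone are not stable under partial derivatives, but by the Leibniz rule the closure
    under sums and products is, and [smooth_coind] applies to it. *)
Inductive alg_smooth : (V -> R[i]) -> Prop :=
| alg_base f : smooth f -> alg_smooth f
| alg_add f g : alg_smooth f -> alg_smooth g -> alg_smooth (fun x => f x + g x)
| alg_mul f g : alg_smooth f -> alg_smooth g -> alg_smooth (fun x => f x * g x).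

Lemma alg_smooth_smooth f : alg_smooth f -> smooth f.
Proof.
apply: smooth_coind => {}f; elim => {f} [f sf|f g af [cf Hf] ag [cg Hg]|
    f g af [cf Hf] ag [cg Hg]].
- split; first exact: (smooth_ccont [::] sf).
  move=> i; exists (partial i f); first exact/alg_base/smooth_partial.
  by move=> x; exact: (smooth_cder [::] i x sf).
- split; first exact: ccontD.
  move=> i; have [f' pf Ef] := Hf i; have [g' pg Eg] := Hg i.
  exists (fun x => f' x + g' x); first exact: alg_add.
  by move=> x; exact: cderD.
- split; first exact: ccontM.
  move=> i; have [f' pf Ef] := Hf i; have [g' pg Eg] := Hg i.
  exists (fun x => f' x * g x + f x * g' x); last by move=> x; exact: cderM.
  by apply: alg_add; exact: alg_mul.
Qed.

Lemma smoothD f g : smooth f -> smooth g -> smooth (fun x => f x + g x).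
Proof. by move=> ? ?; apply/alg_smooth_smooth/alg_add; exact: alg_base. Qed.
Lemma smoothM f g : smooth f -> smooth g -> smooth (fun x => f x * g x).
Proof. by move=> ? ?; apply/alg_smooth_smooth/alg_mul; exact: alg_base. Qed.
Lemma smoothZ c f : smooth f -> smooth (fun x => c * f x).
Proof. by move=> sf; exact: smoothM (smooth_cst c) sf. Qed.

Lemma smooth_conj f : smooth f -> smooth (fun x => conjc (f x)).
Proof.
move=> sf; apply: (@smooth_coind (fun f => exists2 g, smooth g &
  f = fun x => conjc (g x))); last by exists f.
move=> _ [g sg ->]; split; first exact/ccont_conj/(smooth_ccont [::] sg).
move=> i; exists (fun x => conjc (partial i g x)).
  exists (partial i g); [exact: smooth_partial|reflexivity].
by move=> x; apply: cder_conj; exact: (smooth_cder [::] i x sg).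
Qed.

Lemma smooth_affine f a (c : R) : smooth f -> smooth (fun x => f (a + c *: x)).
Proof.
move=> sf; apply: (@smooth_coind (fun f => exists g k, smooth g /\
  f = fun x => k * g (a + c *: x))); last first.
  by exists f, 1; split => //; apply/funext => x; rewrite mul1r.
move=> _ [g [k [sg ->]]]; split.
  by apply: ccontM; [exact: ccont_cst|exact/ccont_affine/(smooth_ccont [::] sg)].
move=> i; exists (fun x => (k * c%:C%C) * partial i g (a + c *: x)).
  exists (partial i g), (k * c%:C%C).
    by split; [exact: smooth_partial|reflexivity].
move=> x; rewrite -mulrA; apply: cderZ; apply: cder_affine.
exact: (smooth_cder [::] i _ sg).
Qed.

Lemma smooth_expi_dotv b : smooth (fun y => expi (dotv y b)).
Proof.
apply: (@smooth_coind (fun f => exists k, f = fun y => k * expi (dotv y b))).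
  move=> _ [k ->]; split.
    by apply: ccontM; [exact: ccont_cst|exact: ccont_expi_dotv].
  move=> i; exists (fun y => (k * Complex 0 (b 0 i)) * expi (dotv y b)).
    by exists (k * Complex 0 (b 0 i)).
  by move=> x; rewrite -mulrA; apply: cderZ; exact: cder_expi_dotv.
by exists 1; apply/funext => y; rewrite mul1r.
Qed.

Lemma pdD s f g : smooth f -> smooth g ->
  pd s (fun x => f x + g x) = fun x => pd s f x + pd s g x.
Proof.
move=> sf sg; elim: s => [//|i s IH]; rewrite [LHS]/= IH.
by apply: partial_funext => x; apply: cderD; exact: smooth_cder.
Qed.

Lemma pdZ s c f : smooth f -> pd s (fun x => c * f x) = fun x => c * pd s f x.
Proof.
move=> sf; elim: s => [//|i s IH]; rewrite [LHS]/= IH.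
by apply: partial_funext => x; apply: cderZ; exact: smooth_cder.
Qed.

Lemma pd_conj s f : smooth f ->
  pd s (fun x => conjc (f x)) = fun x => conjc (pd s f x).
Proof.
move=> sf; elim: s => [//|i s IH]; rewrite [LHS]/= IH.
by apply: partial_funext => x; apply: cder_conj; exact: smooth_cder.
Qed.

Lemma pd_affine s f a (c : R) : smooth f ->
  pd s (fun x => f (a + c *: x)) =
  fun x => (c ^+ size s)%:C%C * pd s f (a + c *: x).
Proof.
move=> sf; elim: s => [|i s IH]; first by apply/funext => x /=; rewrite mul1r.
rewrite [LHS]/= IH; apply: partial_funext => x.
rewrite [size _]/= exprSr rmorphM -mulrA; apply: cderZ; apply: cder_affine.
exact: smooth_cder.
Qed.

(** The word is split at its last letter because [foldr] applies that derivative first: the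
    exponential yields a scalar, and what remains is again a modulated function under the shorter
    word. *)
Lemma pd_mod s i b f : smooth f ->
  pd (rcons s i) (fun y => expi (dotv y b) * f y) =
  fun y => Complex 0 (b 0 i) * pd s (fun y => expi (dotv y b) * f y) y +
    pd s (fun y => expi (dotv y b) * partial i f y) y.
Proof.
move=> sf; have se := smooth_expi_dotv b.
rewrite foldr_rcons.
have -> : partial i (fun y => expi (dotv y b) * f y) =
    (fun y => Complex 0 (b 0 i) * (expi (dotv y b) * f y) +
      expi (dotv y b) * partial i f y).
  apply: partial_funext => x; rewrite mulrA; apply: cderM.
    exact: cder_expi_dotv.
  exact: (smooth_cder [::] i x sf).
have s1 := smoothM se sf; have s2 := smoothM se (smooth_partial i sf).
by rewrite (pdD s (smoothZ _ s1) s2) (pdZ s _ s1).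
Qed.

End partial_derivatives.

(** * Weights *)

Section euclidean_norm.
Context {R : realType}.

Lemma dotv_ge0 n (x : 'rV[R]_n) : 0 <= dotv x x.
Proof. by apply: sumr_ge0 => i _; rewrite -expr2 sqr_ge0. Qed.

Lemma enorm_ge0 n (x : 'rV[R]_n) : 0 <= enorm x.
Proof. exact: sqrtr_ge0. Qed.

Lemma sqr_enorm n (x : 'rV[R]_n) : enorm x ^+ 2 = dotv x x.
Proof. by rewrite sqr_sqrtr// dotv_ge0. Qed.

Lemma enormN n (x : 'rV[R]_n) : enorm (- x) = enorm x.
Proof. by rewrite /enorm dotvNl dotvNr opprK. Qed.

Lemma le_coord_enorm n (x : 'rV[R]_n) i : `|x 0 i| <= enorm x.
Proof.
rewrite -(@ler_pXn2r _ 2)// ?nnegrE ?enorm_ge0// sqr_enorm real_normK ?num_real//.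
rewrite /dotv (bigD1 i)//= -expr2 lerDl.
by apply: sumr_ge0 => j _; rewrite -expr2 sqr_ge0.
Qed.

Lemma enorm0_eq0 n (x : 'rV[R]_n) : enorm x = 0 -> x = 0.
Proof.
move=> x0; apply/rowP => i; rewrite mxE; apply/normr0_eq0/eqP.
by rewrite eq_le normr_ge0 andbT -x0 le_coord_enorm.
Qed.

Lemma dotv_le n (x y : 'rV[R]_n) : dotv x y <= enorm x * enorm y.
Proof.
have [y0|y0] := eqVneq (enorm y) 0.
  rewrite y0 mulr0 (enorm0_eq0 y0) /dotv big1// => i _.
  by rewrite mxE mulr0.
have yp : 0 < enorm y by rewrite lt_neqAle eq_sym y0 enorm_ge0.
(* Cauchy-Schwarz expresses the nonnegativity of [dotv z z] for this multiple of the component of x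
   orthogonal to y. *)
set z := (enorm y ^+ 2) *: x - dotv x y *: y.
have E : dotv z z = enorm y ^+ 2 * ((enorm x * enorm y) ^+ 2 - dotv x y ^+ 2).
  rewrite /z !(dotvBl, dotvBr, dotvZl, dotvZr) -!sqr_enorm (dotvC y x).
  by ring.
have := dotv_ge0 z; rewrite E.
rewrite pmulr_rge0 ?exprn_gt0// subr_ge0 => H.
apply: (le_trans (ler_norm _)).
rewrite -(@ler_pXn2r _ 2)// ?nnegrE ?mulr_ge0 ?enorm_ge0//.
by rewrite real_normK ?num_real.
Qed.

Lemma enormD n (x y : 'rV[R]_n) : enorm (x + y) <= enorm x + enorm y.
Proof.
rewrite -(@ler_pXn2r _ 2)// ?nnegrE ?addr_ge0 ?enorm_ge0//.
rewrite sqr_enorm sqrrD !sqr_enorm dotvDl !dotvDr (dotvC y x).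
have := dotv_le x y; lra.
Qed.

Lemma dotv_abs_le n (x y : 'rV[R]_n) : `|dotv x y| <= enorm x * enorm y.
Proof.
by rewrite ler_norml dotv_le andbT lerNl -dotvNl -(enormN x) dotv_le.
Qed.

Lemma dotv_row_mx n (x y x' y' : 'rV[R]_n) :
  dotv (row_mx x y) (row_mx x' y') = dotv x x' + dotv y y'.
Proof.
rewrite /dotv big_split_ord /=; congr (_ + _); apply: eq_bigr => i _.
- by rewrite !row_mxEl.
- by rewrite !row_mxEr.
Qed.

Lemma enorm_row_mx_l n (x y : 'rV[R]_n) : enorm x <= enorm (row_mx x y).
Proof. by rewrite ler_sqrt ?dotv_ge0// dotv_row_mx lerDl dotv_ge0. Qed.
Lemma enorm_row_mx_r n (x y : 'rV[R]_n) : enorm y <= enorm (row_mx x y).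
Proof. by rewrite ler_sqrt ?dotv_ge0// dotv_row_mx lerDr dotv_ge0. Qed.
Lemma enorm_row_mx n (x y : 'rV[R]_n) : enorm (row_mx x y) <= enorm x + enorm y.
Proof.
rewrite -(@ler_pXn2r _ 2)// ?nnegrE ?addr_ge0 ?enorm_ge0//.
rewrite sqr_enorm dotv_row_mx sqrrD -!sqr_enorm.
have := enorm_ge0 x; have := enorm_ge0 y; nra.
Qed.

End euclidean_norm.

(** * Consequences of the weight axioms *)

Section weight_facts.
Context {R : realType} (w : R -> R).
Hypothesis hw : nonquasianalytic_subadditive_weight w.

Definition W n (y : 'rV[R]_n) := w (enorm y).

Lemma W_ge0 n (y : 'rV[R]_n) : 0 <= W y.
Proof. by apply: (weight_ge0 hw); exact: enorm_ge0. Qed.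

Lemma weight_mono s t : 0 <= s -> s <= t -> w s <= w t.
Proof.
move=> s0 st; apply: (weight_increasing hw) => //.
- by rewrite in_itv /= s0.
- by rewrite in_itv /= (le_trans s0).
Qed.

Lemma WD n (x y : 'rV[R]_n) : W (x + y) <= W x + W y.
Proof.
apply: (le_trans (weight_mono (enorm_ge0 _) (enormD x y))).
by apply: (weight_subadditive hw); exact: enorm_ge0.
Qed.

Lemma WN n (x : 'rV[R]_n) : W (- x) = W x.
Proof. by rewrite /W enormN. Qed.

Lemma WB n (x y : 'rV[R]_n) : W x <= W (x - y) + W y.
Proof. by rewrite -{1}(subrK y x) WD. Qed.

Lemma W_row_mx n (x y : 'rV[R]_n) : W (row_mx x y) <= W x + W y.
Proof.
apply: (le_trans (weight_mono (enorm_ge0 _) (enorm_row_mx x y))).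
by apply: (weight_subadditive hw); exact: enorm_ge0.
Qed.
Lemma W_row_mx_l n (x y : 'rV[R]_n) : W x <= W (row_mx x y).
Proof. exact: weight_mono (enorm_ge0 _) (enorm_row_mx_l _ _). Qed.
Lemma W_row_mx_r n (x y : 'rV[R]_n) : W y <= W (row_mx x y).
Proof. exact: weight_mono (enorm_ge0 _) (enorm_row_mx_r _ _). Qed.

(** Condition (gamma) with the constant 1/(N+1) at 1 + t, followed by subadditivity, gives N log(1 +
    t) <= w(1) + w(t) for large t. On the remaining bounded range the second summand of the constant
    suffices, since [expR (w t)] is at least 1. *)
Lemma poly_le_weight (N : nat) : exists2 C : R, 0 < C &
  forall t, 0 <= t -> (1 + t) ^+ N <= C * expR (w t).
Proof.
have e0 : 0 < N.+1%:R^-1 :> R by rewrite invr_gt0.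
have /eqoP := weight_log hw.
move=> /(_ _ e0) [T [_ HT]].
pose T' := Num.max T 1 + 1.
have T'0 : 0 < T' by rewrite /T' addr_gt0// lt_max ltr01 orbT.
exists (expR (w 1) + (1 + T') ^+ N).
  by rewrite addr_gt0 ?expR_gt0// exprn_gt0// addr_gt0.
move=> t t0; have wt0 := weight_ge0 hw t0.
have E1 : 1 <= expR (w t) by rewrite -expR0 ler_expR.
have [tT|tT] := leP T' t; last first.
  rewrite mulrDl; apply: (@le_trans _ _ ((1 + T') ^+ N * expR (w t))).
    apply: (@le_trans _ _ ((1 + T') ^+ N)).
      by apply: lerXn2r; rewrite ?nnegrE; [lra|lra|lra].
    by rewrite ler_peMr// exprn_ge0// addr_ge0// ltW.
  by rewrite lerDr mulr_ge0 ?expR_ge0.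
have Tt : T < 1 + t.
  have : T <= Num.max T 1 by rewrite le_max lexx.
  by move: tT; rewrite /T'; lra.
have t1 : 0 < 1 + t by rewrite ltr_pwDl.
have := HT _ Tt; rewrite /= => H.
have wt1 : 0 <= w (1 + t) by apply: (weight_ge0 hw); exact: ltW.
rewrite (ger0_norm wt1) in H.
have {}H : ln (1 + t) *+ N <= w 1 + w t.
  apply: (le_trans _ (weight_subadditive hw ler01 t0)).
  rewrite -mulr_natl; apply: (@le_trans _ _ (N%:R * (N.+1%:R^-1 * w (1 + t)))).
    rewrite ler_wpM2l//; apply: (le_trans (ler_norm _)); exact: H.
  rewrite mulrA ler_piMl// ler_pdivrMr// mul1r ler_nat.
  by rewrite leqnSn.
have -> : (1 + t) ^+ N = expR (ln (1 + t) *+ N).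
  by rewrite -mulr_natl expRM_natl lnK// posrE.
apply: (@le_trans _ _ (expR (w 1) * expR (w t))).
  by rewrite -expRD ler_expR.
by rewrite ler_wpM2r ?expR_ge0// lerDl exprn_ge0// addr_ge0// ltW.
Qed.

Lemma poly_le_W (N : nat) : exists2 C : R, 0 < C &
  forall n (y : 'rV[R]_n), (1 + enorm y) ^+ N <= C * expR (W y).
Proof.
have [C C0 H] := poly_le_weight N; exists C => // n y.
by apply: H; exact: enorm_ge0.
Qed.

(** Each factor 1 + y_i^2 is at most (1 + |y|)^2, so the exponent 2n in [poly_le_W] covers the whole
    product. *)
Lemma expNW_le_cauchyn n : exists2 C : R, 0 < C &
  forall y : 'rV[R]_n, expR (- W y) <= C * cauchyn y.
Proof.
have [C C0 H] := poly_le_W (2 * n); exists C => // y.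
have q0 : 0 < \prod_(i < n) (1 + y 0 i ^+ 2).
  by apply: prodr_gt0 => i _; rewrite ltr_pwDl// sqr_ge0.
have -> : cauchyn y = (\prod_(i < n) (1 + y 0 i ^+ 2))^-1.
  by rewrite /cauchyn prodfV.
rewrite expRN ler_pdivlMr// mulrC ler_pdivrMr ?expR_gt0//.
apply: (le_trans _ (H n y)); rewrite exprM -[n in _ ^+ n]card_ord -prodr_const.
apply: ler_prod => i _; rewrite addr_ge0 ?sqr_ge0//= sqrrD expr1n mul1r.
have := le_coord_enorm y i; have := enorm_ge0 y => e0 e1.
have : y 0 i ^+ 2 <= enorm y ^+ 2.
  by rewrite -real_normK ?num_real// lerXn2r ?nnegrE.
have : 0 <= enorm y *+ 2 by rewrite mulrn_wge0.
lra.
Qed.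

End weight_facts.

(** * Differentiation under the integral sign *)

Section lipschitz.
Context {R : realType} {n : nat}.
Local Notation V := 'rV[R]_n.
Local Notation ei i := (delta_mx 0 i : V).

Lemma derive_lipschitz (h h' : R -> R) (B : R) :
  (forall t : R, is_derive t 1 h (h' t)) -> (forall t, `|h' t| <= B) ->
  forall a b, `|h a - h b| <= B * `|a - b|.
Proof.
move=> dh hB a b; wlog ab : a b / a <= b.
  by move=> H; have [/H//|/ltW/H] := leP a b; rewrite distrC [X in _ * X]distrC.
have ch : {within `[a, b], continuous h}.
  apply: continuous_subspaceT => x; apply/differentiable_continuous/derivable1_diffP.
  by have [] := dh x.
have [c _ E] := MVT_segment ab (fun x _ => dh x) ch.
by rewrite distrC E normrM [X in _ <= _ * X]distrC ler_wpM2r.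
Qed.

(** The path from y to x changes one coordinate at a time. The factor 2 comes from applying the mean
    value theorem to the real and imaginary parts separately. *)
Lemma smooth_lipschitz (f : V -> R[i]) (B : 'I_n -> R) : smooth f ->
  (forall i x, normc (partial i f x) <= B i) ->
  forall x y, normc (f x - f y) <= \sum_(i < n) 2 * B i * `|x 0 i - y 0 i|.
Proof.
move=> sf fB x y.
(* Corner k of the path: the first k coordinates are already those of x. *)
pose p k : V := \row_j (if (j < k)%N then x 0 j else y 0 j).
have p0 : p 0%N = y by apply/rowP => j; rewrite mxE.
have pn : p n = x by apply/rowP => j; rewrite mxE ltn_ord.
have step (k : 'I_n) : normc (f (p k.+1) - f (p k)) <= 2 * B k * `|x 0 k - y 0 k|.
  have pk : p k.+1 = (x 0 k - y 0 k) *: ei k + p k.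
    apply/rowP => j; rewrite !mxE eqxx /= ltnS leq_eqVlt.
    case: eqVneq => [/val_inj ->|jk]; first by rewrite /= eqxx ltnn mulr1 subrK.
    have -> : (j == k) = false by apply/eqP => E; rewrite E eqxx in jk.
    by rewrite /= mulr0 add0r.
  have D t : cder f (t *: ei k + p k) (ei k) (partial k f (t *: ei k + p k)).
    exact: (smooth_cder [::] k _ sf).
  rewrite pk.
  have H1 : `|Re (f ((x 0 k - y 0 k) *: ei k + p k)) - Re (f (0 *: ei k + p k))|
      <= B k * `|(x 0 k - y 0 k) - 0|.
    apply: (@derive_lipschitz (fun t => Re (f (t *: ei k + p k)))
       (fun t => Re (partial k f (t *: ei k + p k)))).
      move=> t; exact: (@is_derive_line_at _ _ (fun y => Re (f y)) _ _ _ _ (D t).1).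
    by move=> t; apply: (le_trans (le_Re_normc _)); exact: fB.
  have H2 : `|Im (f ((x 0 k - y 0 k) *: ei k + p k)) - Im (f (0 *: ei k + p k))|
      <= B k * `|(x 0 k - y 0 k) - 0|.
    apply: (@derive_lipschitz (fun t => Im (f (t *: ei k + p k)))
       (fun t => Im (partial k f (t *: ei k + p k)))).
      move=> t; exact: (@is_derive_line_at _ _ (fun y => Im (f y)) _ _ _ _ (D t).2).
    by move=> t; apply: (le_trans (le_Im_normc _)); exact: fB.
  apply: (le_trans (le_normc_ReIm _)); rewrite cReD cImD cReN cImN.
  rewrite scale0r add0r subr0 in H1 H2.
  by rewrite -mulrA mulr_natl mulr2n lerD.
rewrite -{1}pn -{1}p0 -(telescope_sumr (fun k => f (p k)) (leq0n n)) big_mkord.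
have : normc (\sum_(i < n) (f (p i.+1) - f (p i))) <=
    \sum_(i < n) normc (f (p i.+1) - f (p i)).
  elim/big_rec2: _ => [|i a b _ IH]; first by rewrite Normc.normc0.
  by apply: (le_trans (le_normcD _ _)); rewrite lerD2l.
move=> /le_trans; apply; apply: ler_sum => i _; exact: step.
Qed.

Lemma continuous_box (h : V -> R) :
  (forall x e, 0 < e -> exists2 r, 0 < r & forall y, box x r y -> `|h x - h y| < e) ->
  continuous h.
Proof.
move=> H x U /nbhs_ballP[e /= e0 eU]; have [r r0 xr] := H x e e0.
by apply/nbhs_box; exists r => // y yb; apply: eU; exact: xr.
Qed.

Lemma ccont_box (f : V -> R[i]) :
  (forall x e, 0 < e ->
    exists2 r, 0 < r & forall y, box x r y -> normc (f x - f y) < e) -> ccont f.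
Proof.
move=> H; split; apply: continuous_box => x e e0; have [r r0 xr] := H x e e0;
  exists r => // y /xr; apply: le_lt_trans.
- by rewrite -cReN -cReD; exact: le_Re_normc.
- by rewrite -cImN -cImD; exact: le_Im_normc.
Qed.

Lemma ccont_lipschitz (f : V -> R[i]) (B : 'I_n -> R) :
  (forall x y, normc (f x - f y) <= \sum_(i < n) B i * `|x 0 i - y 0 i|) ->
  ccont f.
Proof.
move=> fB; apply: ccont_box => x e e0.
pose M := \sum_(i < n) `|B i| + 1.
have M0 : 0 < M by rewrite ltr_wpDl// sumr_ge0.
exists (e / M); first by rewrite divr_gt0.
move=> y xy; apply: (le_lt_trans (fB _ _)).
apply: (@le_lt_trans _ _ (\sum_(i < n) `|B i| * (e / M))).
  apply: ler_sum => i _; apply: (le_trans (ler_norm _)); rewrite normrM normr_id.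
  by rewrite ler_wpM2l// distrC ltW.
rewrite -mulr_suml mulrCA gtr_pMr// ltr_pdivrMr// mul1r /M.
by rewrite ltrDl.
Qed.

End lipschitz.

Section smooth_under_integral.
Context {R : realType} {n : nat} d {Z : measurableType d}.
Variable mu : {measure set Z -> \bar R}.
Local Notation V := 'rV[R]_n.
Local Notation ei i := (delta_mx 0 i : V).
Local Notation pd s f := (foldr (@partial R n) f s).

(** Along the line through x in direction v this is one-variable differentiation under the integral.
    The domination holds for all parameters, so any open interval around 0 would do; []-1, 1[] is
    one. *)
Lemma is_derive_Rintegral (h h' : V -> Z -> R) (H : Z -> R) x v :
  (forall y, rint mu (h y)) -> rint mu H ->
  (forall y z, is_derive y v (h^~ z) (h' y z)) ->
  (forall y z, `|h' y z| <= H z) ->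
  is_derive x v (fun y => \int[mu]_z h y z) (\int[mu]_z h' x z).
Proof.
move=> Ih IH dh hH; apply/is_derive_line.
pose f (t : R) z := h (t *: v + x) z.
have dl (t : R) (z : Z) : is_derive t 1 (f^~ z) (h' (t *: v + x) z).
  exact: (@is_derive_line_at _ _ (h^~ z) _ _ _ _ (dh _ z)).
have pE (t : R) (z : Z) : partial1of2 f t z = h' (t *: v + x) z.
  by rewrite partial1of2E; have := dl t z => D; exact: derive_val.
have H0 z : 0 <= H z by exact: le_trans (normr_ge0 _) (hH x z).
have I0 : `](-1), 1[%classic (0 : R) by rewrite /= in_itv /= ltrN10 ltr01.
have If t : `](-1), 1[%classic t -> mu.-integrable setT (EFin \o f t).
  by move=> _; exact: Ih.
have Df t z : `](-1), 1[%classic t -> setT z -> derivable (f ^~ z) t 1.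
  by move=> _ _; have [] := dl t z.
have Bf t z : `](-1), 1[%classic t -> setT z -> `|partial1of2 f t z| <= H z.
  by move=> _ _; rewrite pE.
have D1 := derivable_under_integral measurableT I0 If Df H0 IH Bf.
have D2 := differentiation_under_integral measurableT I0 If Df H0 IH Bf.
apply: (DeriveDef D1); rewrite -derive1E D2.
by apply: eq_Rintegral => z _; rewrite pE scale0r add0r.
Qed.

Variable F : Z -> V -> R[i].
Hypothesis sF : forall z, smooth (F z).
Hypothesis mF : forall s y, cmeas (fun z => pd s (F z) y).
Hypothesis bF : forall s, exists2 H : Z -> R, rint mu H &
  forall z y, normc (pd s (F z) y) <= H z.

Lemma cintble_pd s y : cintble mu (fun z => pd s (F z) y).
Proof. by have [H IH bH] := bF s; apply: (cintble_le _ _ IH). Qed.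

Let G s y := cint mu (fun z => pd s (F z) y).

Let cder_G s i x : cder (G s) x (ei i) (G (i :: s) x).
Proof.
have [H IH bH] := bF (i :: s); split.
- apply: (@is_derive_Rintegral (fun y z => Re (pd s (F z) y))
    (fun y z => Re (pd (i :: s) (F z) y)) H _ _ _ IH).
  + by move=> y; have [] := cintble_pd s y.
  + by move=> y z; have [] := smooth_cder s i y (sF z).
  + by move=> y z; apply: (le_trans (le_Re_normc _)); exact: bH.
- apply: (@is_derive_Rintegral (fun y z => Im (pd s (F z) y))
    (fun y z => Im (pd (i :: s) (F z) y)) H _ _ _ IH).
  + by move=> y; have [] := cintble_pd s y.
  + by move=> y z; have [] := smooth_cder s i y (sF z).
  + by move=> y z; apply: (le_trans (le_Im_normc _)); exact: bH.
Qed.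

(** Lipschitz continuity: the constants are twice the integrals of the majorants of the derivatives
    one order higher. *)
Let ccont_G s : ccont (G s).
Proof.
have /choice[H /all_and2[IH bH]] : forall i : 'I_n, exists H : Z -> R, rint mu H /\
    forall z y, normc (pd (i :: s) (F z) y) <= H z.
  by move=> i; have [H IH bH] := bF (i :: s); exists H.
apply: (@ccont_lipschitz _ _ _ (fun i => 2 * \int[mu]_z H i z)) => x y.
rewrite /G -cintB; [|exact: cintble_pd|exact: cintble_pd].
pose K z := \sum_(i < n) 2 * H i z * `|x 0 i - y 0 i|.
have IK : rint mu (fun z => \sum_(i < n) (2 * `|x 0 i - y 0 i|) * H i z) /\
    \int[mu]_z (\sum_(i < n) (2 * `|x 0 i - y 0 i|) * H i z) =
    \sum_(i < n) (2 * `|x 0 i - y 0 i|) * \int[mu]_z H i z.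
  elim: (index_enum _) => [|i r [IHr E]].
    rewrite big_nil; under eq_fun do rewrite big_nil.
    split; first exact: integrable0.
    by rewrite Rintegral_cst// mul0r.
  have I1 := rintZ (2 * `|x 0 i - y 0 i|) (IH i).
  rewrite big_cons -E; under eq_fun do rewrite big_cons.
  split; first exact: rintD.
  rewrite (RintegralD measurableT I1 IHr).
  by rewrite (RintegralZl _ measurableT (IH i)).
rewrite (eq_bigr (fun i => (2 * `|x 0 i - y 0 i|) * \int[mu]_z H i z)); last first.
  by move=> i _; rewrite mulrAC.
rewrite -IK.2; apply: (normc_cint_le _ _ IK.1).
  by apply: cmeasB; exact: mF.
move=> z; rewrite (eq_bigr (fun i => 2 * H i z * `|x 0 i - y 0 i|)); last first.
  by move=> i _; rewrite mulrAC.
apply: smooth_lipschitz; first exact: smooth_pd.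
by move=> i t; exact: bH.
Qed.

Lemma smooth_cint : smooth (fun y => cint mu (fun z => F z y)).
Proof.
apply: (@smooth_coind _ _ (fun f => exists s, f = G s)); last by exists [::].
move=> _ [s ->]; split; first exact: ccont_G.
move=> i; exists (G (i :: s)); first by exists (i :: s).
by move=> x; exact: cder_G.
Qed.

Lemma pd_cint s : pd s (fun y => cint mu (fun z => F z y)) =
  fun y => cint mu (fun z => pd s (F z) y).
Proof.
elim: s => [//|i s IH]; rewrite [LHS]/= IH.
by apply: partial_funext => x; exact: (cder_G s i x).
Qed.

End smooth_under_integral.

(** * Rapid decrease against the weight *)

Section rapid_decay.
Context {R : realType} (w : R -> R).
Hypothesis hw : nonquasianalytic_subadditive_weight w.
Context {n : nat}.
Local Notation V := 'rV[R]_n.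
Local Notation L := (lebesgue_tuple R n).
Local Notation W := (W w).
Local Notation pd s f := (foldr (@partial R n) f s).

Definition decays (h : V -> R[i]) :=
  forall l : R, exists C, forall y, expR (l * W y) * normc (h y) <= C.

(** Derivatives are indexed by words, in any order, so that inductions can remove one letter;
    [S_omega_rapid] and [rapid_S_omega] give the link with multi-indices. *)
Definition rapid (f : V -> R[i]) := smooth f /\ forall s, decays (pd s f).

Lemma decays_bound (h : V -> R[i]) l : decays h ->
  exists2 C : R, 0 < C & forall y, normc (h y) <= C * expR (- (l * W y)).
Proof.
move=> /(_ l) [C HC]; exists (`|C| + 1); first by rewrite ltr_wpDl.
move=> y; rewrite expRN ler_pdivlMr ?expR_gt0// mulrC.
apply: (le_trans (HC y)); apply: (le_trans (ler_norm _)).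
by rewrite lerDl.
Qed.

Lemma decays_bounded (h : V -> R[i]) : decays h ->
  exists2 C : R, 0 < C & forall y, normc (h y) <= C.
Proof.
move=> /(decays_bound 0)[C C0 H]; exists C => // y.
by have := H y; rewrite mul0r oppr0 expR0 mulr1.
Qed.

(** [S_omega] only speaks of positive exponents; monotonicity in l reaches every real l from
    [|l| + 1]. *)
Lemma decays_le (h : V -> R[i]) :
  (forall l, 0 < l -> exists C, forall y, expR (l * W y) * normc (h y) <= C) ->
  decays h.
Proof.
move=> H l; have [C HC] := H (`|l| + 1) (ltr_wpDl (normr_ge0 _) ltr01).
exists C => y; apply: le_trans (HC y); rewrite ler_wpM2r ?normc_ge0// ler_expR.
rewrite ler_wpM2r ?W_ge0//; apply: (le_trans (ler_norm _)).
by rewrite lerDl.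
Qed.

Lemma decays_cauchyn (h : V -> R[i]) : decays h ->
  exists2 C : R, 0 < C & forall y, normc (h y) <= C * cauchyn y.
Proof.
move=> /(decays_bound 1)[C C0 HC]; have [K K0 HK] := expNW_le_cauchyn hw n.
exists (C * K); first exact: mulr_gt0.
move=> y; apply: (le_trans (HC y)); rewrite mul1r -mulrA ler_wpM2l//; exact: ltW.
Qed.

Lemma decays_vcint (h : V -> R[i]) : vcmeas h -> decays h -> vcint h.
Proof.
move=> mh /decays_cauchyn[C C0 HC].
by apply: (cintble_le mh (fun t => HC _)); apply: rintZ; exact: (@vint_cauchyn R n).1.
Qed.

(** A polynomial factor is absorbed by raising the exponent from l to l + 1, through [poly_le_W]. *)
Lemma decaysM_enorm (h g : V -> R[i]) (N : nat) : decays h ->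
  (forall y, normc (g y) <= (1 + enorm y) ^+ N * normc (h y)) -> decays g.
Proof.
move=> dh gh l; have [K K0 HK] := poly_le_W hw N.
have [C HC] := dh (l + 1); exists (K * C) => y.
apply: (@le_trans _ _ (expR (l * W y) * ((K * expR (W y)) * normc (h y)))).
  rewrite ler_wpM2l ?expR_ge0//; apply: (le_trans (gh y)).
  by rewrite ler_wpM2r ?normc_ge0.
have -> : expR (l * W y) * (K * expR (W y) * normc (h y)) =
    K * (expR ((l + 1) * W y) * normc (h y)).
  by rewrite mulrDl mul1r expRD; ring.
by rewrite ler_wpM2l// ltW.
Qed.

Lemma pd_expi s (b : V) c : pd s (fun y => expi (dotv y b) * c) =
  fun y => (\prod_(i <- s) Complex 0 (b 0 i)) * (expi (dotv y b) * c).
Proof.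
elim: s => [|i s IH]; first by apply/funext => y; rewrite big_nil mul1r.
rewrite [LHS]/= IH; apply: partial_funext => y; rewrite big_cons.
have -> : Complex 0 (b 0 i) * \prod_(j <- s) Complex 0 (b 0 j) *
    (expi (dotv y b) * c) = \prod_(j <- s) Complex 0 (b 0 j) *
    (Complex 0 (b 0 i) * expi (dotv y b) * c + expi (dotv y b) * 0) by ring.
apply: cderZ; apply: cderM; [exact: cder_expi_dotv|exact: cder_cst].
Qed.

Lemma normc_prod_coord (s : seq 'I_n) (b : V) :
  normc (\prod_(i <- s) Complex 0 (b 0 i)) <= (1 + enorm b) ^+ size s.
Proof.
elim: s => [|i s IH]; first by rewrite big_nil Normc.normc1 expr0.
rewrite big_cons Normc.normcM exprS; apply: ler_pM; rewrite ?normc_ge0//.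
have -> : normc (Complex 0 (b 0 i)) = `|b 0 i|.
  by rewrite /= expr0n add0r sqrtr_sqr.
by apply: (le_trans (le_coord_enorm b i)); rewrite lerDr.
Qed.

Section inverse_transform.
Variables (sg : R) (h : V -> R[i]).
Hypotheses (sg1 : `|sg| = 1) (mh : vcmeas h) (dh : decays h).

Let b (t : n.-tuple (measurableTypeR R)) : V := sg *: rowt t.
Let F t y := expi (dotv y (b t)) * h (rowt t).

Let enorm_b t : enorm (b t) = enorm (rowt t).
Proof.
by rewrite /enorm /b dotvZl dotvZr mulrA -expr2 -real_normK ?num_real// sg1
  expr1n mul1r.
Qed.

Let sF t : smooth (F t).
Proof. exact: smoothM (smooth_expi_dotv _) (smooth_cst _). Qed.

Let mb i : measurable_fun setT (fun t => b t 0 i : measurableTypeR R).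
Proof. by apply: measurable_scaler_row; exact: measurable_rowt. Qed.

Let mF s y : cmeas (fun t => pd s (F t) y).
Proof.
rewrite /F; under eq_fun do rewrite pd_expi.
apply: cmeasM; last first.
  by apply: cmeasM => //; apply: cmeas_expi_dotv => //; exact: measurable_cst_row.
apply: cmeas_prod => i; split; first exact: measurable_cst.
exact: mb.
Qed.

Let bF s : exists2 H, rint L H & forall t y, normc (pd s (F t) y) <= H t.
Proof.
have [|C C0 HC] := @decays_cauchyn (fun x => ((1 + enorm x) ^+ size s)%:C%C * h x).
  apply: (decaysM_enorm (N := size s) dh) => y.
  by rewrite Normc.normcM normc_real ger0_norm// exprn_ge0// addr_ge0// enorm_ge0.
exists (fun t => C * cauchyn (rowt t)).
  by apply: rintZ; exact: (@vint_cauchyn R n).1.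
move=> t y; apply: le_trans (HC _); rewrite /F pd_expi !Normc.normcM normc_expi mul1r.
rewrite ler_wpM2r ?normc_ge0// normc_real ger0_norm.
  by rewrite -enorm_b; exact: normc_prod_coord.
by rewrite exprn_ge0// addr_ge0// enorm_ge0.
Qed.

(** With [sg] equal to -1 this is the Fourier transform ([fourier_ift]), with 1 its inverse up to
    the factor (2 pi)^n; both signs are treated at once. *)
Definition ift (y : V) := cint L (fun t => F t y).

Lemma smooth_ift : smooth ift.
Proof. exact: smooth_cint. Qed.

(** Symmetry of mixed partials for transforms: a word of derivatives multiplies the integrand by a
    product over its letters, which does not see their order. *)
Lemma pd_ift_perm s s' : perm_eq s s' -> pd s ift = pd s' ift.
Proof.
move=> ss'; rewrite /ift !pd_cint//; apply/funext => y; congr cint.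
by apply/funext => t; rewrite /F !pd_expi (perm_big _ ss').
Qed.

End inverse_transform.

Lemma iter_partial k i (f : V -> R[i]) : iter k (partial i) f = pd (nseq k i) f.
Proof. by elim: k => [//|k IH]; rewrite iterS IH. Qed.

Definition seq_of (a : multi_index n) : seq 'I_n :=
  flatten [seq nseq (a i) i | i <- enum 'I_n].

Lemma mpartialE a f : mpartial a f = pd (seq_of a) f.
Proof.
rewrite /mpartial /seq_of; elim: (enum 'I_n) => [//|i r IH] /=.
by rewrite foldr_cat -IH iter_partial.
Qed.

Lemma size_seq_of a : size (seq_of a) = mabs a.
Proof.
rewrite /seq_of size_flatten /shape -map_comp sumnE big_map /mabs big_enum /=.
by apply: eq_bigr => i _ /=; rewrite size_nseq.
Qed.

Lemma perm_seq_of (s : seq 'I_n) :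
  perm_eq s (seq_of [ffun i => count_mem i s]).
Proof.
apply/allP => x _ /=; apply/eqP; rewrite /seq_of count_flatten -map_comp sumnE.
rewrite big_map big_enum /= (bigD1 x)//= ffunE count_nseq /= eqxx mul1n.
rewrite big1 ?addn0// => j jx; rewrite /= ffunE count_nseq /=.
by rewrite (negbTE jx) mul0n.
Qed.

Lemma normc_mD a (f : V -> R[i]) y : normc (mD a f y) = normc (pd (seq_of a) f y).
Proof.
rewrite /mD Normc.normcM mpartialE; set c := (X in X * _).
suff -> : c = 1 by rewrite mul1r.
rewrite /c; elim: (mabs a) => [|k IH]; first by rewrite expr0 Normc.normc1.
by rewrite exprS Normc.normcM IH mulr1 /= expr0n add0r sqrrN expr1n sqrtr1.
Qed.

Lemma normc_mmonomial (m : multi_index n) (x : V) :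
  `|mmonomial m x| <= (1 + enorm x) ^+ mabs m.
Proof.
rewrite /mmonomial /mabs expr_sum normr_prod; apply: ler_prod => i _.
rewrite normr_ge0 /= normrX; apply: lerXn2r; rewrite ?nnegrE//.
  by rewrite addr_ge0// enorm_ge0.
by apply: (le_trans (le_coord_enorm x i)); rewrite lerDr.
Qed.

(** The Schwartz bounds follow from the weighted ones at l = 1, since [poly_le_W] bounds monomials
    by a multiple of exp(w). *)
Lemma rapid_S_omega f : rapid f -> rapid (fourier f) -> S_omega w f.
Proof.
move=> [sf df] [_ dff]; split.
  split => // a b.
  have [C HC] := df (seq_of a) 1; have [K K0 HK] := poly_le_W hw (mabs b).
  exists (K * C) => _ [x _ <-]; rewrite normc_mD.
  apply: (@le_trans _ _ ((K * expR (W x)) * normc (pd (seq_of a) f x))).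
    rewrite ler_wpM2r ?normc_ge0//; apply: (le_trans (normc_mmonomial b x)).
    exact: HK.
  rewrite -mulrA ler_wpM2l ?(ltW K0)//.
  by have := HC x; rewrite mul1r.
move=> l a l0; split.
- have [C HC] := df (seq_of a) l; exists C => _ [x _ <-].
  by rewrite /weighted normc_mD; exact: HC.
- have [C HC] := dff (seq_of a) l; exists C => _ [x _ <-].
  by rewrite /weighted normc_mD; exact: HC.
Qed.

Lemma S_omega_decays f s : S_omega w f ->
  (forall s s', perm_eq s s' -> pd s f = pd s' f) -> decays (pd s f).
Proof.
move=> [_ Sf] perm; apply: decays_le => l l0.
rewrite (perm _ _ (perm_seq_of s)); have [[C HC] _] := Sf l [ffun i => count_mem i s] l0.
by exists C => y; rewrite -normc_mD; apply: HC; exists y.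
Qed.

Lemma S_omega_fourier_decays f s : S_omega w f ->
  (forall s s', perm_eq s s' -> pd s (fourier f) = pd s' (fourier f)) ->
  decays (pd s (fourier f)).
Proof.
move=> [_ Sf] perm; apply: decays_le => l l0.
rewrite (perm _ _ (perm_seq_of s)); have [_ [C HC]] := Sf l [ffun i => count_mem i s] l0.
by exists C => y; rewrite -normc_mD; apply: HC; exists y.
Qed.

Lemma seq_of0 : seq_of [ffun=> 0%N] = [::].
Proof.
rewrite /seq_of; elim: (enum _) => [//|i r IH] /=.
by rewrite ffunE.
Qed.

Lemma fourier_ift f : fourier f = ift (-1) f.
Proof.
apply/funext => xi; rewrite /fourier /cintegral /ift /cint.
by congr Complex; apply: eq_Rintegral => t _; rewrite dotvC scaleN1r dotvNr.
Qed.

(** The hypothesis gives bounds only along the words [seq_of a]. By inversion f is a multiple of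
    [ift 1 (fourier f)], and [fourier f] is [ift (-1) f]; derivatives of both are insensitive to the
    order of letters, so every word can be rearranged into some [seq_of a]. *)
Lemma S_omega_rapid f : S_omega w f -> rapid f /\ rapid (fourier f).
Proof.
move=> Sf; case: (Sf) => -[sf _] Sfw.
have df : decays f.
  apply: decays_le => l l0; have [[C HC] _] := Sfw l [ffun=> 0%N] l0.
  exists C => y; have := HC _ (ex_intro2 _ _ y Logic.I erefl).
  by rewrite /weighted normc_mD seq_of0.
have dff : decays (fourier f).
  apply: decays_le => l l0; have [_ [C HC]] := Sfw l [ffun=> 0%N] l0.
  exists C => y; have := HC _ (ex_intro2 _ _ y Logic.I erefl).
  by rewrite /weighted normc_mD seq_of0.
have cf : ccont f := smooth_ccont [::] sf.
have mf := ccont_vcmeas cf.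
have N1 : `|(-1 : R)| = 1 by rewrite normrN1.
have sff : smooth (fourier f).
  by rewrite fourier_ift; exact: smooth_ift N1 mf df.
have mff := ccont_vcmeas (smooth_ccont [::] sff).
have fE : f = fun y => ((2 * pi) ^- n)%:C%C * ift 1 (fourier f) y.
  have [M _ fM] := decays_bounded df.
  apply/funext => y.
  have E := fourier_inversion cf fM (decays_vcint mf df) (decays_vcint mff dff) y.
  have -> : ift 1 (fourier f) y = ((2 * pi) ^+ n)%:C%C * f y.
    rewrite -E /ift /cintegral /cint; congr Complex; apply: eq_Rintegral => t _;
    by rewrite scale1r.
  rewrite mulrA -rmorphM mulVf ?mul1r//.
  by rewrite expf_neq0// mulf_neq0// gt_eqF// pi_gt0.
have sift : smooth (ift 1 (fourier f)) := smooth_ift (normr1 _) mff dff.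
split; split => // s; [apply: S_omega_decays|apply: S_omega_fourier_decays] => //.
- move=> s1 s2 p12; rewrite fE !pdZ//.
  by rewrite (pd_ift_perm (normr1 _) mff dff p12).
- by move=> s1 s2 p12; rewrite fourier_ift (pd_ift_perm N1 mf df p12).
Qed.

End rapid_decay.

(** * Time-frequency shifts *)

Section time_frequency_shifts.
Context {R : realType} (w : R -> R).
Hypothesis hw : nonquasianalytic_subadditive_weight w.
Context {n : nat}.
Local Notation V := 'rV[R]_n.
Local Notation L := (lebesgue_tuple R n).
Local Notation W := (W w).
Local Notation decays := (decays w).
Local Notation rapid := (rapid w).
Local Notation pd s f := (foldr (@partial R n) f s).
Implicit Types (th : V -> R[i]) (a b y : V).

(** This is Pi(a, b) th; [tf_shift z phi] is convertible to [TF phi (lsubmx z) (rsubmx z)]. Separate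
    arguments let the Fourier transform exchange their roles. *)
Definition TF th a b y : R[i] := expi (dotv y b) * th (y - a).

Lemma trE th a : (fun y => th (y - a)) = (fun y => th (- a + 1 *: y)).
Proof. by apply/funext => y; rewrite scale1r addrC. Qed.

Lemma smooth_tr th a : smooth th -> smooth (fun y => th (y - a)).
Proof. by move=> sth; rewrite trE; exact: smooth_affine. Qed.

Lemma pd_tr s th a : smooth th -> pd s (fun y => th (y - a)) = fun y => pd s th (y - a).
Proof.
move=> sth; rewrite trE pd_affine//; apply/funext => y.
by rewrite expr1n mul1r scale1r addrC.
Qed.

Lemma smooth_TF th a b : smooth th -> smooth (TF th a b).
Proof. by move=> sth; exact: smoothM (smooth_expi_dotv b) (smooth_tr a sth). Qed.

Lemma pd_TF s i th a b : smooth th ->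
  pd (rcons s i) (TF th a b) =
  fun y => Complex 0 (b 0 i) * pd s (TF th a b) y + pd s (TF (partial i th) a b) y.
Proof.
move=> sth; have str := smooth_tr a sth; rewrite /TF (pd_mod s i b str).
by apply/funext => y; have /= -> := pd_tr [:: i] a sth.
Qed.

Lemma rapid_partial th i : rapid th -> rapid (partial i th).
Proof.
move=> [sth dth]; split; first exact: smooth_partial.
by move=> s; have := dth (rcons s i); rewrite foldr_rcons.
Qed.

(** Translation costs exp(l w(a)) by subadditivity. Each derivative either falls on [th] or brings
    down a coordinate of b, which [poly_le_W] with N = 1 bounds by a multiple of exp(w(b)); hence
    the coefficient [size s]. *)
Lemma TF_bound s (l : R) th : 0 <= l -> rapid th -> exists2 C : R, 0 < C &
  forall a b y, expR (l * W y) * normc (pd s (TF th a b) y) <=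
    C * expR (l * W a + (size s)%:R * W b).
Proof.
move=> l0; elim/last_ind: s th => [|s i IH] th rth.
  have [C C0 HC] := decays_bound l (rth.2 [::]); exists C => // a b y /=.
  rewrite /TF Normc.normcM normc_expi mul1r mul0r addr0.
  apply: (@le_trans _ _ (expR (l * W y) * (C * expR (- (l * W (y - a)))))).
    by rewrite ler_wpM2l ?expR_ge0//; exact: HC.
  rewrite mulrCA -expRD ler_wpM2l ?(ltW C0)// ler_expR -mulrBr ler_wpM2l//.
  by rewrite lerBlDl; exact: WB.
have [C1 C10 H1] := IH th rth; have [C2 C20 H2] := IH _ (rapid_partial i rth).
have [K K0 HK] := poly_le_W hw 1.
exists (K * C1 + C2); first by rewrite addr_gt0// mulr_gt0.
move=> a b y; rewrite pd_TF; last exact: rth.1.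
have bK : normc (Complex 0 (b 0 i)) <= K * expR (W b).
  rewrite /= expr0n add0r sqrtr_sqr; apply: (le_trans (le_coord_enorm b i)).
  by apply: le_trans (HK _ b); rewrite expr1 lerDr.
rewrite size_rcons -natr1 [(_ + 1) * _]mulrDl mul1r addrA expRD.
apply: (@le_trans _ _ (expR (l * W y) * (normc (Complex 0 (b 0 i)) *
    normc (pd s (TF th a b) y) + normc (pd s (TF (partial i th) a b) y)))).
  by rewrite ler_wpM2l ?expR_ge0// -Normc.normcM; exact: le_normcD.
set E := expR (l * W a + (size s)%:R * W b) in H1 H2 *.
rewrite mulrDr mulrDl; apply: lerD.
  rewrite mulrCA; apply: (@le_trans _ _ ((K * expR (W b)) * (C1 * E))).
    by apply: ler_pM; rewrite ?normc_ge0 ?mulr_ge0 ?normc_ge0 ?expR_ge0//; exact: H1.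
  by rewrite le_eqVlt; apply/orP; left; apply/eqP; ring.
apply: (le_trans (H2 a b y)); rewrite ler_wpM2l ?(ltW C20)//.
by rewrite ler_peMr ?expR_ge0// -expR0 ler_expR W_ge0.
Qed.

Lemma rapid_TF th a b : rapid th -> rapid (TF th a b).
Proof.
move=> rth; split; first exact: smooth_TF rth.1.
move=> s; apply: (decays_le hw) => l l0; have [C C0 HC] := TF_bound s (ltW l0) rth.
by exists (C * expR (l * W a + (size s)%:R * W b)) => y; exact: HC.
Qed.

Lemma cmeas_TF d (Z : measurableType d) (a b : Z -> V) s th y : rapid th ->
  (forall i, measurable_fun setT (fun z => a z 0 i : measurableTypeR R)) ->
  (forall i, measurable_fun setT (fun z => b z 0 i : measurableTypeR R)) ->
  cmeas (fun z => pd s (TF th (a z) (b z)) y).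
Proof.
move=> + ma mb; elim/last_ind: s th => [|s i IH] th rth.
  apply: cmeasM; first by apply: cmeas_expi_dotv => //; exact: measurable_cst_row.
  apply: (@cmeas_comp_row _ _ _ _ (fun z => y - a z)).
    by apply: measurable_addr_row; [exact: measurable_cst_row|
      exact: measurable_oppr_row].
  exact: (smooth_ccont [::] rth.1).
have -> : (fun z => pd (rcons s i) (TF th (a z) (b z)) y) =
    (fun z => Complex 0 (b z 0 i) * pd s (TF th (a z) (b z)) y +
      pd s (TF (partial i th) (a z) (b z)) y).
  by apply/funext => z; rewrite pd_TF//; exact: rth.1.
apply: cmeasD; last exact/IH/rapid_partial.
apply: cmeasM; last exact: IH.
by split; [exact: measurable_cst|exact: mb].
Qed.

Definition cont2 (c : V -> V -> R[i]) := forall a0 b0 (e : R), 0 < e ->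
  exists2 r, 0 < r & forall a b, box a0 r a -> box b0 r b ->
    normc (c a b - c a0 b0) <= e.

(** Continuity of (a, b) |-> Q a b with respect to every weighted supremum norm in y. *)
Definition contw (Q : V -> V -> V -> R[i]) := forall (l : R) a0 b0 (e : R), 0 < e ->
  exists2 r, 0 < r & forall a b, box a0 r a -> box b0 r b ->
    forall y, expR (l * W y) * normc (Q a b y - Q a0 b0 y) <= e.

Lemma box_le (a0 : V) (r r' : R) : r <= r' -> box a0 r `<=` box a0 r'.
Proof. by move=> rr a H i; exact: lt_le_trans (H i) rr. Qed.

Lemma contwD Q Q' : contw Q -> contw Q' -> contw (fun a b y => Q a b y + Q' a b y).
Proof.
move=> HQ HQ' l a0 b0 e e0; have e2 : 0 < e / 2 by rewrite divr_gt0.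
have [r r0 H] := HQ l a0 b0 _ e2; have [r' r'0 H'] := HQ' l a0 b0 _ e2.
exists (Num.min r r'); first by rewrite lt_min r0.
move=> a b aB bB y.
have le1 : Num.min r r' <= r by rewrite ge_min lexx.
have le2 : Num.min r r' <= r' by rewrite ge_min lexx orbT.
have h1 := H a b (box_le le1 aB) (box_le le1 bB) y.
have h2 := H' a b (box_le le2 aB) (box_le le2 bB) y.
apply: (@le_trans _ _ (expR (l * W y) * (normc (Q a b y - Q a0 b0 y) +
    normc (Q' a b y - Q' a0 b0 y)))); last by rewrite mulrDr; lra.
rewrite ler_wpM2l ?expR_ge0//; apply: le_trans (le_normcD _ _).
by rewrite opprD addrACA.
Qed.

Lemma contwM c Q : cont2 c -> contw Q -> (forall a b, decays (Q a b)) ->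
  contw (fun a b y => c a b * Q a b y).
Proof.
move=> hc HQ dQ l a0 b0 e e0.
have [C HC] := dQ a0 b0 l.
pose K := `|C| + 1; have K0 : 0 < K by rewrite ltr_wpDl.
pose M := normc (c a0 b0) + 1; have M0 : 0 < M by rewrite ltr_wpDl ?normc_ge0.
(* The bound 1 keeps the modulus of [c a b] below M, and e / 2 / K makes the term with [Q a0 b0] at
   most e / 2. *)
have [|r r0 H] := hc a0 b0 (Num.min 1 (e / 2 / K)).
  by rewrite lt_min ltr01 !divr_gt0.
have [|r' r'0 H'] := HQ l a0 b0 (e / 2 / M); first by rewrite !divr_gt0.
exists (Num.min r r'); first by rewrite lt_min r0.
move=> a b aB bB y.
have le1 : Num.min r r' <= r by rewrite ge_min lexx.
have le2 : Num.min r r' <= r' by rewrite ge_min lexx orbT.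
have := H a b (box_le le1 aB) (box_le le1 bB); rewrite le_min => /andP[h1 h1'].
have h2 := H' a b (box_le le2 aB) (box_le le2 bB) y.
have cM : normc (c a b) <= M.
  rewrite -(subrK (c a0 b0) (c a b)); apply: (le_trans (le_normcD _ _)).
  by rewrite /M addrC lerD2l.
have -> : c a b * Q a b y - c a0 b0 * Q a0 b0 y =
  c a b * (Q a b y - Q a0 b0 y) + (c a b - c a0 b0) * Q a0 b0 y by ring.
apply: (@le_trans _ _ (M * (expR (l * W y) * normc (Q a b y - Q a0 b0 y)) +
   normc (c a b - c a0 b0) * (expR (l * W y) * normc (Q a0 b0 y)))).
  apply: (@le_trans _ _ (expR (l * W y) * (normc (c a b * (Q a b y - Q a0 b0 y)) +
      normc ((c a b - c a0 b0) * Q a0 b0 y)))).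
    by rewrite ler_wpM2l ?expR_ge0//; exact: le_normcD.
  rewrite !Normc.normcM mulrDr !(mulrCA (expR _)) lerD2r ler_wpM2r//.
  by rewrite mulr_ge0 ?expR_ge0 ?normc_ge0.
have -> : e = M * (e / 2 / M) + (e / 2 / K) * K.
  by field; rewrite ?gt_eqF.
apply: lerD; first by rewrite ler_wpM2l// ltW.
apply: ler_pM => //; rewrite ?normc_ge0 ?mulr_ge0 ?expR_ge0 ?normc_ge0//.
by apply: (le_trans (HC y)); apply: (le_trans (ler_norm _)); rewrite lerDl.
Qed.

Lemma expi_lipschitz (s t : R) : normc (expi s - expi t) <= 2 * `|s - t|.
Proof.
apply: (le_trans (le_normc_ReIm _)); rewrite cReD cImD cReN cImN /=.
have H1 : `|cos s - cos t| <= 1 * `|s - t|.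
  apply: (@derive_lipschitz _ (@cos R) (fun x => - sin x)) => x.
  by rewrite normrN; exact: sin_max.
have H2 : `|sin s - sin t| <= 1 * `|s - t|.
  by apply: (@derive_lipschitz _ (@sin R) (@cos R)) => x; exact: cos_max.
lra.
Qed.

Lemma sum_coord_le (a a0 : V) r (B : 'I_n -> R) : 0 < r -> (forall i, 0 <= B i) ->
  box a0 r a -> \sum_(i < n) B i * `|a 0 i - a0 0 i| <= r * \sum_(i < n) B i.
Proof.
move=> r0 B0 aB; rewrite mulr_sumr; apply: ler_sum => i _.
by rewrite mulrC ler_wpM2r// ltW.
Qed.

Lemma enorm_le_sum (a : V) : enorm a <= \sum_(i < n) `|a 0 i|.
Proof.
rewrite -(@ler_pXn2r _ 2)// ?nnegrE ?enorm_ge0 ?sumr_ge0// sqr_enorm /dotv.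
rewrite expr2 mulr_suml; apply: ler_sum => i _.
rewrite -expr2 -real_normK ?num_real// expr2 ler_wpM2l//.
by rewrite (bigD1 i)//= lerDl sumr_ge0.
Qed.

Lemma enorm_box (a a0 : V) r : 0 < r -> box a0 r a -> enorm (a - a0) <= r * n%:R.
Proof.
move=> r0 aB; apply: (le_trans (enorm_le_sum _)).
have := @sum_coord_le a a0 r (fun=> 1) r0 (fun=> ler01) aB.
rewrite sumr_const card_ord; apply: le_trans.
by apply: ler_sum => i _; rewrite !mxE mul1r.
Qed.

Lemma W_box (a a0 : V) r : 0 < r -> r <= 1 -> box a0 r a -> W a <= w n%:R + W a0.
Proof.
move=> r0 r1 aB; apply: (le_trans (WB hw a a0)); rewrite lerD2r.
apply: (weight_mono hw (enorm_ge0 _)); apply: (le_trans (enorm_box r0 aB)).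
by rewrite ler_piMl.
Qed.

(* The weighted difference is controlled by interpolating between a Lipschitz
   bound without weight and a uniform bound with twice the weight. *)
Lemma contw_TF0 th : rapid th -> contw (TF th).
Proof.
move=> rth.
suff pos l : 0 <= l -> forall a0 b0 (e : R), 0 < e ->
  exists2 r, 0 < r & forall a b, box a0 r a -> box b0 r b ->
    forall y, expR (l * W y) * normc (TF th a b y - TF th a0 b0 y) <= e.
  move=> l a0 b0 e e0; have [r r0 H] := pos `|l| (normr_ge0 _) a0 b0 e e0.
  exists r => // a b aB bB y; apply: le_trans (H a b aB bB y).
  rewrite ler_wpM2r ?normc_ge0// ler_expR ler_wpM2r ?W_ge0//; exact: ler_norm.
move=> l0 a0 b0 e e0.
have [C C0 HC] := TF_bound [::] (addr_ge0 l0 l0) rth.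
have [K K0 HK] := TF_bound [::] ler01 rth.
have [P P0 HP] := poly_le_W hw 1.
have /choice[B HB] : forall i, exists B : R, 0 < B /\ forall y, normc (partial i th y) <= B.
  move=> i; have [B B0 H] := decays_bounded (rth.2 [:: i]).
  by exists B; split => // y; exact: H.
pose A0 := w n%:R + W a0; pose U := C * expR ((l + l) * A0) + C * expR ((l + l) * W a0).
pose Lp := 2 * (P * (K * expR A0)) * n%:R + \sum_(i < n) 2 * B i.
have Lp0 : 0 <= Lp.
  rewrite addr_ge0//; last by apply: sumr_ge0 => i _; rewrite mulr_ge0// ltW// (HB i).1.
  by rewrite !mulr_ge0 ?expR_ge0// ltW.
have U0 : 0 < U by rewrite addr_gt0// mulr_gt0 ?expR_gt0.
(* The square of the weighted difference is at most U r Lp, where U bounds the difference under the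
   weight 2 l and r Lp bounds it without weight; this r makes the product at most e^2. The minimum
   with 1 lets [W_box] bound w(a). *)
pose r := Num.min 1 (e ^+ 2 / (U * (Lp + 1))).
have r0 : 0 < r.
  by rewrite lt_min ltr01 divr_gt0 ?exprn_gt0// mulr_gt0// ltr_wpDl.
have r1 : r <= 1 by rewrite ge_min lexx.
exists r => // a b aB bB y.
set D := normc _; have D0 : 0 <= D by exact: normc_ge0.
have Wa : W a <= A0 := W_box r0 r1 aB.
have DU : expR ((l + l) * W y) * D <= U.
  apply: (@le_trans _ _ (expR ((l + l) * W y) * normc (TF th a b y) +
    expR ((l + l) * W y) * normc (TF th a0 b0 y))).
    by rewrite -mulrDr ler_wpM2l ?expR_ge0//; exact: normcB_le.
  apply: lerD.
    apply: (le_trans (HC a b y)); rewrite mul0r addr0 ler_wpM2l ?(ltW C0)// ler_expR.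
    by rewrite ler_wpM2l// addr_ge0.
  by apply: (le_trans (HC a0 b0 y)); rewrite mul0r addr0.
have DL : D <= r * Lp.
  have -> : D = normc ((expi (dotv y b) - expi (dotv y b0)) * th (y - a) +
      expi (dotv y b0) * (th (y - a) - th (y - a0))).
    by congr normc; rewrite /TF; ring.
  apply: (le_trans (le_normcD _ _)); rewrite !Normc.normcM normc_expi mul1r.
  rewrite [r * Lp]mulrDr; apply: lerD.
    apply: (@le_trans _ _ ((2 * (enorm y * (r * n%:R))) * normc (th (y - a)))).
      rewrite ler_wpM2r ?normc_ge0//; apply: (le_trans (expi_lipschitz _ _)).
      rewrite ler_wpM2l// -dotvBr; apply: (le_trans (dotv_abs_le _ _)).
      by rewrite ler_wpM2l ?enorm_ge0// enorm_box.
    have yth : enorm y * normc (th (y - a)) <= P * (K * expR A0).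
      apply: (@le_trans _ _ ((P * expR (W y)) * normc (th (y - a)))).
        rewrite ler_wpM2r ?normc_ge0//; apply: le_trans (HP _ y).
        by rewrite expr1 lerDr.
      rewrite -mulrA ler_wpM2l ?(ltW P0)//.
      have := HK a b y; rewrite /= /TF Normc.normcM normc_expi !mul1r mul0r addr0.
      move=> /le_trans; apply; rewrite ler_wpM2l ?(ltW K0)// ler_expR.
      exact: Wa.
    have -> : 2 * (enorm y * (r * n%:R)) * normc (th (y - a)) =
      (2 * r * n%:R) * (enorm y * normc (th (y - a))) by ring.
    have -> : r * (2 * (P * (K * expR A0)) * n%:R) =
      (2 * r * n%:R) * (P * (K * expR A0)) by ring.
    by rewrite ler_wpM2l// !mulr_ge0// ltW.
  apply: (le_trans (smooth_lipschitz rth.1 (fun i => (HB i).2) _ _)).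
  apply: le_trans (@sum_coord_le a a0 r (fun i => 2 * B i) r0 _ aB).
    apply: ler_sum => i _; rewrite ler_wpM2l ?mulr_ge0 ?(ltW (HB i).1)//.
    rewrite !mxE (_ : y 0 i - a 0 i - (y 0 i - a0 0 i) = - (a 0 i - a0 0 i)).
      by rewrite normrN.
    by ring.
  by move=> i; rewrite mulr_ge0// ltW// (HB i).1.
rewrite -(@ler_pXn2r _ 2)// ?nnegrE ?mulr_ge0 ?expR_ge0 ?(ltW e0)//.
have -> : (expR (l * W y) * D) ^+ 2 = (expR ((l + l) * W y) * D) * D.
  by rewrite mulrDl expRD; ring.
apply: (@le_trans _ _ (U * (r * Lp))).
  by apply: ler_pM; rewrite ?mulr_ge0 ?expR_ge0.
apply: (@le_trans _ _ (U * (e ^+ 2 / (U * (Lp + 1)) * (Lp + 1)))).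
  rewrite ler_wpM2l ?(ltW U0)//; apply: ler_pM; rewrite ?(ltW r0)//.
    by rewrite ge_min lexx orbT.
  by rewrite lerDl.
rewrite le_eqVlt; apply/orP; left; apply/eqP; field; rewrite ?gt_eqF//; last by rewrite ltr_wpDl.
Qed.

Lemma contw_TF s th : rapid th -> contw (fun a b => pd s (TF th a b)).
Proof.
elim/last_ind: s th => [|s i IH] th rth; first exact: contw_TF0.
have -> : (fun a b => pd (rcons s i) (TF th a b)) =
    (fun a b y => Complex 0 (b 0 i) * pd s (TF th a b) y +
      pd s (TF (partial i th) a b) y).
  by apply/funext => a; apply/funext => b; rewrite pd_TF//; exact: rth.1.
apply: contwD; last exact/IH/rapid_partial.
apply: contwM; last by move=> a b; exact: (rapid_TF a b rth).2.
  move=> a0 b0 e e0; exists e => // a b _ bB.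
  rewrite (_ : _ - _ = Complex 0 (b 0 i - b0 0 i)); last first.
    by apply: complex_eq => /=; rewrite ?subrr.
  by rewrite /= expr0n add0r sqrtr_sqr ltW.
exact: IH.
Qed.

(** Translating the variable of integration by a turns translation into modulation and modulation
    into translation; the phase records that the two do not commute. *)
Lemma fourier_TF th a b : vcint th ->
  fourier (TF th a b) = fun eta => expi (dotv a b) * TF (fourier th) b (- a) eta.
Proof.
move=> Ith; apply/funext => eta.
pose g y := expi (- dotv y (eta - b)) * th y.
have Ig : vcint g by exact: vcint_expi.
have Icg : vcint (fun y => expi (- dotv a (eta - b)) * g y) by exact: cintbleZ.
have [_] := vcint_affine (- a) (oner_neq0 R) Icg.
rewrite normr1 expr1n invr1 mul1r.
rewrite [X in _ = X](_ : _ =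
  cint L (fun t => expi (- dotv a (eta - b)) * g (rowt t)))// cintZ// => E.
rewrite /TF mulrA -expiD.
have -> : dotv a b + dotv eta (- a) = - dotv a (eta - b).
  by rewrite dotvBr opprB dotvNr (dotvC eta).
rewrite [RHS](_ : _ = expi (- dotv a (eta - b)) * cint L (g \o @rowt R n))//.
rewrite -E; congr cint; apply/funext => t; rewrite /g scale1r /comp.
rewrite mulrA -expiD mulrA -expiD [- a + _]addrC; congr (expi _ * _).
by rewrite dotvBl !dotvBr; ring.
Qed.

End time_frequency_shifts.

(** * Superpositions of time-frequency shifts *)

Section synthesis.
Context {R : realType} (w : R -> R).
Hypothesis hw : nonquasianalytic_subadditive_weight w.
Context {n : nat}.
Local Notation V := 'rV[R]_n.
Local Notation L := (lebesgue_tuple R n).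
Local Notation W := (W w).
Local Notation rapid := (rapid w).
Local Notation pd s f := (foldr (@partial R n) f s).
Context d {Z : measurableType d}.
Variable mu : {sigma_finite_measure set Z -> \bar R}.

(** The adjoint of the short-time Fourier transform, over an arbitrary measure space: its Fourier
    transform is again of this form, with b and -a in place of a and b and a phase put into G. *)
Definition synth (G : Z -> R[i]) (a b : Z -> V) (th : V -> R[i]) (y : V) : R[i] :=
  cint mu (fun z => G z * TF th (a z) (b z) y).

(** All l are required because the derivatives of a shift cost powers of exp(w) that grow with their
    order; the majorant P stays the same for all of them. *)
Definition beats_weight (P : Z -> R) (G : Z -> R[i]) (a b : Z -> V) :=
  forall l : R, exists2 C : R, 0 < C &
    forall z, normc (G z) * expR (l * (W (a z) + W (b z))) <= C * P z.

Variables (P : Z -> R) (G : Z -> R[i]) (a b : Z -> V).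
Hypotheses (IP : rint mu P) (P0 : forall z, 0 <= P z) (mG : cmeas G).
Hypothesis ma : forall i, measurable_fun setT (fun z => a z 0 i : measurableTypeR R).
Hypothesis mb : forall i, measurable_fun setT (fun z => b z 0 i : measurableTypeR R).
Hypothesis bG : beats_weight P G a b.

(** [TF_bound] costs l w(a) + |s| w(b) in the exponent, and G pays for it at the exponent l + |s| on
    both weights. *)
Lemma synth_dominated s (l : R) th : 0 <= l -> rapid th ->
  exists2 C : R, 0 < C & forall z y,
    expR (l * W y) * normc (G z * pd s (TF th (a z) (b z)) y) <= C * P z.
Proof.
move=> l0 rth; have [C C0 HC] := TF_bound hw s l0 rth.
have [K K0 HK] := bG (l + (size s)%:R).
exists (C * K) => [|z y]; first exact: mulr_gt0.
rewrite Normc.normcM mulrCA.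
apply: (@le_trans _ _ (normc (G z) * (C * expR (l * W (a z) + (size s)%:R * W (b z))))).
  by rewrite ler_wpM2l ?normc_ge0//; exact: HC.
apply: (@le_trans _ _ (C * (normc (G z) * expR ((l + (size s)%:R) *
    (W (a z) + W (b z)))))).
  rewrite mulrCA ler_wpM2l ?(ltW C0)// ler_wpM2l ?normc_ge0// ler_expR.
  have h1 : 0 <= l * W (b z) by rewrite mulr_ge0 ?W_ge0.
  have h2 : 0 <= (size s)%:R * W (a z) by rewrite mulr_ge0 ?W_ge0.
  by rewrite mulrDl !mulrDr; lra.
by rewrite -mulrA ler_wpM2l ?(ltW C0).
Qed.

Section rapid_window.
Variable th : V -> R[i].
Hypothesis rth : rapid th.

Let F z y := G z * TF th (a z) (b z) y.

Let sT z : smooth (TF th (a z) (b z)).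
Proof. exact: smooth_TF rth.1. Qed.

Let sF z : smooth (F z).
Proof. exact: smoothZ. Qed.

Let pdF s z : pd s (F z) = fun y => G z * pd s (TF th (a z) (b z)) y.
Proof. by rewrite /F pdZ. Qed.

Lemma cmeas_synth s y : cmeas (fun z => G z * pd s (TF th (a z) (b z)) y).
Proof. by apply: cmeasM => //; exact: (cmeas_TF s y rth ma mb). Qed.

Let mF s y : cmeas (fun z => pd s (F z) y).
Proof.
by rewrite (_ : (fun z => _) = (fun z => G z * pd s (TF th (a z) (b z)) y));
  [exact: cmeas_synth|apply/funext => z; rewrite pdF].
Qed.

Let bF s : exists2 H : Z -> R, rint mu H & forall z y, normc (pd s (F z) y) <= H z.
Proof.
have [C C0 HC] := synth_dominated s (lexx 0) rth.
exists (fun z => C * P z); first exact: rintZ.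
by move=> z y; have := HC z y; rewrite mul0r expR0 mul1r pdF.
Qed.

Lemma pd_synth s : pd s (synth G a b th) =
  fun y => cint mu (fun z => G z * pd s (TF th (a z) (b z)) y).
Proof.
rewrite /synth (pd_cint sF mF bF s); apply/funext => y.
by congr cint; apply/funext => z; rewrite pdF.
Qed.

Lemma cintble_synth s y : cintble mu (fun z => G z * pd s (TF th (a z) (b z)) y).
Proof.
have := cintble_pd mF bF s y; congr cintble.
by apply/funext => z; rewrite pdF.
Qed.

Lemma rapid_synth : rapid (synth G a b th).
Proof.
split; first exact: smooth_cint sF mF bF.
move=> s; apply: (decays_le hw) => l l0.
have [C C0 HC] := synth_dominated s (ltW l0) rth.
exists (\int[mu]_z (C * P z)) => y; rewrite pd_synth.
rewrite -[expR _](ger0_norm (expR_ge0 _)) -normc_real -Normc.normcM.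
rewrite -cintZ; last exact: cintble_synth.
apply: normc_cint_le; last exact: rintZ.
  by apply: cmeasM; [exact: cmeas_cst|exact: cmeas_synth].
move=> z; rewrite Normc.normcM normc_real (ger0_norm (expR_ge0 _)); exact: HC.
Qed.

(** Fubini, then [fourier_TF] under the integral. The majorant in the space variable comes from
    [synth_dominated] at l = 1, which leaves the integrable factor exp(-w). *)
Lemma fourier_synth :
  fourier (synth G a b th) =
  synth (fun z => G z * expi (dotv (a z) (b z))) b (fun z => - a z) (fourier th).
Proof.
apply/funext => eta.
have cth : ccont th := smooth_ccont [::] rth.1.
have Ith : vcint th by apply: (decays_vcint hw (ccont_vcmeas cth)); exact: (rth.2 [::]).
have [C C0 HC] := synth_dominated [::] ler01 rth.
have [K K0 HK] := expNW_le_cauchyn hw n.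
pose H (p : Z * n.-tuple (measurableTypeR R)) : R[i] :=
  expi (- dotv (rowt p.2) eta) * (G p.1 * TF th (a p.1) (b p.1) (rowt p.2)).
have ma1 i : measurable_fun setT
    (fun p : Z * n.-tuple (measurableTypeR R) => a p.1 0 i : measurableTypeR R).
  exact: (measurableT_comp (ma i) measurable_fst).
have mb1 i : measurable_fun setT
    (fun p : Z * n.-tuple (measurableTypeR R) => b p.1 0 i : measurableTypeR R).
  exact: (measurableT_comp (mb i) measurable_fst).
have mH : cmeas H.
  apply: cmeasM.
    apply: cmeas_expi; apply: measurableT_comp => //; apply: measurable_dotv.
      exact: measurable_rowt2.
    exact: measurable_cst_row.
  apply: cmeasM; first exact: (cmeas_comp measurable_fst mG).
  apply: cmeasM; first by apply: cmeas_expi_dotv => //; exact: measurable_rowt2.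
  apply: (@cmeas_comp_row _ _ _ _ (fun p => rowt p.2 - a p.1)) cth.
  by apply: measurable_addr_row; [exact: measurable_rowt2|exact: measurable_oppr_row].
have bH p : normc (H p) <= (C * P p.1) * (K * cauchyn (rowt p.2)).
  rewrite /H Normc.normcM normc_expi mul1r.
  have := HC p.1 (rowt p.2); rewrite mulrC -ler_pdivlMr ?expR_gt0// -expRN mul1r.
  move=> /le_trans; apply; rewrite ler_wpM2l//.
  by rewrite mulr_ge0 ?P0 ?ltW.
have I1 : rint mu (fun z => C * P z) by exact: rintZ.
have I2 : rint L (fun t => K * cauchyn (rowt t)).
  by apply: rintZ; exact: (@vint_cauchyn R n).1.
transitivity (cint L (fun t => cint mu (fun z => H (z, t)))).
  rewrite /fourier /cintegral -[LHS]/(cint L (fun t =>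
    expi (- dotv (rowt t) eta) * synth G a b th (rowt t))).
  congr cint; apply/funext => t; rewrite /synth -cintZ//.
  exact: (cintble_synth [::]).
rewrite -(cint_swap I1 I2 mH bH) /synth; congr cint; apply/funext => z.
have E : fourier (TF th (a z) (b z)) eta = _ :=
  congr1 (fun f => f eta) (fourier_TF (a z) (b z) Ith).
rewrite -mulrA -[X in G z * X]E /fourier /cintegral.
rewrite -[X in G z * X]/(cint L (fun t =>
    expi (- dotv (rowt t) eta) * TF th (a z) (b z) (rowt t))) -cintZ; last first.
  apply: vcint_expi; apply: (decays_vcint hw); last exact: (rapid_TF hw _ _ rth).2 [::].
  exact: ccont_vcmeas (smooth_ccont [::] (sT z)).
by congr cint; apply/funext => t; rewrite /H /= mulrCA.
Qed.

End rapid_window.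

End synthesis.

Section synthesis_S_omega.
Context {R : realType} (w : R -> R).
Hypothesis hw : nonquasianalytic_subadditive_weight w.
Context {n : nat} d {Z : measurableType d}.
Variable mu : {sigma_finite_measure set Z -> \bar R}.
Local Notation V := 'rV[R]_n.
Variables (P : Z -> R) (G : Z -> R[i]) (a b : Z -> V).
Hypotheses (IP : rint mu P) (P0 : forall z, 0 <= P z) (mG : cmeas G).
Hypothesis ma : forall i, measurable_fun setT (fun z => a z 0 i : measurableTypeR R).
Hypothesis mb : forall i, measurable_fun setT (fun z => b z 0 i : measurableTypeR R).
Hypothesis bG : beats_weight w P G a b.

Lemma beats_weight_swap :
  beats_weight w P (fun z => G z * expi (dotv (a z) (b z))) b (fun z => - a z).
Proof.
move=> l; have [C C0 HC] := bG l; exists C => // z.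
by rewrite Normc.normcM normc_expi mulr1 WN [_ + W w (a z)]addrC.
Qed.

Let mGs : cmeas (fun z => G z * expi (dotv (a z) (b z))).
Proof. by apply: cmeasM => //; exact: cmeas_expi_dotv. Qed.

Lemma S_omega_synth th : S_omega w th -> S_omega w (synth mu G a b th).
Proof.
move=> /(S_omega_rapid hw)[rth rfth]; apply: (rapid_S_omega hw).
  exact: (rapid_synth hw IP mG ma mb bG rth).
rewrite (fourier_synth hw IP P0 mG ma mb bG rth).
apply: (rapid_synth hw IP mGs mb _ beats_weight_swap rfth).
exact: measurable_oppr_row.
Qed.

End synthesis_S_omega.

(** * Finitely additive functions of small density *)

Section finitely_additive.
Context {R : realType} {m : nat} d {Z : measurableType d}.
Variable mu : {measure set Z -> \bar R}.
Local Notation V := 'rV[R]_m.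
Variables (c : Z -> V) (H : Z -> R) (Phi : set Z -> R[i]).
Hypothesis mc : forall i, measurable_fun setT (fun z => c z 0 i : measurableTypeR R).
Hypotheses (IH : rint mu H) (H0 : forall z, 0 <= H z).

Let IHA A : measurable A -> mu.-integrable A (EFin \o H).
Proof. by move=> mA; apply: integrableS IH. Qed.

Let intH0 A : 0 <= \int[mu]_(z in A) H z.
Proof. by apply: Rintegral_ge0 => z _; exact: H0. Qed.

Let intHU A B : measurable A -> measurable B -> A `&` B = set0 ->
  \int[mu]_(z in A `|` B) H z = \int[mu]_(z in A) H z + \int[mu]_(z in B) H z.
Proof.
move=> mA mB AB; apply: Rintegral_setU => //.
  by apply: IHA; exact: measurableU.
by rewrite disj_set2E AB.
Qed.

Hypothesis PhiU : forall A B, measurable A -> measurable B -> A `&` B = set0 ->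
  Phi (A `|` B) = Phi A + Phi B.
Hypothesis Phi_dom : forall A, measurable A -> normc (Phi A) <= \int[mu]_(z in A) H z.
Hypothesis Phi_loc : forall (q : V) (e : R), 0 < e -> exists2 r, 0 < r &
  forall A, measurable A -> A `<=` c @^-1` box q r ->
    normc (Phi A) <= e * \int[mu]_(z in A) H z.

(** The bound is demanded on all measurable subsets of U, which makes the property stable under
    unions. *)
Let good e (U : set Z) := measurable U /\ forall A, measurable A -> A `<=` U ->
  normc (Phi A) <= e * \int[mu]_(z in A) H z.

Let goodU e (U U' : set Z) : good e U -> good e U' -> good e (U `|` U').
Proof.
move=> [mU gU] [mU' gU']; split; first exact: measurableU.
move=> A mA AU; have mAU : measurable (A `&` U) by exact: measurableI.
have mAD : measurable (A `\` U) by exact: measurableD.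
have disj : (A `&` U) `&` (A `\` U) = set0.
  by apply/seteqP; split => // z [[_ ?] [_ ?]].
rewrite -(setUIDK A U) PhiU// intHU// mulrDr.
apply: (le_trans (le_normcD _ _)); apply: lerD; first by apply: gU => // z [].
by apply: gU' => // z [Az nUz]; case: (AU z Az).
Qed.

Let ballN (N : R) : set V := [set x | `|x| <= N].

Let closed_ballN N : closed (ballN N).
Proof.
exact: (continuous_closedP _).1 (@norm_continuous _ _) _ (@closed_le R N).
Qed.

Let measurable_ballN N : measurable (c @^-1` ballN N).
Proof.
rewrite -[X in measurable X]setCK; apply: measurableC; rewrite preimage_setC.
by apply: measurable_open_row => //; exact/closed_openC/closed_ballN.
Qed.

(** Compactness of the ball: finitely many of the boxes supplied by [Phi_loc] cover it, and [goodU]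
    joins their preimages. *)
Let good_ball e N : 0 < e -> good e (c @^-1` ballN N).
Proof.
move=> e0.
have cK : compact (ballN N).
  apply: bounded_closed_compact; last exact: closed_ballN.
  exists `|N|; split; first exact: num_real.
  move=> M NM x xN.
  by apply: (le_trans xN); apply: (le_trans (ler_norm _)); exact: ltW.
have /choice[r rP] : forall q : V, exists r, 0 < r /\ forall A, measurable A ->
    A `<=` c @^-1` box q r -> normc (Phi A) <= e * \int[mu]_(z in A) H z.
  by move=> q; have [r r0 Hr] := Phi_loc q e0; exists r.
move: cK; rewrite compact_cover => /(_ V setT (fun q => box q (r q))) [].
- move=> q _; rewrite (box_ball q (rP q).1); exact: ball_open.
- move=> x _; exists x => // i; rewrite subrr normr0; exact: (rP x).1.
move=> D _ KD.
have gb q : good e (c @^-1` box q (r q)).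
  by split; [exact: measurable_box|exact: (rP q).2].
have g0 : good e set0.
  split => // A mA; rewrite subset0 => ->; apply: (le_trans (Phi_dom _)) => //.
  by rewrite Rintegral_set0 mulr0.
have gD (s : seq V) : exists U, good e U /\
    forall q, q \in s -> c @^-1` box q (r q) `<=` U.
  elim: s => [|q s [U [gU sU]]]; first by exists set0.
  exists (c @^-1` box q (r q) `|` U); split; first exact: goodU.
  move=> p; rewrite inE => /predU1P[->|ps]; first by move=> z; left.
  by move=> z zp; right; exact: sU zp.
have [U [[mU gU] sU]] := gD (finmap.enum_fset D).
split; first exact: measurable_ballN.
move=> A mA AK; apply: gU => // z /AK /KD [q /= qD zq].
by apply: sU zq.
Qed.

(** The density is made tiny on the preimage of a large ball, and the rest contributes at most a
    tail of the integral of H. Only finite unions occur. *)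
Lemma finitely_additive_eq0 : Phi setT = 0.
Proof.
suff small e : 0 < e -> normc (Phi setT) <= e.
  apply: Normc.eq0_normc; apply/eqP; rewrite eq_le normc_ge0 andbT.
  by apply/ler_addgt0Pl => e e0; rewrite addr0; exact: small.
move=> e0; have e2 : 0 < e / 2 by rewrite divr_gt0.
pose I := \int[mu]_z H z; have I0 : 0 <= I by exact: intH0.
pose B k := c @^-1` ballN k%:R.
have mB k : measurable (B k) by exact: measurable_ballN.
have mH := rint_measurable IH.
(* The preimages of the balls of radius k exhaust Z, so the tails of H vanish by dominated
   convergence. *)
have cv : \int[mu]_z (H z * \1_(~` B k) z) @[k --> \oo] --> \int[mu]_z (0 : R).
  apply: (Rdominated _ _ _ IH).
  - move=> k; apply: measurable_funM => //; apply: measurable_indic.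
    exact: measurableC.
  - exact: measurable_cst.
  - move=> z; have [k0 k0P] : exists k0 : nat, `|c z| <= k0%:R.
      exists (Num.truncn `|c z|).+1; exact/ltW/truncnS_gt.
    apply: cvg_near_cst; exists k0 => // k /= k0k.
    rewrite indicE memNset ?mulr0// => nB; apply: nB; rewrite /B /ballN /=.
    by apply: (le_trans k0P); rewrite ler_nat.
  - move=> k z; rewrite normrM ger0_norm// ler_piMr// indicE.
    by case: (_ \in _); rewrite ?normr1 ?normr0.
rewrite Rintegral_cst// mul0r in cv.
move/cvgrPdist_le : cv => /(_ _ e2)[k _ /(_ k (leqnn k)) /= Hk].
rewrite sub0r normrN in Hk.
have [_ gB] := @good_ball (e / 2 / (I + 1)) k%:R (divr_gt0 e2 (ltr_wpDl I0 ltr01)).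
rewrite -(setvU (B k)) setUC.
rewrite PhiU//; [|exact: measurableC|by rewrite setICr].
apply: (le_trans (le_normcD _ _)).
rewrite (splitr e); apply: lerD.
  apply: (le_trans (gB (B k) (mB k) _)) => //.
  apply: (@le_trans _ _ (e / 2 / (I + 1) * (I + 1))).
    rewrite ler_wpM2l ?divr_ge0 ?addr_ge0 ?(ltW e0)//.
    have /= := intHU (mB k) (measurableC (mB k)) (setICr _).
    rewrite setUv -/I => E; have := intH0 (~` B k).
    by rewrite /= in E *; lra.
  by rewrite divfK// gt_eqF// ltr_wpDl.
apply: (le_trans (Phi_dom (measurableC (mB k)))).
apply: le_trans (le_trans (ler_norm _) Hk).
rewrite Rintegral_mkcond le_eqVlt; apply/orP; left; apply/eqP.
apply: eq_Rintegral => z _; rewrite patchE indicE.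
by case: (_ \in _); rewrite ?mulr1 ?mulr0.
Qed.

End finitely_additive.

(** * Bounded functionals *)

Section dual_space.
Context {R : realType} (w : R -> R).
Hypothesis hw : nonquasianalytic_subadditive_weight w.
Context {n : nat}.
Local Notation V := 'rV[R]_n.
Local Notation L := (lebesgue_tuple R n).
Local Notation W := (W w).
Local Notation rapid := (rapid w).
Local Notation pd s f := (foldr (@partial R n) f s).

Implicit Types f g h : V -> R[i].

Lemma rapid_lin c f g : rapid f -> rapid g -> rapid (fun x => c * f x + g x).
Proof.
move=> [sf df] [sg dg]; have scf := smoothZ c sf.
split; first exact: smoothD.
move=> s l; have [C HC] := df s l; have [C' HC'] := dg s l.
exists (normc c * C + C') => y; rewrite pdD// pdZ//.
apply: (@le_trans _ _ (normc c * (expR (l * W y) * normc (pd s f y)) +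
    expR (l * W y) * normc (pd s g y))).
  rewrite mulrCA -mulrDr ler_wpM2l ?expR_ge0// -Normc.normcM; exact: le_normcD.
by apply: lerD => //; rewrite ler_wpM2l ?normc_ge0.
Qed.

Lemma rapid_vcint f : rapid f -> vcint f.
Proof.
move=> rf; apply: (decays_vcint hw); last exact: rf.2 [::].
exact: ccont_vcmeas (smooth_ccont [::] rf.1).
Qed.

Lemma fourier_lin c f g : vcint f -> vcint g ->
  fourier (fun x => c * f x + g x) = fun xi => c * fourier f xi + fourier g xi.
Proof.
move=> If Ig; apply/funext => xi.
have If' := vcint_expi xi If; have Ig' := vcint_expi xi Ig.
rewrite /fourier /cintegral.
rewrite -[LHS]/(cint L (fun t => expi (- dotv (rowt t) xi) *
  (c * f (rowt t) + g (rowt t)))).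
rewrite -[X in c * X]/(cint L ((fun x => expi (- dotv x xi) * f x) \o @rowt R n)).
rewrite -[X in _ + X]/(cint L ((fun x => expi (- dotv x xi) * g x) \o @rowt R n)).
rewrite -cintZ// -cintD//; last exact: cintbleZ.
by congr cint; apply/funext => t /=; ring.
Qed.

Lemma fourierZ c f : vcint f ->
  fourier (fun x => c * f x) = fun xi => c * fourier f xi.
Proof.
move=> If; apply/funext => xi; rewrite /fourier /cintegral.
rewrite -[LHS]/(cint L (fun t => expi (- dotv (rowt t) xi) * (c * f (rowt t)))).
rewrite -[X in c * X]/(cint L ((fun x => expi (- dotv x xi) * f x) \o @rowt R n)).
rewrite -cintZ; last exact: vcint_expi.
by congr cint; apply/funext => t /=; rewrite mulrCA.
Qed.

Lemma S_omega_lin c f g : S_omega w f -> S_omega w g ->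
  S_omega w (fun x => c * f x + g x).
Proof.
move=> /(S_omega_rapid hw)[rf rff] /(S_omega_rapid hw)[rg rfg].
apply: (rapid_S_omega hw); first exact: rapid_lin.
by rewrite fourier_lin; [exact: rapid_lin|exact: rapid_vcint|exact: rapid_vcint].
Qed.

Lemma S_omega0 : S_omega w (fun _ : V => 0).
Proof.
have z s : pd s (fun _ : V => 0) = fun=> (0 : R[i]).
  elim: s => [//|i s IH]; rewrite [LHS]/= IH.
  by apply: partial_funext => x; exact: cder_cst.
have r0 : rapid (fun _ : V => 0).
  split; first exact: smooth_cst.
  by move=> s l; exists 0 => y; rewrite z Normc.normc0 mulr0.
apply: (rapid_S_omega hw) => //.
rewrite (_ : fourier _ = fun=> 0)//; apply/funext => xi.
rewrite /fourier /cintegral -[LHS]/(cint L (fun t => expi (- dotv (rowt t) xi) * 0)).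
by rewrite -[RHS](cint0 L); congr cint; apply/funext => t; rewrite mulr0.
Qed.

Lemma S_omegaZ c f : S_omega w f -> S_omega w (fun x => c * f x).
Proof.
move=> Sf; have := S_omega_lin c Sf S_omega0; congr S_omega.
by apply/funext => x; rewrite addr0.
Qed.

Definition linear_on (u : (V -> R[i]) -> R[i]) := forall (c : R[i]) f g,
  S_omega w f -> S_omega w g -> u (fun x => c * f x + g x) = c * u f + u g.

(** [E] is a family indexed by words, not one function to be differentiated, so that derivatives
    already moved under an integral can be inserted directly. *)
Definition Nle (l : R) (m : nat) (E : seq 'I_n -> V -> R[i]) (M : R) :=
  forall s y, (size s <= m)%N -> expR (l * W y) * normc (E s y) <= M.

(** Continuity with respect to a single norm, stated with an arbitrary upper bound M so that no
    supremum has to be formed. *)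
Definition bounded_on (u : (V -> R[i]) -> R[i]) (l : R) (m : nat) (C : R) :=
  forall g M, S_omega w g -> 0 <= M -> Nle l m (fun s => pd s g) M ->
    Nle l m (fun s => pd s (fourier g)) M -> normc (u g) <= C * M.

Section linear_functional.
Variable u : (V -> R[i]) -> R[i].
Hypothesis lu : linear_on u.

Lemma linear_on0 : u (fun=> 0) = 0.
Proof.
have := lu 1 S_omega0 S_omega0; under eq_fun do rewrite mulr0 addr0.
by move=> /eqP; rewrite mul1r -subr_eq0 opprD addrA subrr sub0r oppr_eq0 => /eqP.
Qed.

Lemma linear_onZ c f : S_omega w f -> u (fun x => c * f x) = c * u f.
Proof.
move=> Sf; have := lu c Sf S_omega0; rewrite linear_on0 addr0 => <-.
by congr u; apply/funext => x; rewrite addr0.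
Qed.

Lemma linear_onD f g : S_omega w f -> S_omega w g ->
  u (fun x => f x + g x) = u f + u g.
Proof.
move=> Sf Sg; have := lu 1 Sf Sg; rewrite mul1r => <-.
by congr u; apply/funext => x; rewrite mul1r.
Qed.

Lemma linear_onB c f g : S_omega w f -> S_omega w g ->
  u (fun x => f x - c * g x) = u f - c * u g.
Proof.
move=> Sf Sg; have := lu (- c) Sg Sf; rewrite mulNr addrC => <-.
by congr u; apply/funext => x; rewrite mulNr addrC.
Qed.

End linear_functional.

(** Continuity at 0 with tolerance 1, followed by homogeneity. The finitely many seminorms of the
    neighbourhood are all dominated at one exponent l and one order m. *)
Lemma dual_bounded u : S_omega_dual w u -> linear_on u /\
  exists l m C, [/\ 0 <= l, 0 <= C & bounded_on u l m C].
Proof.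
move=> [lu cu]; split => //.
have [s [del [del0 s0 H]]] := cu _ S_omega0 1 ltr01.
(* Sums stand in for maxima over the list of seminorms. *)
pose l := \sum_(k <- s) `|k.1|; pose m := (\sum_(k <- s) mabs k.2)%N.
have sl k : k \in s -> k.1 <= l.
  move=> ks; rewrite /l (big_rem _ ks) /=; apply: (le_trans (ler_norm _)).
  by rewrite lerDl sumr_ge0.
have sm k : k \in s -> (mabs k.2 <= m)%N.
  by move=> ks; rewrite /m (big_rem _ ks) /= leq_addr.
exists l, m, (2 / del); split; rewrite ?divr_ge0 ?(ltW del0) ?sumr_ge0//.
(* The scaling below divides by M, hence M > 0; general M is reached by letting M + e' decrease to
   M. *)
suff pos g M : S_omega w g -> 0 < M -> Nle l m (fun s => pd s g) M ->
    Nle l m (fun s => pd s (fourier g)) M -> normc (u g) <= 2 / del * M.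
  move=> g M Sg M0 N1 N2; apply/ler_addgt0Pr => e e0.
  have k0 : 0 < 2 / del by rewrite divr_gt0.
  have Mlt : M <= M + e / (2 / del) by rewrite lerDl divr_ge0 ?(ltW e0) ?(ltW k0).
  apply: (le_trans (pos g (M + e / (2 / del)) Sg _ _ _)).
  - by rewrite ltr_wpDl// divr_gt0.
  - by move=> t y ts; apply: le_trans Mlt; exact: N1.
  - by move=> t y ts; apply: le_trans Mlt; exact: N2.
  - by rewrite mulrDr [X in _ + X]mulrCA divff ?mulr1// gt_eqF.
move=> Sg M0 N1 N2.
(* After this scaling each seminorm is at most del / 2, strictly below [del]. *)
pose c : R := del / (2 * M); have c0 : 0 < c by rewrite divr_gt0// mulr_gt0.
have [rg rfg] := S_omega_rapid hw Sg.
pose g' x := c%:C%C * g x.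
have Sg' : S_omega w g' := S_omegaZ c%:C%C Sg.
have fg' : fourier g' = fun xi => c%:C%C * fourier g xi.
  exact: fourierZ (rapid_vcint rg).
have small h k : k \in s -> smooth h -> Nle l m (fun s => pd s h) M ->
    seminorm w k.1 k.2 (fun x => c%:C%C * h x) < del.
  move=> ks sh Nh; apply: (@le_lt_trans _ _ (del / 2)); last first.
    by rewrite ltr_pdivrMr// ltr_pMr// ltr1n.
  apply: ge_sup; first by exists (weighted w k.1 k.2 (fun x => c%:C%C * h x) 0), 0.
  move=> _ [y _ <-]; rewrite /weighted normc_mD pdZ// Normc.normcM normc_real.
  rewrite (gtr0_norm c0) mulrCA.
  have := Nh (seq_of k.2) y; rewrite size_seq_of => /(_ (sm _ ks)) Hy.
  apply: (@le_trans _ _ (c * M)).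
    rewrite ler_wpM2l ?(ltW c0)//; apply: le_trans Hy.
    rewrite ler_wpM2r ?normc_ge0// ler_expR ler_wpM2r ?(sl _ ks)//.
    exact: W_ge0.
  by rewrite le_eqVlt /c; apply/orP; left; apply/eqP; field; rewrite gt_eqF.
have := H g' Sg'; rewrite (linear_on0 lu) subr0.
have -> : (fun x => g' x - 0) = g' by apply/funext => x; rewrite subr0.
have -> : u g' = c%:C%C * u g by exact: linear_onZ.
move=> /(_ _) Hlt.
have {}Hlt : normc (c%:C%C * u g) < 1.
  apply: Hlt => k ks; split; first exact: small rg.1 N1.
  by rewrite fg'; exact: small rfg.1 N2.
rewrite Normc.normcM normc_real gtr0_norm// mulrC -ltr_pdivlMr// mul1r in Hlt.
apply: (le_trans (ltW Hlt)); rewrite /c invf_div mulrAC.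
by [].
Qed.

End dual_space.

(** * Functionals commute with superpositions *)

Section finite_orders.
Context {R : realType} {n : nat}.

(** Words of length at most m form the finite type [m.-bseq], so constants chosen word by word
    become uniform. *)
Lemma seq_bound (m : nat) (f : seq 'I_n -> R) :
  exists2 C : R, 0 < C & forall s, (size s <= m)%N -> f s <= C.
Proof.
exists (\sum_(t : m.-bseq 'I_n) `|f t| + 1); first by rewrite ltr_wpDl ?sumr_ge0.
move=> s sm; pose t : m.-bseq 'I_n := Bseq sm.
rewrite -[f s]/(f t) (bigD1 t)//=; apply: (le_trans (ler_norm _)).
by rewrite -addrA lerDl addr_ge0// sumr_ge0.
Qed.

Lemma seq_bound_below (m : nat) (f : seq 'I_n -> R) : (forall s, 0 < f s) ->
  exists2 r : R, 0 < r & forall s, (size s <= m)%N -> r <= f s.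
Proof.
move=> f0; have [C C0 HC] := seq_bound m (fun s => (f s)^-1).
exists C^-1; first by rewrite invr_gt0.
by move=> s sm; rewrite -[f s]invrK lef_pV2 ?posrE ?invr_gt0//; exact: HC.
Qed.

End finite_orders.

(** * Superpositions restricted to subsets of the parameter space *)

Section weak_integral_family.
Context {R : realType} (w : R -> R).
Hypothesis hw : nonquasianalytic_subadditive_weight w.
Context {n : nat}.
Local Notation V := 'rV[R]_n.
Local Notation W := (W w).
Context d {Z : measurableType d}.
Variable mu : {sigma_finite_measure set Z -> \bar R}.
Variables (P : Z -> R) (G : Z -> R[i]) (a b : Z -> V).
Hypotheses (IP : rint mu P) (P0 : forall z, 0 <= P z) (mG : cmeas G).

(** Restriction to A is put into the coefficient, so that an integral over A is a superposition over
    all of Z. *)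
Definition cut (A : set Z) (z : Z) : R[i] := (\1_A z)%:C%C * G z.

Lemma indic_le1 (A : set Z) (z : Z) : \1_A z <= 1 :> R.
Proof. by rewrite indicE; case: (z \in A). Qed.

Lemma normc_cut A z : normc (cut A z) = \1_A z * normc (G z).
Proof. by rewrite /cut Normc.normcM normc_real ger0_norm. Qed.

Lemma cmeas_cut A : measurable A -> cmeas (cut A).
Proof. by move=> mA; apply: cmeasM => //; exact/cmeas_real/measurable_indic. Qed.

Lemma Rintegral_cut (f : Z -> R) A :
  \int[mu]_(z in A) f z = \int[mu]_z (\1_A z * f z).
Proof.
rewrite Rintegral_mkcond; apply: eq_Rintegral => z _; rewrite patchE indicE.
by case: (_ \in _); rewrite ?mul1r ?mul0r.
Qed.

Lemma rint_cut (f : Z -> R) A : measurable A -> rint mu f ->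
  rint mu (fun z => \1_A z * f z).
Proof.
move=> mA If; apply: (rint_le _ _ (integrable_norm If)).
  apply: measurable_funM; first exact: measurable_indic.
  exact: rint_measurable If.
move=> z; rewrite normrM ler_piMl// indicE.
by case: (_ \in _); rewrite ?normr1 ?normr0.
Qed.

(** Stands for the derivatives of the shifts and for those of their Fourier transforms; the
    estimates below are applied once to each. *)
Variable D : seq 'I_n -> V -> V -> V -> R[i].
Hypothesis contD : forall s, contw w (D s).
Hypothesis mD : forall s y, cmeas (fun z => D s (a z) (b z) y).
Variables (l : R) (m : nat).
Hypothesis l0 : 0 <= l.
Hypothesis bD : forall s, exists2 C : R, 0 < C & forall z y,
  expR (l * W y) * normc (G z * D s (a z) (b z) y) <= C * P z.

(** The factor 1 gives the difference the shape f - c g that [bound_difference] expects. *)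
Lemma family_continuous a0 b0 (e : R) : 0 < e -> exists2 r, 0 < r &
  forall a b, box a0 r a -> box b0 r b ->
    Nle w l m (fun s y => D s a b y - 1 * D s a0 b0 y) e.
Proof.
move=> e0.
have /choice[r rP] : forall s, exists r, 0 < r /\ forall a b, box a0 r a ->
    box b0 r b -> forall y, expR (l * W y) * normc (D s a b y - D s a0 b0 y) <= e.
  by move=> s; have [r r0 Hr] := contD s l a0 b0 e0; exists r.
have [r' r'0 r'P] := seq_bound_below m (fun s => (rP s).1).
exists r' => // a' b' aB bB s y sm; rewrite mul1r.
by apply: (rP s).2; apply: (box_le (r'P s sm)).
Qed.

Lemma family_bound : exists2 C : R, 0 < C &
  forall z, Nle w l m (fun s y => G z * D s (a z) (b z) y) (C * P z).
Proof.
have /choice[C CP] : forall s, exists C : R, 0 < C /\ forall z y,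
    expR (l * W y) * normc (G z * D s (a z) (b z) y) <= C * P z.
  by move=> s; have [C C0 HC] := bD s; exists C.
have [K K0 KP] := seq_bound m C.
exists K => // z s y sm; apply: (le_trans ((CP s).2 z y)).
by rewrite ler_wpM2r//; exact: KP.
Qed.

Let cutD A s y z : cut A z * D s (a z) (b z) y =
  (\1_A z)%:C%C * (G z * D s (a z) (b z) y).
Proof. by rewrite /cut mulrA. Qed.

Let mcutD A s y : measurable A -> cmeas (fun z => cut A z * D s (a z) (b z) y).
Proof. by move=> mA; apply: cmeasM => //; exact: cmeas_cut. Qed.

Lemma family_cintble A s y : measurable A ->
  cintble mu (fun z => cut A z * D s (a z) (b z) y).
Proof.
move=> mA; have [C C0 HC] := bD s.
apply: (cintble_le (mcutD s y mA) _ (rintZ (C * expR (- (l * W y))) IP)) => z.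
rewrite cutD Normc.normcM normc_real ger0_norm//.
apply: (@le_trans _ _ (normc (G z * D s (a z) (b z) y))).
  by rewrite ler_piMl ?normc_ge0// indic_le1.
by rewrite mulrAC expRN ler_pdivlMr ?expR_gt0// mulrC.
Qed.

Lemma family_integral_bound : exists2 C : R, 0 < C & forall A, measurable A ->
  Nle w l m (fun s y => cint mu (fun z => cut A z * D s (a z) (b z) y))
    (\int[mu]_(z in A) (C * P z)).
Proof.
have [C C0 HC] := family_bound; exists C => // A mA s y sm.
rewrite -[expR _](ger0_norm (expR_ge0 _)) -normc_real -Normc.normcM.
rewrite -cintZ; last exact: family_cintble.
rewrite Rintegral_cut; apply: normc_cint_le.
- by apply: cmeasM; [exact: cmeas_cst|exact: mcutD].
- move=> z; rewrite cutD !Normc.normcM !normc_real !ger0_norm ?expR_ge0//.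
  rewrite mulrCA ler_wpM2l// -Normc.normcM; exact: HC.
- exact: rint_cut (rintZ _ IP).
Qed.

Hypothesis IG : rint mu (fun z => normc (G z)).

Lemma cintble_cut A : measurable A -> cintble mu (cut A).
Proof.
move=> mA; apply: (cintble_le (cmeas_cut mA) _ IG) => z.
by rewrite normc_cut ler_piMl ?normc_ge0// indic_le1.
Qed.

(** For parameters in a small box every member of the family may be replaced by the one at the
    centre, with an error of density e relative to the modulus of G. This is the source of the small
    local density of [Phi]. *)
Lemma family_local a0 b0 (e : R) : 0 < e -> exists2 r, 0 < r &
  forall A, measurable A -> A `<=` [set z | box a0 r (a z) /\ box b0 r (b z)] ->
    Nle w l m (fun s y => cint mu (fun z => cut A z * D s (a z) (b z) y) -
      cint mu (cut A) * D s a0 b0 y) (e * \int[mu]_(z in A) normc (G z)).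
Proof.
move=> e0; have [r r0 Hr] := family_continuous a0 b0 e0; exists r => // A mA AB s y sm.
rewrite -[expR _](ger0_norm (expR_ge0 _)) -normc_real -Normc.normcM.
rewrite -cintZr; last exact: cintble_cut.
have I1 := family_cintble s y mA.
have I2 : cintble mu (fun z => cut A z * D s a0 b0 y).
  have := cintbleZ (D s a0 b0 y) (cintble_cut mA); congr cintble.
  by apply/funext => z; rewrite mulrC.
rewrite -cintB// -cintZ; last exact: cintbleB.
rewrite Rintegral_cut -RintegralZl//; last exact: rint_cut.
apply: normc_cint_le.
- apply: cmeasM; first exact: cmeas_cst.
  exact: cmeasB (cintble_cmeas I1) (cintble_cmeas I2).
- move=> z; rewrite -mulrBr mulrCA Normc.normcM normc_cut -mulrA.
  have [zA|zA] := boolP (z \in A); last first.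
    by rewrite indicE (negbTE zA) !mul0r mulr0.
  have [az bz] := AB z (set_mem zA).
  have := Hr _ _ az bz s y sm; rewrite mul1r => H.
  rewrite indicE zA !mul1r mulrC ler_wpM2r ?normc_ge0//.
  by rewrite Normc.normcM normc_real ger0_norm ?expR_ge0.
- by apply: rintZ; exact: rint_cut.
Qed.

End weak_integral_family.

(** * Exchange of a functional with a superposition *)

Section weak_integral.
Context {R : realType} (w : R -> R).
Hypothesis hw : nonquasianalytic_subadditive_weight w.
Context {n : nat}.
Local Notation V := 'rV[R]_n.
Local Notation W := (W w).
Local Notation pd s f := (foldr (@partial R n) f s).
Variables (u : (V -> R[i]) -> R[i]) (l : R) (m : nat) (Cu : R).
Hypotheses (lu : linear_on w u) (l0 : 0 <= l) (Cu0 : 0 <= Cu).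
Hypothesis bu : bounded_on w u l m Cu.
Variable th : V -> R[i].
Hypothesis Sth : S_omega w th.

Let rth : rapid w th := (S_omega_rapid hw Sth).1.
Let rfth : rapid w (fourier th) := (S_omega_rapid hw Sth).2.

Lemma fourier_TFE a b : fourier (TF th a b) =
  fun eta => expi (dotv a b) * TF (fourier th) b (- a) eta.
Proof. exact: fourier_TF (rapid_vcint hw rth). Qed.

Lemma S_omega_TF a b : S_omega w (TF th a b).
Proof.
apply: (rapid_S_omega hw); first exact: rapid_TF.
rewrite fourier_TFE.
have r1 := rapid_TF hw b (- a) rfth.
have := rapid_lin (expi (dotv a b)) r1 (S_omega_rapid hw (S_omega0 hw (n := n))).1.
by congr rapid; apply/funext => y; rewrite addr0.
Qed.

Let D1 s a b y := pd s (TF th a b) y.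
Let D2 s a b y := expi (dotv a b) * pd s (TF (fourier th) b (- a)) y.

Let D2E s a b : pd s (fourier (TF th a b)) = D2 s a b.
Proof. by rewrite fourier_TFE pdZ//; exact: smooth_TF rfth.1. Qed.

Let contD1 s : contw w (D1 s).
Proof. exact: contw_TF. Qed.

Lemma box_opp (a0 a : V) r : box a0 r a -> box (- a0) r (- a).
Proof. by move=> H i; rewrite !mxE -opprD normrN; exact: H. Qed.

Let contD2 s : contw w (D2 s).
Proof.
apply: contwM.
- move=> a0 b0 e e0.
  (* Collects <a - a0, b> and <a0, b - b0>, each at most r n times a norm, with the Lipschitz
     constant 2 of [expi]; the last n comes from |b| <= |b0| + n when r <= 1. *)
  pose M := 2 * (n%:R * (enorm b0 + enorm a0 + n%:R)) + 1.
  have M0 : 0 < M by rewrite ltr_wpDl// !mulr_ge0// !addr_ge0// enorm_ge0.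
  exists (Num.min 1 (e / M)); first by rewrite lt_min ltr01 divr_gt0.
  set r := Num.min _ _ => a b aB bB.
  have r0 : 0 < r by rewrite lt_min ltr01 divr_gt0.
  have r1 : r <= 1 by rewrite ge_min lexx.
  apply: (le_trans (expi_lipschitz _ _)).
  have -> : dotv a b - dotv a0 b0 = dotv (a - a0) b + dotv a0 (b - b0).
    by rewrite dotvBl dotvBr; ring.
  have hb : enorm b <= enorm b0 + n%:R.
    rewrite -(subrK b0 b) addrC; apply: (le_trans (enormD _ _)); rewrite lerD2l.
    by apply: (le_trans (enorm_box r0 bB)); rewrite ler_piMl.
  have h1 : `|dotv (a - a0) b| <= (r * n%:R) * (enorm b0 + n%:R).
    apply: (le_trans (dotv_abs_le _ _)); apply: ler_pM; rewrite ?enorm_ge0//.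
    exact: enorm_box.
  have h2 : `|dotv a0 (b - b0)| <= enorm a0 * (r * n%:R).
    apply: (le_trans (dotv_abs_le _ _)); rewrite ler_wpM2l ?enorm_ge0//.
    exact: enorm_box.
  apply: (@le_trans _ _ (r * M)).
    apply: (@le_trans _ _ (2 * ((r * n%:R) * (enorm b0 + n%:R) +
        enorm a0 * (r * n%:R)))).
      by rewrite ler_wpM2l//; apply: (le_trans (ler_normD _ _)); exact: lerD.
    by rewrite /M; have := r0; nra.
  by rewrite -ler_pdivlMr// ge_min lexx orbT.
- move=> k a0 b0 e e0; have [r r0 Hr] := contw_TF hw s rfth k b0 (- a0) e0.
  by exists r => // a b aB bB y; apply: Hr => //; exact: box_opp.
- by move=> a b; exact: (rapid_TF hw b (- a) rfth).2.
Qed.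

Lemma pd_lin s c f g : smooth f -> smooth g ->
  pd s (fun x : V => f x - c * g x) = fun x => pd s f x - c * pd s g x.
Proof.
move=> sf sg; have -> : (fun x => f x - c * g x) = (fun x => - c * g x + f x).
  by apply/funext => x; rewrite mulNr addrC.
rewrite (pdD s (smoothZ (- c) sg) sf) (pdZ s (- c) sg).
by apply/funext => x; rewrite mulNr addrC.
Qed.

Lemma fourierB c f g : rapid w f -> rapid w g ->
  fourier (fun x : V => f x - c * g x) = fun x => fourier f x - c * fourier g x.
Proof.
move=> rf rg; have -> : (fun x => f x - c * g x) = (fun x => - c * g x + f x).
  by apply/funext => x; rewrite mulNr addrC.
rewrite (fourier_lin (- c) (rapid_vcint hw rg) (rapid_vcint hw rf)).
by apply/funext => x; rewrite mulNr addrC.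
Qed.

Lemma S_omegaB c (f g : V -> R[i]) : S_omega w f -> S_omega w g ->
  S_omega w (fun x => f x - c * g x).
Proof.
move=> Sf Sg; have := S_omega_lin hw (- c) Sg Sf; congr S_omega.
by apply/funext => x; rewrite mulNr addrC.
Qed.

(** Boundedness of u applied to f - c TF, with the derivatives of the shift and of its transform
    already written as [D1] and [D2]. *)
Let bound_difference f c a0 b0 M : S_omega w f -> 0 <= M ->
  Nle w l m (fun s y => pd s f y - c * D1 s a0 b0 y) M ->
  Nle w l m (fun s y => pd s (fourier f) y - c * D2 s a0 b0 y) M ->
  normc (u f - c * u (TF th a0 b0)) <= Cu * M.
Proof.
move=> Sf M0 N1 N2; have ST := S_omega_TF a0 b0.
have [rf rff] := S_omega_rapid hw Sf; have [rT rfT] := S_omega_rapid hw ST.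
rewrite -(linear_onB lu c Sf ST); apply: bu; [exact: S_omegaB|by []|..].
- by move=> s y sm; rewrite (pd_lin s c rf.1 rT.1); exact: N1.
- move=> s y sm; rewrite (fourierB c rf rT) (pd_lin s c rff.1 rfT.1) D2E; exact: N2.
Qed.

Lemma functional_continuous a0 b0 (e : R) : 0 < e -> exists2 r, 0 < r &
  forall a b, box a0 r a -> box b0 r b ->
    normc (u (TF th a b) - u (TF th a0 b0)) <= e.
Proof.
move=> e0; have e'0 : 0 < e / (Cu + 1) by rewrite divr_gt0// ltr_wpDl.
have [r1 r10 H1] := family_continuous contD1 l m a0 b0 e'0.
have [r2 r20 H2] := family_continuous contD2 l m a0 b0 e'0.
exists (Num.min r1 r2); first by rewrite lt_min r10.
move=> a b aB bB.
have le1 : Num.min r1 r2 <= r1 by rewrite ge_min lexx.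
have le2 : Num.min r1 r2 <= r2 by rewrite ge_min lexx orbT.
have N1 := H1 a b (box_le le1 aB) (box_le le1 bB).
have N2 := H2 a b (box_le le2 aB) (box_le le2 bB).
rewrite -[u (TF th a0 b0)]mul1r.
apply: (le_trans (bound_difference (S_omega_TF a b) (ltW e'0) N1 _)).
  by move=> s y sm; rewrite D2E; exact: N2.
by rewrite mulrCA ler_piMr ?(ltW e0)// ler_pdivrMr ?ltr_wpDl// mul1r lerDl.
Qed.

(** Continuity in the phase-space point yields, through [cmeas_comp_row], the measurability of u
    along any measurable family of shifts. *)
Lemma ccont_functional :
  ccont (fun q : 'rV[R]_(n + n) => u (TF th (lsubmx q) (rsubmx q))).
Proof.
apply: ccont_box => q e e0.
have e2 : 0 < e / 2 by rewrite divr_gt0.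
have [r r0 Hr] := functional_continuous (lsubmx q) (rsubmx q) e2.
exists r => // q' qq'; rewrite normc_distC; apply: (@le_lt_trans _ _ (e / 2)).
  apply: Hr => i; rewrite !mxE; exact: qq'.
by rewrite ltr_pdivrMr// ltr_pMr// ltr1n.
Qed.

Context d {Z : measurableType d}.
Variable mu : {sigma_finite_measure set Z -> \bar R}.
Variables (P : Z -> R) (G : Z -> R[i]) (a b : Z -> V).
Hypotheses (IP : rint mu P) (P0 : forall z, 0 <= P z) (mG : cmeas G).
Hypothesis ma : forall i, measurable_fun setT (fun z => a z 0 i : measurableTypeR R).
Hypothesis mb : forall i, measurable_fun setT (fun z => b z 0 i : measurableTypeR R).
Hypothesis bG : beats_weight w P G a b.

Let c z : 'rV[R]_(n + n) := row_mx (a z) (b z).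

Let mc i : measurable_fun setT (fun z => c z 0 i : measurableTypeR R).
Proof. exact: measurable_row_mx. Qed.

Let K z := u (TF th (a z) (b z)).

Let mK : cmeas K.
Proof.
rewrite (_ : K = fun z => u (TF th (lsubmx (c z)) (rsubmx (c z)))).
  exact: (cmeas_comp_row mc ccont_functional).
by apply/funext => z; rewrite /c row_mxKl row_mxKr.
Qed.

Let bD1 s : exists2 C : R, 0 < C & forall z y,
  expR (l * W y) * normc (G z * D1 s (a z) (b z) y) <= C * P z.
Proof. exact: (synth_dominated hw bG s l0 rth). Qed.

Let bD2 s : exists2 C : R, 0 < C & forall z y,
  expR (l * W y) * normc (G z * D2 s (a z) (b z) y) <= C * P z.
Proof.
have [C C0 HC] := synth_dominated hw (beats_weight_swap bG) s l0 rfth.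
by exists C => // z y; rewrite /D2 mulrA; exact: HC.
Qed.

Let mD1 s y : cmeas (fun z => D1 s (a z) (b z) y).
Proof. exact: (cmeas_TF s y rth ma mb). Qed.

Let mD2 s y : cmeas (fun z => D2 s (a z) (b z) y).
Proof.
apply: cmeasM; first exact: cmeas_expi_dotv.
by apply: (cmeas_TF s y rfth mb); exact: measurable_oppr_row.
Qed.

(** [G z] is moved inside u by linearity, so that [beats_weight] compensates the growth of u on
    shifts. *)
Let bGK : exists2 C : R, 0 < C & forall z, normc (G z * K z) <= C * P z.
Proof.
have [C1 C10 H1] := family_bound P0 m bD1; have [C2 C20 H2] := family_bound P0 m bD2.
exists (Cu * (C1 + C2) + 1); first by rewrite ltr_wpDl// mulr_ge0// addr_ge0// ltW.
move=> z; rewrite /K -(linear_onZ hw lu); last exact: S_omega_TF.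
apply: (@le_trans _ _ (Cu * ((C1 + C2) * P z))); last first.
  by rewrite mulrA ler_wpM2r// lerDl.
have rT := rapid_TF hw (a z) (b z) rth.
apply: bu; first exact: S_omegaZ (S_omega_TF _ _).
- by rewrite mulr_ge0// addr_ge0// ltW.
- move=> s y sm; rewrite (pdZ s _ rT.1); apply: (le_trans (H1 z s y sm)).
  by rewrite ler_wpM2r// lerDl ltW.
- move=> s y sm; rewrite (fourierZ _ (rapid_vcint hw rT)).
  rewrite (pdZ s _ (S_omega_rapid hw (S_omega_TF (a z) (b z))).2.1) D2E.
  apply: (le_trans (H2 z s y sm)).
  by rewrite ler_wpM2r// lerDr ltW.
Qed.

Let beats_cut A : beats_weight w P (cut G A) a b.
Proof.
move=> k; have [C C0 HC] := bG k; exists C => // z.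
apply: le_trans (HC z); rewrite ler_wpM2r ?expR_ge0// normc_cut.
by rewrite ler_piMl ?normc_ge0// indic_le1.
Qed.

Let GA A := synth mu (cut G A) a b th.

Let S_GA A : measurable A -> S_omega w (GA A).
Proof.
move=> mA.
exact: (S_omega_synth hw IP P0 (cmeas_cut mG mA) ma mb (beats_cut A) Sth).
Qed.

Let pd_GA A s : measurable A ->
  pd s (GA A) = fun y => cint mu (fun z => cut G A z * D1 s (a z) (b z) y).
Proof.
move=> mA; exact: (pd_synth hw IP (cmeas_cut mG mA) ma mb (beats_cut A) rth).
Qed.

Let pd_fourier_GA A s : measurable A ->
  pd s (fourier (GA A)) = fun y => cint mu (fun z => cut G A z * D2 s (a z) (b z) y).
Proof.
move=> mA; have mGA := cmeas_cut mG mA.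
rewrite /GA (fourier_synth hw IP P0 mGA ma mb (beats_cut A) rth).
have mGs : cmeas (fun z => cut G A z * expi (dotv (a z) (b z))).
  by apply: cmeasM => //; exact: cmeas_expi_dotv.
rewrite (pd_synth hw IP mGs mb (measurable_oppr_row ma)
  (beats_weight_swap (beats_cut A)) rfth).
by apply/funext => y; congr cint; apply/funext => z; rewrite /D2 mulrA.
Qed.

Let Phi A := u (GA A) - cint mu (fun z => cut G A z * K z).

Let IcK A : measurable A -> cintble mu (fun z => cut G A z * K z).
Proof.
move=> mA; have [C C0 HC] := bGK.
apply: (cintble_le _ _ (rintZ C IP)); first exact: cmeasM (cmeas_cut mG mA) mK.
move=> z; apply: le_trans (HC z).
rewrite Normc.normcM normc_cut [X in _ <= X]Normc.normcM.
by rewrite ler_wpM2r ?normc_ge0// ler_piMl ?normc_ge0// indic_le1.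
Qed.

Let cutU A B z : A `&` B = set0 -> cut G (A `|` B) z = cut G A z + cut G B z.
Proof.
move=> AB; rewrite /cut -mulrDl -rmorphD !indicE in_setU /=.
have [zA|zA] := boolP (z \in A); have [zB|zB] := boolP (z \in B) => //=.
- have : (A `&` B) z by split; exact: set_mem.
  by rewrite AB.
- by rewrite addr0.
- by rewrite add0r.
- by rewrite addr0.
Qed.

Let PhiU A B : measurable A -> measurable B -> A `&` B = set0 ->
  Phi (A `|` B) = Phi A + Phi B.
Proof.
move=> mA mB AB.
have E1 : u (GA (A `|` B)) = u (GA A) + u (GA B).
  rewrite -(linear_onD lu (S_GA mA) (S_GA mB)); congr u; apply/funext => y.
  rewrite /GA /synth -cintD; last 2 first.
  - exact: (cintble_synth hw IP (cmeas_cut mG mA) ma mb (beats_cut A) rth [::] y).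
  - exact: (cintble_synth hw IP (cmeas_cut mG mB) ma mb (beats_cut B) rth [::] y).
  by congr cint; apply/funext => z; rewrite cutU// mulrDl.
have E2 : cint mu (fun z => cut G (A `|` B) z * K z) =
    cint mu (fun z => cut G A z * K z) + cint mu (fun z => cut G B z * K z).
  rewrite -cintD; [|exact: IcK|exact: IcK]; congr cint.
  by apply/funext => z; rewrite cutU// mulrDl.
by rewrite /Phi E1 E2; ring.
Qed.

Let intA_le (f g : Z -> R) A : measurable A -> rint mu f -> rint mu g ->
  (forall z, f z <= g z) -> \int[mu]_(z in A) f z <= \int[mu]_(z in A) g z.
Proof.
move=> mA If Ig fg; apply: le_Rintegral => //; exact: integrableS If || exact: integrableS Ig.
Qed.

Let intAZ (f : Z -> R) k A : measurable A -> rint mu f ->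
  \int[mu]_(z in A) (k * f z) = k * \int[mu]_(z in A) f z.
Proof. by move=> mA If; rewrite RintegralZl//; exact: integrableS If. Qed.

Theorem weak_integral : u (synth mu G a b th) =
  cint mu (fun z => G z * u (TF th (a z) (b z))).
Proof.
have [C1 C10 H1] := family_integral_bound IP P0 mG mD1 m bD1.
have [C2 C20 H2] := family_integral_bound IP P0 mG mD2 m bD2.
have [C3 C30 H3] := bGK.
have [C4 C40 H4] := bG 0.
have nG z : normc (G z) <= C4 * P z by have := H4 z; rewrite mul0r expR0 mulr1.
have IG : rint mu (fun z => normc (G z)).
  apply: (rint_le _ _ (rintZ C4 IP)); first exact: measurable_normc.
  by move=> z; rewrite ger0_norm ?normc_ge0.
(* One multiple of P serves as H for both hypotheses: Cu (C1 + C2) + C3 gives the domination of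
   [Phi], and the 1 makes kappa at least 1 for the local estimate. *)
pose kappa := Cu * (C1 + C2) + C3 + 1.
have k1 : 0 < kappa by rewrite ltr_wpDl// addr_ge0 ?(ltW C30)// mulr_ge0// addr_ge0// ltW.
have IPA A : measurable A -> 0 <= \int[mu]_(z in A) P z.
  by move=> _; apply: Rintegral_ge0 => z _.
suff : Phi setT = 0.
  move=> /eqP; rewrite subr_eq0 /GA => /eqP.
  have -> : cut G setT = G.
    by apply/funext => z; rewrite /cut indicT mul1r.
  by [].
apply: (@finitely_additive_eq0 _ _ _ _ mu c (fun z => kappa * P z) Phi mc) => //.
- exact: rintZ.
- by move=> z; rewrite mulr_ge0// ltW.
- move=> A mA; rewrite intAZ//.
  apply: (le_trans (normcB_le _ _)).
  apply: (@le_trans _ _ (Cu * ((C1 + C2) * \int[mu]_(z in A) P z) +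
      C3 * \int[mu]_(z in A) P z)); last first.
    by have := IPA A mA; rewrite /kappa; move: (\int[mu]_(z in A) P z) => I I0; lra.
  apply: lerD.
    apply: bu; first exact: S_GA.
    + by rewrite mulr_ge0 ?IPA// addr_ge0// ltW.
    + move=> s y sm; rewrite pd_GA//; apply: (le_trans (H1 A mA s y sm)).
      by rewrite intAZ// ler_wpM2r ?IPA// lerDl ltW.
    + move=> s y sm; rewrite pd_fourier_GA//; apply: (le_trans (H2 A mA s y sm)).
      by rewrite intAZ// ler_wpM2r ?IPA// lerDr ltW.
  rewrite -intAZ// Rintegral_cut; apply: normc_cint_le.
  + exact: cintble_cmeas (IcK mA).
  + move=> z; rewrite /cut -mulrA Normc.normcM normc_real ger0_norm//.
    by rewrite ler_wpM2l.
  + by apply: rint_cut => //; exact: rintZ.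
move=> q e e0.
(* The two local errors add up to e1 (Cu + 1) times the integral of the modulus of G, which C4 P
   dominates; the added ones keep the denominator positive. *)
pose e1 := e / (2 * (Cu + 1) * (C4 + 1)).
have den0 : 0 < 2 * (Cu + 1) * (C4 + 1).
  by rewrite !mulr_gt0 ?ltr_wpDl// ltW.
have e10 : 0 < e1 by rewrite divr_gt0.
have [r1 r10 L1] := family_local IP mG contD1 mD1 m bD1 IG (lsubmx q) (rsubmx q) e10.
have [r2 r20 L2] := family_local IP mG contD2 mD2 m bD2 IG (lsubmx q) (rsubmx q) e10.
have [r3 r30 L3] := functional_continuous (lsubmx q) (rsubmx q) e10.
set a0 := lsubmx q in L1 L2 L3; set b0 := rsubmx q in L1 L2 L3.
exists (Num.min r1 (Num.min r2 r3)); first by rewrite !lt_min r10 r20.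
set r := Num.min _ _; move=> A mA Aq.
have le1 : r <= r1 by rewrite /r ge_min lexx.
have le2 : r <= r2 by rewrite /r !ge_min lexx !orbT.
have le3 : r <= r3 by rewrite /r !ge_min lexx !orbT.
have AB r' : r <= r' -> A `<=` [set z | box a0 r' (a z) /\ box b0 r' (b z)].
  move=> rr z /Aq Hz; split=> i.
    have := Hz (lshift n i); rewrite /c row_mxEl /a0 mxE => /lt_le_trans; exact.
  have := Hz (rshift n i); rewrite /c row_mxEr /b0 mxE => /lt_le_trans; exact.
set I := \int[mu]_(z in A) normc (G z) in L1 L2.
have I0 : 0 <= I by apply: Rintegral_ge0 => z _; exact: normc_ge0.
pose K0 := u (TF th a0 b0).
have IcA := cintble_cut mG IG mA.
(* Both parts of [Phi A] are compared with the value K0 at the centre of the box times the integral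
   of G over A. *)
have -> : Phi A = (u (GA A) - cint mu (cut G A) * K0) -
    cint mu (fun z => cut G A z * (K z - K0)).
  rewrite /Phi (_ : (fun z => cut G A z * (K z - K0)) =
    (fun z => cut G A z * K z - cut G A z * K0)); last first.
    by apply/funext => z; rewrite mulrBr.
  rewrite cintB; [|exact: IcK|].
    by rewrite cintZr// -/K; ring.
  have := cintbleZ K0 IcA; congr cintble; apply/funext => z.
  by rewrite mulrC.
apply: (le_trans (normcB_le _ _)).
have B1 : normc (u (GA A) - cint mu (cut G A) * K0) <= Cu * (e1 * I).
  apply: bound_difference; first exact: S_GA.
  - by rewrite mulr_ge0// ltW.
  - by move=> s y sm; rewrite pd_GA//; exact: (L1 A mA (AB _ le1)).
  - by move=> s y sm; rewrite pd_fourier_GA//; exact: (L2 A mA (AB _ le2)).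
have B2 : normc (cint mu (fun z => cut G A z * (K z - K0))) <= e1 * I.
  rewrite /I -intAZ// Rintegral_cut; apply: normc_cint_le.
  - apply: cmeasM; first exact: cmeas_cut.
    by apply: cmeasB => //; exact: cmeas_cst.
  - move=> z; rewrite Normc.normcM normc_cut -mulrA.
    have [zA|zA] := boolP (z \in A); last first.
      by rewrite indicE (negbTE zA) !mul0r.
    rewrite ler_wpM2l// mulrC ler_wpM2r ?normc_ge0//.
    by have [az bz] := AB _ le3 z (set_mem zA); exact: L3.
  - by apply: rint_cut => //; exact: rintZ.
have IleP : I <= C4 * \int[mu]_(z in A) P z.
  by rewrite -intAZ//; apply: intA_le => //; exact: rintZ.
apply: (@le_trans _ _ (e1 * ((Cu + 1) * (C4 * \int[mu]_(z in A) P z)))).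
  apply: (@le_trans _ _ (e1 * ((Cu + 1) * I))).
    by apply: (le_trans (lerD B1 B2)); rewrite le_eqVlt; apply/orP; left; apply/eqP; ring.
  by rewrite ler_wpM2l ?(ltW e10)// ler_wpM2l// addr_ge0.
rewrite intAZ// mulrA.
have Ip := IPA A mA; move: (\int[mu]_(z in A) P z) Ip => J J0.
have kk : 1 <= kappa.
  by rewrite /kappa lerDr addr_ge0 ?(ltW C30)// mulr_ge0// addr_ge0// ltW.
apply: (@le_trans _ _ (e * J)); last first.
  by rewrite ler_wpM2l ?(ltW e0)// ler_peMl.
rewrite !mulrA ler_wpM2r//.
have -> : e = e1 * (2 * (Cu + 1) * (C4 + 1)) by rewrite /e1 divfK// gt_eqF.
rewrite -mulrA ler_wpM2l ?(ltW e10)//.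
by move: Cu0 C40; lra.
Qed.

End weak_integral.

(** * The short-time Fourier transform *)

Section short_time_fourier.
Context {R : realType} (w : R -> R).
Hypothesis hw : nonquasianalytic_subadditive_weight w.
Context {n : nat}.
Local Notation V := 'rV[R]_n.
Local Notation L := (lebesgue_tuple R n).
Local Notation W := (W w).
Local Notation rapid := (rapid w).
Local Notation decays := (decays w).
Local Notation pd s f := (foldr (@partial R n) f s).
Implicit Types f g psi phi : V -> R[i].

Lemma rapid_ccont f : rapid f -> ccont f.
Proof. by move=> [sf _]; exact: smooth_ccont [::] sf. Qed.

Lemma conj_TF phi a b : (fun y => conjc (TF phi a b y)) =
  TF (fun y => conjc (phi y)) a (- b).
Proof. by apply/funext => y; rewrite /TF conjcM expi_conj dotvNr. Qed.

Lemma fourier_conj f : vcint f ->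
  fourier (fun y => conjc (f y)) = fun xi => conjc (fourier f (0 + (-1) *: xi)).
Proof.
move=> If; apply/funext => xi; rewrite add0r scaleN1r.
rewrite /fourier /cintegral.
rewrite -[LHS]/(cint L (fun t => expi (- dotv (rowt t) xi) * conjc (f (rowt t)))).
rewrite -[X in conjc X]/(cint L ((fun x => expi (- dotv x (- xi)) * f x) \o @rowt R n)).
rewrite -cint_conj; last exact: vcint_expi.
by congr cint; apply/funext => t; rewrite /comp conjcM expi_conj dotvNr opprK.
Qed.

Lemma rapid_conj f : rapid f -> rapid (fun y => conjc (f y)).
Proof.
move=> [sf df]; split; first exact: smooth_conj.
move=> s l; have [C HC] := df s l; exists C => y.
by rewrite pd_conj// normc_conj.
Qed.

(** The reflection is written as an affine map so that [smooth_affine] and [pd_affine] apply. *)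
Lemma rapid_reflect f : rapid f -> rapid (fun y => f (0 + (-1) *: y)).
Proof.
move=> [sf df]; split; first exact: smooth_affine.
move=> s l; have [C HC] := df s l; exists C => y.
rewrite pd_affine// Normc.normcM normc_real normrX normrN1 expr1n mul1r.
by have := HC (0 + (-1) *: y); rewrite add0r scaleN1r WN.
Qed.

Lemma S_omega_conj f : S_omega w f -> S_omega w (fun y => conjc (f y)).
Proof.
move=> /(S_omega_rapid hw)[rf rff]; apply: (rapid_S_omega hw); first exact: rapid_conj.
rewrite fourier_conj; last exact: (rapid_vcint hw rf).
exact: rapid_conj (rapid_reflect rff).
Qed.

(** w(x) <= w(y) + w(y - x) turns decay of both factors into decay in x; the extra unit in the
    exponent for f leaves exp(-w(y)), which [expNW_le_cauchyn] makes integrable. *)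
Lemma translate_product_bound f g (l : R) : 0 <= l -> decays f -> decays g ->
  exists2 C : R, 0 < C & forall x y,
    normc (f y) * normc (g (y - x)) <= C * expR (- (l * W x)) * cauchyn y.
Proof.
move=> l0 df dg; have [C C0 HC] := decays_bound (l + 1) df.
have [D D0 HD] := decays_bound l dg; have [K K0 HK] := expNW_le_cauchyn hw n.
exists (C * D * K); first by rewrite !mulr_gt0.
move=> x y.
apply: (@le_trans _ _ ((C * expR (- ((l + 1) * W y))) * (D * expR (- (l * W (y - x)))))).
  by apply: ler_pM; rewrite ?normc_ge0.
have -> : C * expR (- ((l + 1) * W y)) * (D * expR (- (l * W (y - x)))) =
    (C * D) * (expR (- (l * W y) - l * W (y - x)) * expR (- W y)).
  by rewrite mulrDl mul1r opprD !expRD; ring.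
have -> : C * D * K * expR (- (l * W x)) * cauchyn y =
  (C * D) * (expR (- (l * W x)) * (K * cauchyn y)) by ring.
rewrite ler_wpM2l ?mulr_ge0 ?(ltW C0) ?(ltW D0)//.
apply: ler_pM; rewrite ?expR_ge0//.
rewrite ler_expR -opprD lerN2 -mulrDr ler_wpM2l//.
by have := WD hw y (- (y - x)); rewrite WN opprB [y + _]addrC subrK.
Qed.

Definition Vf psi phi (a b : V) : R[i] :=
  cintegral (fun y => psi y * conjc (TF phi a b y)).

Lemma cintegralE f : cintegral f = cint L (f \o @rowt R n).
Proof. by []. Qed.

Lemma vcint_mul f g : rapid f -> rapid g -> vcint (fun y => f y * g y).
Proof.
move=> rf rg; have [B B0 HB] := decays_bounded (rg.2 [::]).
apply: (cintble_le _ _ (rintZ B (cintble_norm (rapid_vcint hw rf)))).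
  apply: cmeasM; apply: ccont_vcmeas; exact: rapid_ccont.
by move=> t; rewrite /comp Normc.normcM mulrC ler_wpM2r ?normc_ge0//; exact: HB.
Qed.

Lemma inversion psi : rapid psi -> rapid (fourier psi) -> forall y,
  cintegral (fun xi => expi (dotv y xi) * fourier psi xi) =
  ((2 * pi) ^+ n)%:C%C * psi y.
Proof.
move=> rp rfp; have [M _ HM] := decays_bounded (rp.2 [::]).
by apply: (fourier_inversion (rapid_ccont rp) HM); exact: (rapid_vcint hw).
Qed.

(** The inversion formula is inserted for psi, and after Fubini the inner integral is the conjugate
    of the transform of g. *)
Lemma parseval psi g : rapid psi -> rapid (fourier psi) -> rapid g ->
  ((2 * pi) ^+ n)%:C%C * cintegral (fun y => psi y * conjc (g y)) =
  cintegral (fun xi => fourier psi xi * conjc (fourier g xi)).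
Proof.
move=> rp rfp rg.
have Ifp := rapid_vcint hw rfp; have Ig := rapid_vcint hw rg.
pose F (z : n.-tuple (measurableTypeR R) * n.-tuple (measurableTypeR R)) : R[i] :=
  (expi (dotv (rowt z.1) (rowt z.2)) * fourier psi (rowt z.2)) * conjc (g (rowt z.1)).
have mF : cmeas F.
  apply: cmeasM.
    apply: cmeasM.
      by apply: cmeas_expi_dotv; [exact: measurable_rowt1|exact: measurable_rowt2].
    by apply: (cmeas_comp_row _ (rapid_ccont rfp)); exact: measurable_rowt2.
  apply: cmeas_conj.
  by apply: (cmeas_comp_row _ (rapid_ccont rg)); exact: measurable_rowt1.
have bF z : normc (F z) <= normc (g (rowt z.1)) * normc (fourier psi (rowt z.2)).
  by rewrite /F !Normc.normcM normc_expi mul1r normc_conj mulrC.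
have swap := cint_swap (cintble_norm Ig) (cintble_norm Ifp) mF bF.
rewrite !cintegralE -cintZ; last first.
  exact: (vcint_mul rp (rapid_conj rg)).
transitivity (cint L (fun t => cint L (fun t' => F (t, t')))).
  congr cint; apply/funext => t; rewrite /comp mulrA -(inversion rp rfp) cintegralE.
  have I1 : vcint (fun xi => expi (dotv (rowt t) xi) * fourier psi xi).
    apply: (cintble_le _ _ (cintble_norm Ifp)).
      apply: cmeasM; last exact: cintble_cmeas Ifp.
      by apply: cmeas_expi_dotv; [exact: measurable_cst_row|exact: measurable_rowt].
    by move=> t'; rewrite /comp Normc.normcM normc_expi mul1r.
  by rewrite -(cintZr _ I1).
rewrite swap; congr cint; apply/funext => t'; rewrite /comp.
have Ige := vcint_expi (rowt t') Ig.
pose k t := expi (- dotv (rowt t) (rowt t')) * g (rowt t).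
have Ek : fourier g (rowt t') = cint L k by exact: erefl.
rewrite [fourier g _]Ek -(cint_conj Ige) -(cintZ _ (cintble_conj Ige)).
congr cint; apply/funext => t; rewrite /F /= conjcM expi_conj opprK; ring.
Qed.

Lemma Vf_decay psi phi (l : R) : 0 <= l -> S_omega w psi -> S_omega w phi ->
  exists2 C : R, 0 < C & forall a b,
    normc (Vf psi phi a b) * expR (l * (W a + W b)) <= C.
Proof.
move=> l0 /(S_omega_rapid hw)[rp rfp] /(S_omega_rapid hw)[rphi rfphi].
(* The geometric mean halves the exponents, so both one-sided bounds are taken at 2 l. *)
have l20 : 0 <= l + l by rewrite addr_ge0.
have [C C0 HC] := translate_product_bound l20 (rp.2 [::]) (rphi.2 [::]).
have [D D0 HD] := translate_product_bound l20 (rfp.2 [::]) (rfphi.2 [::]).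
pose A := \int[L]_t cauchyn (rowt t); have Ic := (@vint_cauchyn R n).1.
have A0 : 0 <= A by apply: Rintegral_ge0 => t _; exact: cauchyn_ge0.
pose c : R := ((2 * pi) ^+ n)^-1.
have pi0 : (2 * pi : R) ^+ n != 0 by rewrite expf_neq0// mulf_neq0// gt_eqF// pi_gt0.
have c0 : 0 < c by rewrite invr_gt0 exprn_gt0// mulr_gt0// pi_gt0.
have H1 a b : normc (Vf psi phi a b) <= (C * A) * expR (- ((l + l) * W a)).
  rewrite /Vf cintegralE mulrAC -RintegralZl//.
  apply: normc_cint_le; last exact: rintZ.
    apply: cmeasM; first exact: ccont_vcmeas (rapid_ccont rp).
    by apply: cmeas_conj; exact: ccont_vcmeas (rapid_ccont (rapid_TF hw a b rphi)).
  move=> t; rewrite /comp Normc.normcM normc_conj /TF Normc.normcM normc_expi mul1r.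
  exact: HC.
have H2 a b : normc (Vf psi phi a b) <= (c * (D * A)) * expR (- ((l + l) * W b)).
  have rT := rapid_TF hw a b rphi.
  have -> : Vf psi phi a b = c%:C%C *
      cintegral (fun xi => fourier psi xi * conjc (fourier (TF phi a b) xi)).
    by rewrite -parseval// mulrA -rmorphM mulVf// mul1r.
  rewrite Normc.normcM normc_real gtr0_norm// -!mulrA ler_wpM2l ?(ltW c0)//.
  rewrite mulrA mulrAC -RintegralZl// cintegralE.
  apply: normc_cint_le; last exact: rintZ.
    apply: cmeasM; first exact: ccont_vcmeas (rapid_ccont rfp).
    apply: cmeas_conj; apply: ccont_vcmeas.
    rewrite (fourier_TF a b (rapid_vcint hw rphi)).
    apply: ccontM; first exact: ccont_cst.
    exact: rapid_ccont (rapid_TF hw b (- a) rfphi).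
  move=> t; rewrite /comp Normc.normcM normc_conj.
  rewrite (fourier_TF a b (rapid_vcint hw rphi)).
  by rewrite /TF !Normc.normcM !normc_expi !mul1r; exact: HD.
pose Q := (C * A) * (c * (D * A)).
have Q0 : 0 <= Q by rewrite !mulr_ge0 ?(ltW c0) ?(ltW C0) ?(ltW D0).
exists (Num.sqrt Q + 1); first by rewrite ltr_wpDl ?sqrtr_ge0.
move=> a b; apply: (@le_trans _ _ (Num.sqrt Q)); last by rewrite lerDl.
set N := normc _; have N0 : 0 <= N by exact: normc_ge0.
rewrite -(@ler_pXn2r _ 2)// ?nnegrE ?mulr_ge0 ?expR_ge0 ?sqrtr_ge0// sqr_sqrtr//.
have -> : (N * expR (l * (W a + W b))) ^+ 2 =
   (N * expR ((l + l) * W a)) * (N * expR ((l + l) * W b)).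
  by rewrite mulrDr expRD !mulrDl !expRD; ring.
apply: ler_pM; rewrite ?mulr_ge0 ?expR_ge0//.
- by have := H1 a b; rewrite expRN ler_pdivlMr ?expR_gt0.
- by have := H2 a b; rewrite expRN ler_pdivlMr ?expR_gt0.
Qed.

(* Makes [Vf psi phi a b] a special case of [u (TF th a b)] for a bounded functional [u]. *)
Lemma pairing_linear_bounded psi : S_omega w psi ->
  linear_on w (fun g => cintegral (fun y => psi y * g y)) /\
  exists l m C, [/\ 0 <= l, 0 <= C &
    bounded_on w (fun g => cintegral (fun y => psi y * g y)) l m C].
Proof.
move=> /(S_omega_rapid hw)[rp _]; split.
  move=> c f g /(S_omega_rapid hw)[rf _] /(S_omega_rapid hw)[rg _].
  have I1 := vcint_mul rp rf; have I2 := vcint_mul rp rg.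
  rewrite !cintegralE -cintZ// -cintD//; last exact: cintbleZ.
  by congr cint; apply/funext => t; rewrite /comp; ring.
exists 0, 0%N, (\int[L]_t normc (psi (rowt t))); split => //.
  by apply: Rintegral_ge0 => t _; exact: normc_ge0.
move=> g M /(S_omega_rapid hw)[rg _] M0 N1 _.
have In := cintble_norm (rapid_vcint hw rp).
rewrite cintegralE -RintegralZr//; apply: normc_cint_le.
- by apply: cmeasM; apply: ccont_vcmeas; exact: rapid_ccont.
- move=> t; rewrite /comp Normc.normcM ler_wpM2l ?normc_ge0//.
  by have := N1 [::] (rowt t) isT; rewrite mul0r expR0 mul1r.
- by have := rintZ M In; congr rint; apply/funext => t; rewrite mulrC.
Qed.

(** * Inversion of the short-time Fourier transform *)

Section reconstruction.
Variables psi phi : V -> R[i].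
Hypotheses (Spsi : S_omega w psi) (Sphi : S_omega w phi).

Let th y := conjc (phi y).
Let Sth : S_omega w th := S_omega_conj Sphi.
Let rp := (S_omega_rapid hw Spsi).1.
Let rfp := (S_omega_rapid hw Spsi).2.
Let rphi := (S_omega_rapid hw Sphi).1.

Let ccont_u : ccont (fun q : 'rV[R]_(n + n) =>
  cintegral (fun y => psi y * TF th (lsubmx q) (rsubmx q) y)).
Proof.
have [lu [l [m [C [l0 C0 bu]]]]] := pairing_linear_bounded Spsi.
exact: (ccont_functional hw lu C0 bu Sth).
Qed.

Lemma cmeas_Vf d (Z : measurableType d) (a b : Z -> V) :
  (forall i, measurable_fun setT (fun z => a z 0 i : measurableTypeR R)) ->
  (forall i, measurable_fun setT (fun z => b z 0 i : measurableTypeR R)) ->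
  cmeas (fun z => Vf psi phi (a z) (b z)).
Proof.
move=> ma mb.
have mc := measurable_row_mx ma (measurable_oppr_row mb).
have := cmeas_comp_row mc ccont_u; congr cmeas; apply/funext => z.
rewrite row_mxKl row_mxKr /Vf; congr cintegral; apply/funext => y.
by rewrite -conj_TF.
Qed.

Definition normsq (g : V -> R[i]) : R := \int[L]_t (normc (g (rowt t)) ^+ 2).

Let h a y := psi y * conjc (phi (y - a)).

(** For fixed a the inversion formula can now be applied in the variable b. *)
Let VfE a b : Vf psi phi a b = fourier (h a) b.
Proof.
rewrite /Vf /fourier; congr cintegral; apply/funext => y.
by rewrite /TF /h conjcM expi_conj mulrCA.
Qed.

(** Fourier inversion for [h a] at y, multiplied by phi(y - a). Integrability of the transform of
    [h a] is read off from [Vf_decay] through [VfE]. *)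
Let inner a y : cintegral (fun b => Vf psi phi a b * TF phi a b y) =
  ((2 * pi) ^+ n)%:C%C * psi y * (normc (phi (y - a)) ^+ 2)%:C%C.
Proof.
have rtr : rapid (fun y => phi (y - a)).
  have := rapid_TF hw a 0 rphi; congr rapid; apply/funext => x.
  rewrite /TF (_ : dotv x 0 = 0) ?expi0 ?mul1r//.
  by rewrite /dotv big1// => i _; rewrite mxE mulr0.
have rctr := rapid_conj rtr.
have ch : ccont (h a) by apply: ccontM; exact: rapid_ccont.
have [M M0 HM] : exists2 M : R, 0 < M & forall x, normc (h a x) <= M.
  have [A A0 HA] := decays_bounded (rp.2 [::]).
  have [B B0 HB] := decays_bounded (rctr.2 [::]).
  exists (A * B); first exact: mulr_gt0.
  by move=> x; rewrite /h Normc.normcM; apply: ler_pM; rewrite ?normc_ge0//; exact: HB.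
have Ih : vcint (h a) by exact: vcint_mul rp rctr.
have Ifh : vcint (fourier (h a)).
  have [C C0 HC] := Vf_decay ler01 Spsi Sphi.
  have [K K0 HK] := expNW_le_cauchyn hw n.
  apply: (cintble_le _ _ (rintZ (C * K) (@vint_cauchyn R n).1)).
    have := cmeas_Vf (fun i => measurable_cst_row a i) (@measurable_rowt R n).
    by congr cmeas; apply/funext => t; rewrite VfE.
  move=> t; rewrite /comp -VfE -mulrA.
  apply: (@le_trans _ _ (C * expR (- W (rowt t)))); last first.
    by rewrite ler_wpM2l ?(ltW C0).
  rewrite expRN ler_pdivlMr ?expR_gt0//; apply: le_trans (HC a (rowt t)).
  by rewrite ler_wpM2l ?normc_ge0// ler_expR mul1r lerDr W_ge0.
have E := fourier_inversion ch HM Ih Ifh y.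
rewrite -mul_conjc [phi _ * _]mulrC mulrA -[X in _ = X * _]mulrA -/(h a y) -E.
rewrite !cintegralE -cintZr; last first.
  apply: (cintble_le _ _ (cintble_norm Ifh)).
    apply: cmeasM; last exact: cintble_cmeas Ifh.
    by apply: cmeas_expi_dotv; [exact: measurable_cst_row|exact: measurable_rowt].
  by move=> t; rewrite /comp Normc.normcM normc_expi mul1r.
by congr cint; apply/funext => t; rewrite /comp VfE /TF; ring.
Qed.

Let profile (z : n.-tuple (measurableTypeR R) * n.-tuple (measurableTypeR R)) : R :=
  cauchyn (rowt z.1) * cauchyn (rowt z.2).

(** [inner] integrates out b; what remains is the integral of |phi(y - a)|^2 over a, which the
    reflection a |-> y - a turns into [normsq phi]. *)
Lemma stft_inversion y :
  cint (L \x L)%E (fun z => Vf psi phi (rowt z.1) (rowt z.2) *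
    TF phi (rowt z.1) (rowt z.2) y) =
  ((2 * pi) ^+ n * normsq phi)%:C%C * psi y.
Proof.
have [C C0 HC] := Vf_decay ler01 Spsi Sphi.
have [K K0 HK] := expNW_le_cauchyn hw n.
have [B B0 HB] := decays_bounded (rphi.2 [::]).
pose F z := Vf psi phi (rowt z.1) (rowt z.2) * TF phi (rowt z.1) (rowt z.2) y.
have mF : cmeas F.
  apply: cmeasM.
    by apply: cmeas_Vf; [exact: measurable_rowt1|exact: measurable_rowt2].
  by apply: (cmeas_TF [::] y rphi); [exact: measurable_rowt1|exact: measurable_rowt2].
have bF z : normc (F z) <= (C * B * K * cauchyn (rowt z.1)) * (K * cauchyn (rowt z.2)).
  rewrite /F Normc.normcM.
  have -> : C * B * K * cauchyn (rowt z.1) * (K * cauchyn (rowt z.2)) =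
    (C * ((K * cauchyn (rowt z.1)) * (K * cauchyn (rowt z.2)))) * B by ring.
  apply: ler_pM; rewrite ?normc_ge0//; last first.
    by rewrite /TF Normc.normcM normc_expi mul1r; exact: HB.
  apply: (@le_trans _ _ (C * (expR (- W (rowt z.1)) * expR (- W (rowt z.2))))).
    by rewrite -expRD -opprD expRN ler_pdivlMr ?expR_gt0//;
      have := HC (rowt z.1) (rowt z.2); rewrite mul1r.
  by rewrite ler_wpM2l ?(ltW C0)//; apply: ler_pM; rewrite ?expR_ge0.
have Ic := (@vint_cauchyn R n).1.
rewrite (cint_prod1 (rintZ (C * B * K) Ic) (rintZ K Ic) mF bF).
have -> : (fun x => cint L (fun t => F (x, t))) = (fun x =>
    (((2 * pi) ^+ n)%:C%C * psi y) * (normc (phi (y - rowt x)) ^+ 2)%:C%C).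
  by apply/funext => x; rewrite -(inner (rowt x) y).
have Isq : vint (fun x => normc (phi x) ^+ 2).
  apply: (rint_le _ _ (rintZ B (cintble_norm (rapid_vcint hw rphi)))).
    apply: measurable_funX; apply: measurable_normc.
    exact: ccont_vcmeas (rapid_ccont rphi).
  by move=> t; rewrite /comp ger0_norm ?sqr_ge0// expr2 ler_wpM2r ?normc_ge0.
have m1 : (-1 : R) != 0 by rewrite oppr_eq0 oner_eq0.
have [Ia Ea] := vint_affine y m1 Isq.
have yE x : y + (-1) *: x = y - x by rewrite scaleN1r.
have Iy : rint L (fun t => normc (phi (y - rowt t)) ^+ 2).
  by have := Ia; congr rint; apply/funext => t; rewrite /comp yE.
rewrite cintZ; last by split => //; exact: integrable0.
rewrite [LHS]mulrAC; congr (_ * _).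
rewrite [RHS]rmorphM; congr (_ * _); apply: complex_eq => /=; last by rewrite Rintegral_cst// mul0r.
rewrite /normsq -[RHS]mul1r -[X in _ = X * _](_ : `|(-1 : R)| ^- n = 1); last first.
  by rewrite normrN1 expr1n invr1.
by rewrite -Ea; apply: eq_Rintegral => t _; rewrite yE.
Qed.

End reconstruction.

(** By continuity |phi| stays above half of |phi(y0)| on a box of radius r, whose measure is (2 r)^n
    > 0 by [lebesgue_tuple_box]. *)
Lemma normsq_gt0 phi : rapid phi -> phi <> cst 0 -> 0 < normsq phi.
Proof.
move=> rphi phi0.
have [y0 py0] : exists y0, phi y0 != 0.
  apply: contrapT => H; apply: phi0; apply/funext => y.
  by apply/eqP; apply: contrapT => /negP yn; apply: H; exists y.
set q := normc (phi y0).
have q0 : 0 < q.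
  rewrite lt_neqAle normc_ge0 andbT eq_sym; apply/eqP => /Normc.eq0_normc p0.
  by rewrite p0 eqxx in py0.
(* A quarter for each of the real and imaginary parts, so that the modulus loses at most half. *)
have q4 : 0 < q / 4 by rewrite divr_gt0.
have [c1 c2] := rapid_ccont rphi.
have near1 (k : V -> R) : continuous k -> exists2 r, 0 < r &
    forall y, box y0 r y -> `|k y0 - k y| < q / 4.
  move=> ck; have : nbhs y0 (k @^-1` ball (k y0) (q / 4)).
    by apply: ck; exact: nbhsx_ballx.
  by move=> /nbhs_box[r r0 H]; exists r => // y /H.
have [r1 r10 H1] := near1 _ c1; have [r2 r20 H2] := near1 _ c2.
set r := Num.min r1 r2; have r0 : 0 < r by rewrite lt_min r10.
pose B : set (n.-tuple (measurableTypeR R)) := @rowt R n @^-1` box y0 r.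
have mB : measurable B by apply: measurable_box; exact: measurable_rowt.
have phiB t : B t -> q / 2 <= normc (phi (rowt t)).
  move=> Bt.
  have h1 := H1 _ (box_le (le_trans (lexx _) (ltac:(by rewrite /r ge_min lexx) : r <= r1)) Bt).
  have h2 := H2 _ (box_le (le_trans (lexx _) (ltac:(by rewrite /r ge_min lexx orbT) : r <= r2)) Bt).
  have : q <= normc (phi y0 - phi (rowt t)) + normc (phi (rowt t)).
    by rewrite /q -{1}(subrK (phi (rowt t)) (phi y0)); exact: le_normcD.
  have := le_normc_ReIm (phi y0 - phi (rowt t)); rewrite cReD cImD cReN cImN.
  by move: h1 h2; lra.
have [M M0 HM] := decays_bounded (rphi.2 [::]).
have Isq : rint L (fun t => normc (phi (rowt t)) ^+ 2).
  apply: (rint_le _ _ (rintZ M (cintble_norm (rapid_vcint hw rphi)))).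
    apply: measurable_funX; apply: measurable_normc.
    exact: ccont_vcmeas (rapid_ccont rphi).
  by move=> t; rewrite /comp ger0_norm ?sqr_ge0// expr2 ler_wpM2r ?normc_ge0.
have le1 t : \1_B t * (q / 2) ^+ 2 <= normc (phi (rowt t)) ^+ 2.
  have [tB|tB] := boolP (t \in B); last by rewrite indicE (negbTE tB) mul0r sqr_ge0.
  rewrite indicE tB mul1r; apply: lerXn2r; rewrite ?nnegrE ?normc_ge0//.
    by rewrite divr_ge0// ltW.
  by apply: phiB; exact: set_mem.
have I1 : rint L (fun t => \1_B t * (q / 2) ^+ 2).
  apply: (rint_le _ _ Isq).
    by apply: measurable_funM; [exact: measurable_indic|exact: measurable_cst].
  by move=> t; rewrite ger0_norm; [exact: le1|rewrite indicE mulr_ge0 ?ler0n ?sqr_ge0].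
apply: lt_le_trans (le_rint I1 Isq le1).
rewrite -Rintegral_cut Rintegral_cst// mulr_gt0 ?exprn_gt0 ?divr_gt0//.
have -> : B = [set t | forall i, ball (y0 0 i) r (tnth t i)].
  apply/seteqP; split => t /= Ht i; have := Ht i; rewrite rowtE /ball /= distrC//.
have mball i : measurable (ball (y0 0 i) r : set (measurableTypeR R)) by exact: measurable_ball.
rewrite [ltRHS](congr1 fine (lebesgue_tuple_box mball)) (eq_bigr (fun=> (r *+ 2)%:E)); last first.
  by move=> i _; rewrite lebesgue_measure_ball// ltW.
rewrite -(big_morph EFin EFinM erefl) /= prodr_const.
by rewrite exprn_gt0// mulrn_wgt0.
Qed.

End short_time_fourier.

(** * The wave front set *)

(* The canonical sigma-finite structure of [m1 \x m2] is shadowed by an instance for pairs of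
   finite measures, hence the definition. *)
Definition phase_measure (R : realType) (n : nat) :
    set (n.-tuple (measurableTypeR R) * n.-tuple (measurableTypeR R)) -> \bar R :=
  (lebesgue_tuple R n \x lebesgue_tuple R n)%E.
Arguments phase_measure : clear implicits.

Section phase_measure.
Context {R : realType} (n : nat).

HB.instance Definition _ := Measure.on (phase_measure R n).

Let sigma_finite_phase_measure : sigma_finite setT (phase_measure R n).
Proof.
have /sigma_finiteP[F [TF ndF Foo]] := sigma_finiteT (lebesgue_tuple R n).
exists (fun k => F k `*` F k) => [|k].
  apply/esym; rewrite -subTset => -[x y] _.
  have [i _ Fix] : (\bigcup_k F k) x by rewrite -TF.
  have [j _ Fjy] : (\bigcup_k F k) y by rewrite -TF.
  exists (maxn i j) => //; split => /=.
  - by move: x Fix; exact/subsetPset/ndF/leq_maxl.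
  - by move: y Fjy; exact/subsetPset/ndF/leq_maxr.
have [mF ltF] := Foo k; split; first exact: measurableX.
by rewrite [ltLHS]product_measure1E// lte_mul_pinfty// ge0_fin_numE.
Qed.

HB.instance Definition _ := Measure_isSigmaFinite.Build _ _ _ (phase_measure R n)
  sigma_finite_phase_measure.

End phase_measure.

Section wave_front_set.
Context {R : realType} (w : R -> R).
Hypothesis hw : nonquasianalytic_subadditive_weight w.
Context {n : nat}.
Local Notation V := 'rV[R]_n.
Local Notation L := (lebesgue_tuple R n).
Local Notation W := (W w).
Local Notation mu := (phase_measure R n).
Local Notation Z := (n.-tuple (measurableTypeR R) * n.-tuple (measurableTypeR R))%type.
Variables (u : (V -> R[i]) -> R[i]) (phi : V -> R[i]).
Hypotheses (du : S_omega_dual w u) (Sphi : S_omega w phi).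

Let th y := conjc (phi y).
Let Sth : S_omega w th := S_omega_conj hw Sphi.

(** The bracket conjugates the test function, which conjugates the window and reverses the
    frequency; V_phi u thus becomes the linear u on shifts of [th]. *)
Lemma stftE z : stft phi u z = u (TF th (lsubmx z) (- rsubmx z)).
Proof. exact: (congr1 u (conj_TF phi (lsubmx z) (rsubmx z))). Qed.

Definition stft_decays :=
  forall l, 0 < l -> exists C, forall z, expR (l * W z) * normc (stft phi u z) <= C.

(* The bounds on the cones are uniform because finitely many cones cover the unit sphere. *)
Lemma WF'_eq0_decays : WF' w phi u = set0 -> stft_decays.
Proof.
move=> WF0.
have /choice[G GP] : forall z : 'rV[R]_(n + n), exists G : set 'rV[R]_(n + n),
    z != 0 -> [/\ open G, conic G, G z & forall l, 0 < l ->
      has_ubound [set expR (l * w (enorm z)) * normc (stft phi u z) | z in G]].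
  move=> z; have [->|z0] := eqVneq z 0; first by exists set0.
  have WFz : ~ WF' w phi u z by rewrite WF0.
  apply: contrapT => nG; apply: WFz; split => // -[G [oG cG _ Gz bG]].
  by apply: nG; exists G => _; split.
have sphere_neq0 z : `|z| = 1 -> z != 0 :> 'rV[R]_(n + n).
  by move=> z1; rewrite -normr_eq0 z1 oner_eq0.
(* This is the sphere of the sup norm, which serves as well: every nonzero z is a positive multiple
   of one of its points. *)
have : compact [set z : 'rV[R]_(n + n) | `|z| = 1].
  apply: bounded_closed_compact.
    by exists 1; split => [|M M1 x /= ->]; [exact: num_real|exact: ltW].
  exact: (continuous_closedP _).1 (@norm_continuous _ _) _ (@closed_eq R 1).
rewrite compact_cover => /(_ _ [set z | `|z| = 1] G)[].
- by move=> z /sphere_neq0 /GP[].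
- by move=> z z1; exists z => //; have [] := GP z (sphere_neq0 z z1).
move=> D sD KD l l0.
have [C HC] : exists C, forall q, q \in finmap.enum_fset D -> q != 0 ->
    forall z, G q z -> expR (l * W z) * normc (stft phi u z) <= C.
  elim: (finmap.enum_fset D) => [|q s [C HC]]; first by exists 0.
  have [q0|q0] := eqVneq q 0.
    exists C => p; rewrite inE => /predU1P[->|]; last exact: HC.
    by rewrite q0 eqxx.
  have [_ _ _ /(_ l l0)[C' HC']] := GP q q0.
  exists (Num.max C' C) => p; rewrite inE => /predU1P[->|ps] p0 z Gz.
    by rewrite le_max HC'//; exists z.
  by rewrite le_max (HC p ps p0)// orbT.
(* The origin has no direction and gets a bound of its own. *)
exists (Num.max C (expR (l * W (0 : 'rV[R]_(n + n))) * normc (stft phi u 0))) => z.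
rewrite le_max; have [->|z0] := eqVneq z 0; first by rewrite lexx orbT.
have nz : 0 < `|z| by rewrite normr_gt0.
have [|q /= qD Gq] := KD (`|z|^-1 *: z).
  by rewrite /= normrZ normfV normr_id mulVf// gt_eqF.
have q0 : q != 0 by apply: sphere_neq0; exact: set_mem (sD q qD).
rewrite (HC q)//; have [_ cG _ _] := GP q q0.
by have := cG `|z| _ nz Gq; rewrite scalerA mulfV ?gt_eqF// scale1r.
Qed.

Lemma S_omega_stft_decays : in_S_omega w u -> stft_decays.
Proof.
move=> [f Sf uf] l l0; have [C C0 HC] := Vf_decay hw (ltW l0) Sf Sphi.
exists C => z; rewrite /stft uf; last exact: (S_omega_TF hw Sphi).
apply: le_trans (HC (lsubmx z) (rsubmx z)).
rewrite mulrC ler_wpM2l ?normc_ge0// ler_expR ler_wpM2l ?(ltW l0)//.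
by rewrite -{1}(hsubmxK z); exact: W_row_mx.
Qed.

(** The punctured space itself is an admissible cone around every point. *)
Lemma decays_WF'_eq0 : stft_decays -> WF' w phi u = set0.
Proof.
move=> H; rewrite -subset0 => z [z0]; apply; exists [set z | z != 0]; split => //.
- rewrite (_ : [set z | z != 0] = Num.norm @^-1` [set r : R | r != 0]).
    by apply: open_comp; [move=> x _; exact: norm_continuous|exact: open_neq].
  by apply/seteqP; split => q /=; rewrite normr_eq0.
- by move=> t q t0 /= q0; rewrite scaler_eq0 negb_or gt_eqF.
- by move=> l /H[C HC]; exists C => _ [q _ <-]; exact: HC.
Qed.

Let profile (z : Z) : R := cauchyn (rowt z.1) * cauchyn (rowt z.2).

Let profile_ge0 z : 0 <= profile z.
Proof. by rewrite mulr_ge0 ?cauchyn_ge0. Qed.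

Let rint_profile : rint mu profile.
Proof. exact: (rint_prodM (@vint_cauchyn R n).1 (@vint_cauchyn R n).1). Qed.

(** The unit of exponent beyond [|l|] is given up: exp(-w(a) - w(b)) is at most a multiple of
    [profile]. *)
Let beats_profile (G : Z -> R[i]) :
  (forall l, 0 < l -> exists C, forall z,
    normc (G z) * expR (l * (W (rowt z.1) + W (rowt z.2))) <= C) ->
  beats_weight w profile G (fun z => rowt z.1) (fun z => rowt z.2).
Proof.
move=> H l; have l1 : 0 < `|l| + 1 by rewrite ltr_wpDl.
have [C HC] := H _ l1; have [K K0 HK] := expNW_le_cauchyn hw n.
exists ((`|C| + 1) * (K * K)) => [|z]; first by rewrite !mulr_gt0// ltr_wpDl.
set S := W _ + W _; have S0 : 0 <= S by rewrite addr_ge0 ?W_ge0.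
apply: (@le_trans _ _ (normc (G z) * expR ((`|l| + 1) * S) * expR (- S))).
  rewrite -mulrA -expRD ler_wpM2l ?normc_ge0// ler_expR mulrDl mul1r addrK.
  by rewrite ler_wpM2r// ler_norm.
rewrite -[leRHS]mulrA; apply: ler_pM; rewrite ?mulr_ge0 ?normc_ge0 ?expR_ge0//.
  by apply: (le_trans (HC z)); rewrite ler_wpDr// ler_norm.
by rewrite /profile /S opprD expRD mulrACA; apply: ler_pM; rewrite ?expR_ge0.
Qed.

Let Gu (z : Z) := stft phi u (row_mx (rowt z.1) (rowt z.2)).

Let GuE z : Gu z = u (TF th (rowt z.1) (- rowt z.2)).
Proof. by rewrite /Gu stftE row_mxKl row_mxKr. Qed.

Lemma cmeas_stft d (X : measurableType d) (a b : X -> V) :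
  (forall i, measurable_fun setT (fun x => a x 0 i : measurableTypeR R)) ->
  (forall i, measurable_fun setT (fun x => b x 0 i : measurableTypeR R)) ->
  cmeas (fun x => stft phi u (row_mx (a x) (b x))).
Proof.
move=> ma mb; have [lu [l [m [C [l0 C0 bu]]]]] := dual_bounded hw du.
have mc := measurable_row_mx ma (measurable_oppr_row mb).
have := cmeas_comp_row mc (ccont_functional hw lu C0 bu Sth).
by congr cmeas; apply/funext => z; rewrite row_mxKl row_mxKr stftE row_mxKl row_mxKr.
Qed.

Hypothesis dec : stft_decays.
Hypothesis phi0 : phi <> cst 0.


(** w(a) and w(b) are each at most w(z), so the exponent 2 l in z covers l (w(a) + w(b)). *)
Let beats_Gu : beats_weight w profile Gu (fun z => rowt z.1) (fun z => rowt z.2).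
Proof.
apply: beats_profile => l l0.
have l20 : 0 < l + l by rewrite addr_gt0.
have [C HC] := dec l20; exists C => z; apply: le_trans (HC (row_mx (rowt z.1) (rowt z.2))).
rewrite mulrC ler_wpM2r ?normc_ge0// ler_expR mulrDr mulrDl.
by apply: lerD; rewrite ler_wpM2l ?(ltW l0)//; [exact: W_row_mx_l|exact: W_row_mx_r].
Qed.

Let mGu : cmeas Gu.
Proof. by apply: cmeas_stft; [exact: measurable_rowt1|exact: measurable_rowt2]. Qed.

Let rint_Gu : rint mu (fun z => normc (Gu z)).
Proof.
have [C C0 HC] := beats_Gu 0; apply: (rint_le _ _ (rintZ C rint_profile)).
  exact: measurable_normc.
move=> z; rewrite ger0_norm ?normc_ge0//.
by have := HC z; rewrite mul0r expR0 mulr1.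
Qed.

Let m1 i : measurable_fun setT (fun z : Z => rowt z.1 0 i : measurableTypeR R).
Proof. exact: measurable_rowt1. Qed.

Let m2 i : measurable_fun setT (fun z : Z => rowt z.2 0 i : measurableTypeR R).
Proof. exact: measurable_rowt2. Qed.

(** The constant of [stft_inversion], by which the representing function has to be divided. *)
Let k : R := (2 * pi) ^+ n * normsq phi.

Let k_neq0 : k != 0.
Proof.
have nphi := normsq_gt0 hw (S_omega_rapid hw Sphi).1 phi0.
by rewrite mulf_neq0 ?gt_eqF// exprn_gt0// mulr_gt0// pi_gt0.
Qed.

Let f := synth mu Gu (fun z => rowt z.1) (fun z => rowt z.2) phi.

Let Sf : S_omega w f.
Proof. exact: (S_omega_synth hw rint_profile profile_ge0 mGu m1 m2 beats_Gu Sphi). Qed.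

(** Fubini moves the pairing with psi inside the superposition, where it becomes the conjugate of
    [Vf psi phi]. *)
Let pairing_f psi : S_omega w psi ->
  cintegral (fun y => f y * conjc (psi y)) =
  cint mu (fun z => Gu z * conjc (Vf psi phi (rowt z.1) (rowt z.2))).
Proof.
move=> Spsi; have [rpsi _] := S_omega_rapid hw Spsi; have [rphi _] := S_omega_rapid hw Sphi.
have [M M0 HM] := decays_bounded (rphi.2 [::]).
pose F (p : n.-tuple (measurableTypeR R) * Z) : R[i] :=
  Gu p.2 * TF phi (rowt p.2.1) (rowt p.2.2) (rowt p.1) * conjc (psi (rowt p.1)).
have p1 i : measurable_fun setT
    (fun p : n.-tuple (measurableTypeR R) * Z => rowt p.1 0 i : measurableTypeR R).
  exact: measurable_rowt1.
have p21 i : measurable_fun setT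
    (fun p : n.-tuple (measurableTypeR R) * Z => rowt p.2.1 0 i : measurableTypeR R).
  exact: (measurableT_comp (m1 i) measurable_snd).
have p22 i : measurable_fun setT
    (fun p : n.-tuple (measurableTypeR R) * Z => rowt p.2.2 0 i : measurableTypeR R).
  exact: (measurableT_comp (m2 i) measurable_snd).
have mF : cmeas F.
  apply: cmeasM; last first.
    by apply: cmeas_conj; exact: (cmeas_comp_row p1 (rapid_ccont rpsi)).
  apply: cmeasM; first exact: (cmeas_stft p21 p22).
  apply: cmeasM; first exact: (cmeas_expi_dotv p1 p22).
  apply: (cmeas_comp_row _ (rapid_ccont rphi)).
  by apply: measurable_addr_row => //; exact: measurable_oppr_row.
have bF p : normc (F p) <= M * normc (psi (rowt p.1)) * normc (Gu p.2).
  rewrite /F /TF !Normc.normcM normc_conj normc_expi mul1r.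
  by rewrite [leRHS]mulrC mulrA ler_wpM2r ?normc_ge0// ler_wpM2l ?normc_ge0.
have Ipsi := rintZ M (cintble_norm (rapid_vcint hw rpsi)).
have swap := cint_swap Ipsi rint_Gu mF bF.
transitivity (cint L (fun t => cint mu (fun z => F (t, z)))).
  rewrite cintegralE; congr cint; apply/funext => t; rewrite /comp /f /synth.
  rewrite -cintZr//.
  exact: (cintble_synth hw rint_profile mGu m1 m2 beats_Gu rphi [::]).
rewrite swap; congr cint; apply/funext => z; rewrite /Vf cintegralE.
have Iz : vcint (fun y => psi y * conjc (TF phi (rowt z.1) (rowt z.2) y)).
  by apply: (vcint_mul hw rpsi); apply: rapid_conj; exact: rapid_TF.
rewrite -(cint_conj Iz) -(cintZ _ (cintble_conj Iz)).
congr cint; apply/funext => t; rewrite /F /comp /= [in RHS]conjcM conjcK; ring.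
Qed.

(** Conjugating [stft_inversion] writes the conjugate of psi as a superposition of shifts of [th] at
    frequency -b. [weak_integral] takes u inside, and there [GuE] recognises V_phi u. *)
Let functional_psi psi : S_omega w psi ->
  u (fun y => conjc (psi y)) =
  (k^-1)%:C%C * cint mu (fun z => Gu z * conjc (Vf psi phi (rowt z.1) (rowt z.2))).
Proof.
move=> Spsi; have [lu [l [m [C [l0 C0 bu]]]]] := dual_bounded hw du.
have [rphi _] := S_omega_rapid hw Sphi.
pose V0 z := Vf psi phi (rowt z.1) (rowt z.2); pose V1 z := conjc (V0 z).
have bV0 : beats_weight w profile V0 (fun z => rowt z.1) (fun z => rowt z.2).
  apply: beats_profile => s s0; have [D D0 HD] := Vf_decay hw (ltW s0) Spsi Sphi.
  by exists D => z; exact: HD.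
have mV0 : cmeas V0 := cmeas_Vf hw Spsi Sphi m1 m2.
have bV1 : beats_weight w profile V1 (fun z => rowt z.1) (fun z => - rowt z.2).
  by move=> s; have [D D0 HD] := bV0 s; exists D => // z; rewrite normc_conj WN.
have mV1 : cmeas V1 by exact: cmeas_conj.
have m2N := measurable_oppr_row m2.
pose g := synth mu V1 (fun z => rowt z.1) (fun z => - rowt z.2) th.
have Sg : S_omega w g.
  exact: (S_omega_synth hw rint_profile profile_ge0 mV1 m1 m2N bV1 Sth).
have psiE : (fun y => conjc (psi y)) = (fun y => (k^-1)%:C%C * g y).
  apply/funext => y; have E := stft_inversion hw Spsi Sphi y.
  have -> : g y = conjc (k%:C%C * psi y).
    rewrite /k -E -cint_conj; last first.
      exact: (cintble_synth hw rint_profile mV0 m1 m2 bV0 rphi [::]).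
    congr cint; apply/funext => z; rewrite conjcM; congr (_ * _).
    exact: esym (congr1 (fun h => h y) (conj_TF phi (rowt z.1) (rowt z.2))).
  by rewrite conjcM conjc_real mulrA -rmorphM (mulVf k_neq0) mul1r.
rewrite psiE (linear_onZ hw lu _ Sg); congr (_ * _).
rewrite (weak_integral hw lu l0 C0 bu Sth rint_profile profile_ge0 mV1 m1 m2N bV1).
by congr cint; apply/funext => z; rewrite GuE mulrC.
Qed.

(** [functional_psi] and [pairing_f] express both sides by the same phase-space integral. *)
Lemma stft_decays_S_omega : in_S_omega w u.
Proof.
exists (fun y => (k^-1)%:C%C * f y); first exact: S_omegaZ.
move=> psi Spsi; rewrite /bracket (functional_psi Spsi) -(pairing_f Spsi).
have [rf _] := S_omega_rapid hw Sf; have [rpsi _] := S_omega_rapid hw Spsi.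
rewrite !cintegralE -(cintZ _ (vcint_mul hw rf (rapid_conj rpsi))).
by congr cint; apply/funext => t; rewrite /comp mulrA.
Qed.

End wave_front_set.

Theorem proposition3p18 (R : realType) (d : nat) (w : R -> R)
    (u : ('rV[R]_d -> R[i]) -> R[i]) (phi : 'rV[R]_d -> R[i]) :
  (0 < d)%N ->
  nonquasianalytic_subadditive_weight w ->
  S_omega_dual w u ->
  window w phi ->
  WF' w phi u = set0 <-> in_S_omega w u.
Proof.
move=> _ hw du [Sphi phi0]; split => [WF0|Su].
  exact: (stft_decays_S_omega hw du Sphi (WF'_eq0_decays WF0) phi0).
exact: decays_WF'_eq0 (S_omega_stft_decays hw Sphi Su).
Qed.
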